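(* Let $(\xi_{\kappa,\iota})_{\kappa\in\mathbb N_0,\ \iota\in I_\kappa}$ be an i.i.d. family of $\mathcal N(0,1)$ random variables on a probability space with probability measure $\mathbf P$. For $\ell\in\mathbb N$ put $$\hat h_\ell:=\sqrt8\,\pi\sum_{\kappa=0}^{\ell-1}\sum_{\iota\in I_\kappa}\xi_{\kappa,\iota}\cdot\mathring{\mathsf G}\,\eta_{\kappa,\iota}.$$ Then: (a) The biharmonic Gaussian field on $\mathbb T^4$ (the centered Gaussian random field with covariance function $k$) is given by $$h:=\sqrt8\,\pi\sum_{\kappa=0}^{\infty}\sum_{\iota\in I_\kappa}\xi_{\kappa,\iota}\cdot\mathring{\mathsf G}\,\eta_{\kappa,\iota}.$$ (b) For every $\epsilon>0$, $\hat h_\ell\to h$ as $\ell\to\infty$ in $L^2(\mathbf P)$ with values in $H^{-\epsilon}(\mathbb T^4)$, i.e. $\mathbf E\big[\|\hat h_\ell-h\|_{H^{-\epsilon}}^2\big]\to0$. In particular, for a.e. $\omega$ and every $\epsilon>0$, $h^\omega\in H^{-\epsilon}(\mathbb T^4)$. (c) For every $u\in H^{-2}(\mathbb T^4)$, the family $(\langle u,\hat h_\ell\rangle)_{\ell\in\mathbb N}$ is a centered $L^2(\mathbf P)$-bounded martingale, and $\langle u,\hat h_\ell\rangle\to\langle u,h\rangle$ in $L^2(\mathbf P)$ as $\ell\to\infty$.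
   Context: $\mathbb T^4=\mathbb R^4/\mathbb Z^4$ is the flat 4-torus and $\mathcal L^4$ its Lebesgue (volume) measure. A function (or distribution) $u$ is called grounded if $\int u\,d\mathcal L^4=0$ (resp. $\langle u,\mathbf 1\rangle=0$); $\mathring L^2(\mathbb T^4)$ denotes the grounded functions in $L^2(\mathbb T^4)$. Sobolev spaces: let $(\varphi_j)_{j\in\mathbb N_0}$ be a complete orthonormal basis of $L^2(\mathbb T^4)$ of eigenfunctions of $-\Delta$ with eigenvalues $\lambda_0=0<\lambda_1\le\lambda_2\le\dots$ (so $\varphi_0$ is constant). For $s\in\mathbb R$, $H^s(\mathbb T^4)=(1-\Delta)^{-s/2}L^2(\mathbb T^4)$ is the usual Sobolev space. The pairing of $u=\sum_j\alpha_j\varphi_j\in H^s$ and $v=\sum_j\beta_j\varphi_j\in H^{-s}$ is $\langle u,v\rangle=\sum_j\alpha_j\beta_j$. Green operator: $\mathring{\mathsf G}$ is the inverse of $-\Delta$ on grounded functions/distributions, $\mathring{\mathsf G}\big(\sum_{j\ge1}\alpha_j\varphi_j\big)=\sum_{j\ge1}\frac{\alpha_j}{\lambda_j}\varphi_j$. On $\mathring L^2$ it is an integral operator $\mathring{\mathsf G}u(x)=\int_{\mathbb T^4}\mathring G(x,y)u(y)\,d\mathcal L^4(y)$ with symmetric kernel $\mathring G$ satisfying $\int\mathring G(x,y)\,d\mathcal L^4(y)=0$ for all $x$ (the grounded Green kernel). Biharmonic field: put $k(x,y)=8\pi^2\int_{\mathbb T^4}\mathring G(x,z)\mathring G(z,y)\,d\mathcal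 L^4(z)$, the integral kernel of the inverse on $\mathring L^2$ of $\frac1{8\pi^2}\Delta^2$, with associated bilinear form $\mathfrak k(u,v)=8\pi^2\sum_{j\ge1}\lambda_j^{-2}\langle u,\varphi_j\rangle\langle v,\varphi_j\rangle$ on $H^{-2}(\mathbb T^4)$. A biharmonic Gaussian field $h$ (centered Gaussian random field with covariance function $k$) is a linear family $(\langle h,u\rangle)_{u\in H^{-2}(\mathbb T^4)}$ of centered Gaussian random variables with $\mathbf E[\langle h,u\rangle^2]=\mathfrak k(u,u)$ for all $u\in H^{-2}(\mathbb T^4)$. Isotropic Haar system: for $\ell\in\mathbb N_0$ let $A_\ell=\{0,1,\dots,2^\ell-1\}^4$, $B_\ell=\{0,1\}^4\setminus\{(0,0,0,0)\}$, $I_\ell=A_\ell\times B_\ell$. For $\iota=(\alpha,\beta)\in I_\ell$ let $\eta_{\ell,\iota}(x)=\eta_{\ell,\alpha,\beta}(x)=\prod_{m=1}^4\tilde\eta_{\ell,\alpha_m,\beta_m}(x_m)$ for $x\in[0,1)^4\cong\mathbb T^4$, where $\tilde\eta_{\ell,a,0}(t)=2^{\ell/2}\,1_{[a,a+1)}(2^\ell t)$ and $\tilde\eta_{\ell,a,1}(t)=2^{\ell/2}\big(1_{[a,a+\frac12)}-1_{[a+\frac12,a+1)}\big)(2^\ell t)$. The functions $\eta_{\ell,\iota}$ ($\ell\in\mathbb N_0$, $\iota\in I_\ell$) form a complete orthonormal system in $\mathring L^2(\mathbb T^4)$. *)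

(* Defs.v *)
From HB Require Import structures.
From mathcomp Require Import all_boot all_order all_algebra.
From mathcomp Require Import all_classical all_reals all_analysis.
Set Implicit Arguments.
Unset Strict Implicit.
Unset Printing Implicit Defensive.
Import Order.TTheory GRing.Theory Num.Theory.
Import numFieldNormedType.Exports.

Local Open Scope classical_set_scope.
Local Open Scope ring_scope.

(* Functions on T^4 = R^4/Z^4 are 1-periodic functions on R^4, integrated over
   the fundamental domain [0,1)^4.  R^4 is the nested product
   ((R * R) * R) * R, which carries both the normed-module structure and the
   product sigma-algebra. *)
Section Torus.
Context {R : realType}.
Local Notation mR := (measurableTypeR R).

Definition coord (x : R * R * R * R) (m : 'I_4) : R :=
  nth 0 [:: x.1.1.1; x.1.1.2; x.1.2; x.2] m.

Definition basis_vec (m : 'I_4) : R * R * R * R :=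
  ((m == 0 :> nat)%:R, (m == 1 :> nat)%:R,
   (m == 2 :> nat)%:R, (m == 3 :> nat)%:R).

(* [measurableTypeR R] is the copy of R on which the library puts the Lebesgue
   measure; it has the same carrier and the same Borel sets. *)
Definition vol4 : {measure set (mR * mR * mR * mR) -> \bar R} :=
  (lebesgue_measure \x lebesgue_measure \x lebesgue_measure
     \x lebesgue_measure)%E.

Definition unit_cell : set (R * R * R * R) :=
  [set x | forall m : 'I_4, 0 <= coord x m < 1].

Implicit Types f g : R * R * R * R -> R.

Definition torus_periodic f :=
  forall x (m : 'I_4), f (x + basis_vec m) = f x.

Definition torus_inner f g : R := \int[vol4]_(x in unit_cell) (f x * g x).

Definition torus_L2 f : Prop :=
  measurable_fun unit_cell (f : mR * mR * mR * mR -> R) /\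
  (\int[vol4]_(x in unit_cell) ((f x) ^+ 2)%:E < +oo)%E.

Definition partial (m : 'I_4) f : R * R * R * R -> R :=
  fun x => 'D_(basis_vec m) f x.

Definition C2 f : Prop :=
  [/\ continuous f,
      forall m, (forall x, derivable f x (basis_vec m)) /\
                continuous (partial m f)
    & forall m n, (forall x, derivable (partial m f) x (basis_vec n)) /\
                  continuous (partial n (partial m f))].

Definition laplacian f : R * R * R * R -> R :=
  fun x => \sum_(m < 4) partial m (partial m f) x.

(* Completeness of the orthonormal system is stated as totality: the only
   element of L^2 orthogonal to all phi_j is 0. *)
Record laplace_eigenbasis (phi : nat -> R * R * R * R -> R) (lam : nat -> R)
    : Prop := LaplaceEigenbasis {
  eigen_periodic : forall j, torus_periodic (phi j);
  eigen_C2 : forall j, C2 (phi j);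
  eigen_eq : forall j x, - laplacian (phi j) x = lam j * phi j x;
  eigen_orthonormal : forall i j, torus_inner (phi i) (phi j) = (i == j)%:R;
  eigen_complete : forall f, torus_L2 f ->
    (forall j, torus_inner f (phi j) = 0) ->
    {ae vol4, forall x, unit_cell x -> f x = 0};
  eigen_lam0 : lam 0%N = 0;
  eigen_lam1 : 0 < lam 1%N;
  eigen_mono : forall i j, (i <= j)%N -> lam i <= lam j }.

End Torus.

(* A distribution u = \sum_j alpha_j phi_j on T^4 is represented by its
   coefficient sequence alpha_j = <u, phi_j> in a fixed eigenbasis; a function
   is embedded through its inner products with the phi_j. *)
Section Distributions.
Context {R : realType}.
Implicit Types (lam u v : nat -> R) (s : R).

Definition coefs (phi : nat -> R * R * R * R -> R) (f : R * R * R * R -> R) :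
  nat -> R := fun j => torus_inner f (phi j).

(* The squared norm of (1 - Delta)^{s/2} u in L^2, possibly +oo. *)
Definition sobolev_sqnorm lam s u : \bar R :=
  (\sum_(0 <= j <oo) ((1 + lam j) `^ s * u j ^+ 2)%:E)%E.

Definition sobolev lam s : set (nat -> R) :=
  [set u | (sobolev_sqnorm lam s u < +oo)%E].

Definition pairing u v : R := limn (series (fun j => u j * v j)).

Definition green lam u : nat -> R :=
  fun j => if j == 0%N then 0 else u j / lam j.

(* The form k(u,v) = 8 pi^2 \sum_{j >= 1} lam_j^{-2} <u,phi_j> <v,phi_j>. *)
Definition biharmonic_form lam u v : R :=
  8 * pi ^+ 2 *
    limn (series (fun j => (lam j.+1) ^- 2 * u j.+1 * v j.+1)).

Definition unit_coef (j : nat) : nat -> R := fun i => (i == j)%:R.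

End Distributions.

Section Haar.
Context {R : realType}.

Definition haar_index (l : nat) : finType :=
  {i : {ffun 'I_4 -> 'I_(2 ^ l)} * {ffun 'I_4 -> bool}
     | i.2 != [ffun=> false]}.

Definition haar1 (l a : nat) (b : bool) (t : R) : R :=
  let y := 2 ^+ l * t in
  2 `^ (l%:R / 2) *
  (if b then \1_(`[a%:R, a%:R + 2^-1[) y - \1_(`[a%:R + 2^-1, a%:R + 1[) y
   else \1_(`[a%:R, a%:R + 1[) y).

Definition haar (l : nat) (i : haar_index l) (x : R * R * R * R) : R :=
  \prod_(m < 4) haar1 l ((val i).1 m) ((val i).2 m) (coord x m).

End Haar.

Section Probability.
Context {R : realType} {d : measure_display} {T : measurableType d}
        (P : probability T R).

Definition mutually_independent (I : eqType) (X : I -> T -> R) : Prop :=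
  forall (J : seq I) (A : I -> set R), uniq J ->
    (forall i, i \in J -> measurable (A i)) ->
    P (\bigcap_(i in [set` J]) (X i @^-1` A i))
    = (\prod_(i <- J) P (X i @^-1` A i))%E.

Definition iid_std_normal (I : eqType) (X : I -> {RV P >-> R}) : Prop :=
  (forall i A, measurable A -> distribution P (X i) A = normal_prob 0 1 A) /\
  mutually_independent (fun i => X i : T -> R).

(* [normal_prob 0 0] is not the Dirac mass at 0, hence the case split. *)
Definition centered_gaussian (X : {RV P >-> R}) : Prop :=
  exists2 s : R, 0 <= s & forall A, measurable A ->
    distribution P X A = if s == 0 then dirac (0 : R) A else normal_prob 0 s A.

(* Elements of H^{-2} are combined coefficientwise; linearity of the family
   of random variables is almost sure. *)
Definition biharmonic_field (lam : nat -> R)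
    (h : (nat -> R) -> {RV P >-> R}) : Prop :=
  [/\ forall (a b : R) (u v : nat -> R),
        sobolev lam (- 2) u -> sobolev lam (- 2) v ->
        {ae P, forall w,
           h (fun j => a * u j + b * v j) w = a * h u w + b * h v w},
      forall u, sobolev lam (- 2) u -> centered_gaussian (h u)
    & forall u, sobolev lam (- 2) u ->
        'E_P[fun w => (h u w ^+ 2)%R]%E = (biharmonic_form lam u u)%:E].

(* The random distribution \sum_j <h, phi_j> phi_j of a field h. *)
Definition realization (h : (nat -> R) -> {RV P >-> R}) (w : T) : nat -> R :=
  fun j => h (unit_coef j) w.

Definition martingale (F : nat -> set (set T)) (X : nat -> T -> R) : Prop :=
  [/\ forall n (B : set R), measurable B -> F n (X n @^-1` B),
      forall n, P.-integrable setT (EFin \o X n)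
    & forall m n A, (m <= n)%N -> F m A ->
        (\int[P]_(w in A) (X n w)%:E = \int[P]_(w in A) (X m w)%:E)%E].

Definition centered (X : nat -> T -> R) : Prop :=
  forall n, 'E_P[X n]%E = 0%E.

Definition L2_bounded (X : nat -> T -> R) : Prop :=
  exists C : R, forall n, ('E_P[fun w => (X n w ^+ 2)%R] <= C%:E)%E.

Variable xi : forall k : nat, haar_index k -> {RV P >-> R}.

Definition haar_level (phi : nat -> R * R * R * R -> R) (lam : nat -> R)
    (k : nat) (w : T) : nat -> R :=
  fun j => Num.sqrt 8 * pi *
    \sum_(i : haar_index k) xi i w * green lam (coefs phi (haar i)) j.

Definition haar_field (phi : nat -> R * R * R * R -> R) (lam : nat -> R)
    (l : nat) (w : T) : nat -> R :=
  fun j => \sum_(k < l) haar_level phi lam k w j.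

(* h is the sum over k >= 0 of the [haar_level]s: for each u in H^{-2} the
   series of the random variables <u, haar_level k> converges to <h, u>
   in L^2(P). *)
Definition haar_series_sum (phi : nat -> R * R * R * R -> R) (lam : nat -> R)
    (h : (nat -> R) -> {RV P >-> R}) : Prop :=
  forall u, sobolev lam (- 2) u ->
    (fun l => 'E_P[fun w =>
        ((\sum_(k < l) pairing u (haar_level phi lam k w) - h u w) ^+ 2)%R]%E)
      @ \oo --> 0%E.

Definition haar_filtration (l : nat) : set (set T) :=
  <<s [set A | exists k (i : haar_index k) (B : set R),
         [/\ (k < l)%N, measurable B & A = xi i @^-1` B]] >>.

End Probability.

(* Main.v *)
Require Import Defs.
From HB Require Import structures.
From mathcomp Require Import all_boot all_order all_algebra.
From mathcomp Require Import all_classical all_reals all_analysis.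
From mathcomp Require Import measurable_realfun ring lra.
Set Implicit Arguments.
Unset Strict Implicit.
Unset Printing Implicit Defensive.
Import Order.TTheory GRing.Theory Num.Theory.
Import numFieldNormedType.Exports.
Local Open Scope classical_set_scope.
Local Open Scope ring_scope.

(** Let M_i(j) = <eta_i, phi_j> be the coefficients of the Haar function eta_i,
    and for u in H^{-2} let g = G u, a square-summable sequence with g(0) = 0.
    Moving G from one side of the pairing to the other, the pairing of u with
    the sum of the levels k < l is the finite Gaussian sum
    sqrt 8 pi sum_i xi_i <g, M_i>, of variance 8 pi^2 sum_i <g, M_i>^2.  If the
    Haar system satisfies Parseval's identity on the sequences vanishing at 0,
    these variances increase to 8 pi^2 |g|^2 = k(u,u) and the partial sums are
    Cauchy in L^2; their limit <h, u> is Gaussian of the right variance.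
    Every convergence assertion follows from an explicit bound: the mean square
    distance of the partial sum to its limit is at most 8 pi^2 times the
    Parseval defect |g|^2 - sum_i <g, M_i>^2.

    Parseval's identity ([row_parseval]).  The defect is nonnegative (Bessel) and
    subadditive up to a factor 2, so it suffices to treat the unit sequences,
    that is to show that the Haar energies of phi_j, j > 0, add up to 1.
    The Haar coefficients of level k carry exactly the difference between the
    L^2 norms of the averages over the cubes of side 2^{-k-1} and 2^{-k}
    ([haar_level_energy]), so the sum telescopes, and the averages of a
    continuous function converge to it.  Since eta_i integrates to 0 along
    the lines of some direction, the coefficients of level k are also
    bounded by the gradient ([haar_level_le]), and the gradient of phi_j has
    squared norm lam j ([eigen_gradient]).  Hence the energy of phi_j
    at level l is at least 1 - (64/3) 4^{-l} lam j ([cube_energy_ge]).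

    Sobolev convergence ([sobolev_dist_cvg0]).  Expanding the norm, the expected
    squared H^{-eps} distance is at most 8 pi^2 times the sum over j >= 1 of
    (1 + lam j)^{-eps} (lam j)^{-2} times the defect of the j-th unit sequence.
    Each term tends to 0 as l grows, and dominated convergence applies because
    sum_j (1 + lam j)^{-eps} (lam j)^{-2} is finite ([weyl_summable]).  In
    dimension 4 this is a consequence of lam j >= c sqrt j, which the same
    estimate [cube_energy_ge] yields ([weyl_lower_bound]): the functions constant
    on the cubes of side 2^{-l} form a space of dimension 16^l, so the total
    energy at level l of any number of the phi_j is at most 16^l, whereas each
    phi_j with small lam j contributes nearly 1.

    Probability.  Sums of independent centered normal variables are normal
    because their densities convolve ([gaussian_lin]); mean square limits exist
    by completeness ([L2_limit]) and stay Gaussian, as is seen on distribution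
    functions ([gaussian_law_limit]).  Linearity of the field passes to the
    limit.  The martingale property holds because a variable xi_i of level at
    least m has integral 0 over every event generated by the levels below m
    ([std_integral_sigma]). *)

Local Notation coord := Defs.coord.

(** * Integration over the unit cell *)

Section SigmaFiniteProduct.
Context d1 d2 (T1 : measurableType d1) (T2 : measurableType d2) (R : realType).
Variable m1 : {sigma_finite_measure set T1 -> \bar R}.
Variable m2 : {sigma_finite_measure set T2 -> \bar R}.

(** The fourfold product of Lebesgue measures is nested, so that Tonelli's
    theorem on R^4 needs the product of two sigma-finite measures to carry a
    sigma-finite structure itself. *)
Definition sigma_prod : set (T1 * T2) -> \bar R := (m1 \x m2)%E.

HB.instance Definition _ := Measure.copy sigma_prod (m1 \x m2)%E.

Let sigma_prod_sigma_finite : sigma_finite setT sigma_prod.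
Proof.
have /sigma_finiteP[F [TF ndF Foo]] := sigma_finiteT m1.
have /sigma_finiteP[G [TG ndG Goo]] := sigma_finiteT m2.
exists (fun n => F n `*` G n) => [|k].
  rewrite -setXTT TF TG predeqE => -[x y]; split=> [|[n _ []]/= Fn Gn].
    move=> [/= [n _ Fn] [k _ Gk]]; exists (maxn n k) => //; split => /=.
    - by apply: subsetPset Fn; exact/ndF/leq_maxl.
    - by apply: subsetPset Gk; exact/ndG/leq_maxr.
  by split; exists n.
have [mF Fk] := Foo k; have [mG Gk] := Goo k.
split; first exact: measurableX.
by rewrite /sigma_prod product_measure1E// lte_mul_pinfty// ge0_fin_numE.
Qed.

HB.instance Definition _ := Measure_isSigmaFinite.Build _ _ _ sigma_prod
  sigma_prod_sigma_finite.

End SigmaFiniteProduct.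

Section Tonelli.
Context (R : realType).
Local Notation mR := (measurableTypeR R).
Local Notation leb := (@lebesgue_measure R).
Local Open Scope ereal_scope.

Lemma tonelli_le_right d1 d2 (X : measurableType d1) (Y : measurableType d2)
  (mu : {sigma_finite_measure set X -> \bar R})
  (nu : {sigma_finite_measure set Y -> \bar R}) (F G : X * Y -> \bar R) :
  measurable_fun setT F -> measurable_fun setT G ->
  (forall z, 0 <= F z) -> (forall z, 0 <= G z) ->
  (forall x, \int[nu]_y F (x, y) <= \int[nu]_y G (x, y)) ->
  \int[mu \x nu]_z F z <= \int[mu \x nu]_z G z.
Proof.
move=> mF mG F0 G0 FG; rewrite !fubini_tonelli1//.
apply: ge0_le_integral => //.
- by move=> x _; apply: integral_ge0 => y _.
- exact: measurable_fun_fubini_tonelli_F.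
- exact: measurable_fun_fubini_tonelli_F.
- by move=> x _; exact: FG.
Qed.

Lemma tonelli_le_left d1 d2 (X : measurableType d1) (Y : measurableType d2)
  (mu : {sigma_finite_measure set X -> \bar R})
  (nu : {sigma_finite_measure set Y -> \bar R}) (F G : X * Y -> \bar R) :
  measurable_fun setT F -> measurable_fun setT G ->
  (forall z, 0 <= F z) -> (forall z, 0 <= G z) ->
  (forall y, \int[mu]_x F (x, y) <= \int[mu]_x G (x, y)) ->
  \int[mu \x nu]_z F z <= \int[mu \x nu]_z G z.
Proof.
move=> mF mG F0 G0 FG; rewrite !fubini_tonelli2//.
apply: ge0_le_integral => //.
- by move=> x _; apply: integral_ge0 => y _.
- exact: measurable_fun_fubini_tonelli_G.
- exact: measurable_fun_fubini_tonelli_G.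
- by move=> x _; exact: FG.
Qed.

(** As t varies, the line in direction m through x: integrals over the cell are
    sliced along these lines. *)
Definition upd (m : 'I_4) (x : R * R * R * R) (t : R) : R * R * R * R :=
  (if m == 0%N :> nat then t else x.1.1.1, if m == 1%N :> nat then t else x.1.1.2,
   if m == 2%N :> nat then t else x.1.2, if m == 3%N :> nat then t else x.2).

Lemma measurable_upd m x : measurable_fun setT (upd m x : mR -> mR * mR * mR * mR).
Proof.
case: m => [[|[|[|[|//]]]] Hm]; rewrite /upd /=;
(apply: measurable_fun_pair;
  [apply: measurable_fun_pair; [apply: measurable_fun_pair|]|]);
  first [exact: measurable_id | exact: measurable_cst].
Qed.

Definition vol2 : {sigma_finite_measure set (mR * mR)%type -> \bar R} := sigma_prod leb leb.
Definition vol3 : {sigma_finite_measure set (mR * mR * mR)%type -> \bar R} := sigma_prod vol2 leb.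

(** Comparing integrals over R^4 only requires comparing them along all
    lines in one fixed direction: Tonelli's theorem is applied once for each
    of the nested factors. *)
Lemma vol4_slice_le (m : 'I_4) (F G : mR * mR * mR * mR -> \bar R) :
  measurable_fun setT F -> measurable_fun setT G ->
  (forall z, 0 <= F z) -> (forall z, 0 <= G z) ->
  (forall x, \int[leb]_t F (upd m x t) <= \int[leb]_t G (upd m x t)) ->
  \int[vol4]_z F z <= \int[vol4]_z G z.
Proof.
move=> mF mG F0 G0.
have vol4E (H : mR * mR * mR * mR -> \bar R) :
  \int[vol4]_z H z = \int[vol3 \x leb]_z H z by [].
have mpair d1 d2 (X : measurableType d1) (Y : measurableType d2)
    (H : X * Y -> \bar R) (y : Y) :
    measurable_fun setT H -> measurable_fun setT (fun x => H (x, y)).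
  by move=> mH; apply: (measurableT_comp mH); exact: measurable_fun_pair.
have m1 w := mpair _ _ _ _ F w mF.
have m2 w := mpair _ _ _ _ G w mG.
have m3 w z := mpair _ _ _ _ _ z (m1 w).
have m4 w z := mpair _ _ _ _ _ z (m2 w).
rewrite !{}vol4E; case: m => [[|[|[|[|//]]]] Hm]; rewrite /upd /= => FG.
- apply: (@tonelli_le_left _ _ _ _ vol3 leb F G mF mG F0 G0) => w.
  apply: (@tonelli_le_left _ _ _ _ vol2 leb _ _ (m1 w) (m2 w)) => // z.
  apply: (@tonelli_le_left _ _ _ _ leb leb _ _ (m3 w z) (m4 w z)) => // y.
  exact: (FG (0, y, z, w)%R).
- apply: (@tonelli_le_left _ _ _ _ vol3 leb F G mF mG F0 G0) => w.
  apply: (@tonelli_le_left _ _ _ _ vol2 leb _ _ (m1 w) (m2 w)) => // z.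
  apply: (@tonelli_le_right _ _ _ _ leb leb _ _ (m3 w z) (m4 w z)) => // y.
  exact: (FG (y, 0, z, w)%R).
- apply: (@tonelli_le_left _ _ _ _ vol3 leb F G mF mG F0 G0) => w.
  apply: (@tonelli_le_right _ _ _ _ vol2 leb _ _ (m1 w) (m2 w)) => // -[x y].
  exact: (FG (x, y, 0, w)%R).
- apply: (@tonelli_le_right _ _ _ _ vol3 leb F G mF mG F0 G0) => -[[x y] z].
  exact: (FG (x, y, z, 0)%R).
Qed.

End Tonelli.

Section CellIntegral.
Context (R : realType).
Local Notation mR := (measurableTypeR R).
Local Notation leb := (@lebesgue_measure R).
Local Notation R4 := (R * R * R * R)%type.
Implicit Types f g : R4 -> R.

Lemma unit_cellE (x : R4) : unit_cell x <->
  [/\ 0 <= x.1.1.1 < 1, 0 <= x.1.1.2 < 1, 0 <= x.1.2 < 1 & 0 <= x.2 < 1].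
Proof.
split=> [H|[h0 h1 h2 h3] [[|[|[|[|//]]]] Hm]]; rewrite /coord //=.
have i0 : (0 < 4)%N by []. have i1 : (1 < 4)%N by [].
have i2 : (2 < 4)%N by []. have i3 : (3 < 4)%N by [].
have := (H (Ordinal i0), H (Ordinal i1), H (Ordinal i2), H (Ordinal i3)).
by rewrite /coord /=; case=> -[[]].
Qed.

Lemma unit_cell_setX : @unit_cell R =
  (((`[0, 1[ `*` `[0, 1[) `*` `[0, 1[) `*` `[0, 1[)%classic.
Proof.
apply/seteqP; split=> x /=; rewrite !in_itv /=.
  by move=> /unit_cellE[].
by move=> [[[h0 h1] h2] h3]; apply/unit_cellE.
Qed.

Lemma measurable_unit_cell : measurable (@unit_cell R : set (mR * mR * mR * mR)).
Proof.
rewrite unit_cell_setX; apply: measurableX; last exact: measurable_itv.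
apply: measurableX; last exact: measurable_itv.
by apply: measurableX; exact: measurable_itv.
Qed.

Lemma vol4_unit_cell : vol4 (@unit_cell R) = 1%E.
Proof.
have mI : measurable (`[0, 1[ : set mR) by exact: measurable_itv.
have I1 : leb `[0, 1[%classic = 1%E.
  by rewrite lebesgue_measure_itv /= lte_fin ltr01 oppr0 adde0.
rewrite unit_cell_setX.
have E1 := @product_measure1E _ _ _ _ _ (vol3 R) leb _ _
  (measurableX (measurableX mI mI) mI) mI.
have E2 := @product_measure1E _ _ _ _ _ (vol2 R) leb _ _ (measurableX mI mI) mI.
have E3 := @product_measure1E _ _ _ _ _ leb leb _ _ mI mI.
set J : set mR := `[0, 1[%classic in I1 E1 E2 E3 *.
transitivity (vol3 R (J `*` J `*` J) * 1)%E.
  by rewrite -I1; exact: E1.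
rewrite mule1; transitivity (vol2 R (J `*` J) * 1)%E.
  by rewrite -I1; exact: E2.
by rewrite mule1 -[RHS]mule1 -{1}I1 -I1; exact: E3.
Qed.

(** [torus_inner f g] unfolds to the [cint] of the product, so that all inner
    products are handled through it. *)
Definition cint f : R := \int[vol4]_(x in unit_cell) f x.

(** A class closed under the algebraic operations which contains all the
    functions at hand and whose members are integrable, the cell being of
    volume 1. *)
Definition cell_bounded f : Prop :=
  measurable_fun unit_cell (f : mR * mR * mR * mR -> R) /\
  exists K, forall x, unit_cell x -> `|f x| <= K.

Lemma cell_bounded_integrable f : cell_bounded f ->
  vol4.-integrable unit_cell (EFin \o f : mR * mR * mR * mR -> _).
Proof.
move=> [mf [K fK]]; apply: measurable_bounded_integrable => //.
- exact: measurable_unit_cell.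
- by rewrite vol4_unit_cell ltry.
- exists K; split; first exact: num_real.
  by move=> M KM x /fK/le_trans; apply; exact: ltW.
Qed.

Lemma cell_bounded_cst (c : R) : cell_bounded (fun=> c).
Proof. by split; [exact: measurable_cst | exists `|c|]. Qed.

Lemma cell_boundedD f g : cell_bounded f -> cell_bounded g ->
  cell_bounded (fun x => f x + g x).
Proof.
move=> [mf [K fK]] [mg [L gL]]; split; first exact: measurable_funD.
exists (K + L) => x cx; apply: (le_trans (ler_normD _ _)).
by apply: lerD; [exact: fK | exact: gL].
Qed.

Lemma cell_boundedM f g : cell_bounded f -> cell_bounded g ->
  cell_bounded (fun x => f x * g x).
Proof.
move=> [mf [K fK]] [mg [L gL]]; split; first exact: measurable_funM.
exists (K * L) => x cx; rewrite normrM.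
by apply: ler_pM => //; [exact: fK | exact: gL].
Qed.

Lemma cell_boundedZ c f : cell_bounded f -> cell_bounded (fun x => c * f x).
Proof. by apply: cell_boundedM; exact: cell_bounded_cst. Qed.

Lemma cell_boundedB f g : cell_bounded f -> cell_bounded g ->
  cell_bounded (fun x => f x - g x).
Proof.
move=> bf bg; rewrite (_ : (fun x => _) = (fun x => f x + (-1) * g x)).
  by apply: cell_boundedD => //; exact: cell_boundedZ.
by apply/funext => x; rewrite mulN1r.
Qed.

Lemma cell_bounded_sqr f : cell_bounded f -> cell_bounded (fun x => f x ^+ 2).
Proof. by move=> bf; have := cell_boundedM bf bf. Qed.

Lemma cell_bounded_norm f : cell_bounded f -> cell_bounded (fun x => `|f x|).
Proof.
move=> [mf [K fK]]; split.
  exact: (measurableT_comp (@normr_measurable R setT) mf).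
by exists K => x cx; rewrite normr_id; exact: fK.
Qed.

Lemma cell_bounded_sum (J : Type) (s : seq J) (P : pred J) (F : J -> R4 -> R) :
  (forall j, cell_bounded (F j)) ->
  cell_bounded (fun x => \sum_(j <- s | P j) F j x).
Proof.
move=> bF; elim: s => [|j s IH].
  under [X in cell_bounded X]funext do rewrite big_nil.
  exact: cell_bounded_cst.
under [X in cell_bounded X]funext do rewrite big_cons.
by case: (P j) => //; exact: cell_boundedD.
Qed.

Lemma cell_bounded_prod (J : Type) (s : seq J) (P : pred J) (F : J -> R4 -> R) :
  (forall j, cell_bounded (F j)) ->
  cell_bounded (fun x => \prod_(j <- s | P j) F j x).
Proof.
move=> bF; elim: s => [|j s IH].
  under [X in cell_bounded X]funext do rewrite big_nil.
  exact: cell_bounded_cst.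
under [X in cell_bounded X]funext do rewrite big_cons.
by case: (P j) => //; exact: cell_boundedM.
Qed.

Lemma cint_eq f g : (forall x, unit_cell x -> f x = g x) -> cint f = cint g.
Proof. by move=> fg; apply: eq_Rintegral => x; rewrite inE => /fg. Qed.

Lemma cint_cst c : cint (fun=> c) = c.
Proof.
by rewrite /cint Rintegral_cst ?vol4_unit_cell ?mulr1 //; exact: measurable_unit_cell.
Qed.

Lemma cintD f g : cell_bounded f -> cell_bounded g ->
  cint (fun x => f x + g x) = cint f + cint g.
Proof.
by move=> bf bg; apply: RintegralD;
  [exact: measurable_unit_cell|exact: cell_bounded_integrable..].
Qed.

Lemma cintZ c f : cell_bounded f -> cint (fun x => c * f x) = c * cint f.
Proof.
by move=> bf; apply: RintegralZl;
  [exact: measurable_unit_cell|exact: cell_bounded_integrable].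
Qed.

Lemma cintB f g : cell_bounded f -> cell_bounded g ->
  cint (fun x => f x - g x) = cint f - cint g.
Proof.
by move=> bf bg; apply: RintegralB;
  [exact: measurable_unit_cell|exact: cell_bounded_integrable..].
Qed.

Lemma cint_sum (J : Type) (s : seq J) (P : pred J) (F : J -> R4 -> R) :
  (forall j, cell_bounded (F j)) ->
  cint (fun x => \sum_(j <- s | P j) F j x) = \sum_(j <- s | P j) cint (F j).
Proof.
move=> bF; elim: s => [|j s IH].
  by under eq_fun do rewrite big_nil; rewrite big_nil cint_cst.
under eq_fun do rewrite big_cons; rewrite big_cons; case: (P j) => //.
by rewrite cintD ?IH //; exact: cell_bounded_sum.
Qed.

Lemma cint_le f g : cell_bounded f -> cell_bounded g ->
  (forall x, unit_cell x -> f x <= g x) -> cint f <= cint g.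
Proof.
by move=> bf bg fg; apply: le_Rintegral;
  [exact: measurable_unit_cell|exact: cell_bounded_integrable..|].
Qed.

Lemma cint_ge0 f : (forall x, unit_cell x -> 0 <= f x) -> 0 <= cint f.
Proof. by move=> f0; apply: Rintegral_ge0. Qed.

Lemma upd_cell m (x : R4) t : unit_cell x -> 0 <= t < 1 -> unit_cell (upd m x t).
Proof.
move=> /unit_cellE[h0 h1 h2 h3] ht; apply/unit_cellE; rewrite /upd /=.
by split; case: ifP.
Qed.

Lemma upd_cell_inv m (x : R4) t : unit_cell (upd m x t) -> 0 <= t < 1.
Proof.
case: m => [[|[|[|[|//]]]] Hm] /unit_cellE; rewrite /upd /=; by case.
Qed.

Lemma upd_upd m (x : R4) s t : upd m (upd m x s) t = upd m x t.
Proof.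
by case: m => [[|[|[|[|//]]]] Hm].
Qed.

Definition slice_int (m : 'I_4) f (x : R4) : R :=
  \int[leb]_(t in `[0, 1[) f (upd m x t).

Lemma cell_bounded_slice m f x : cell_bounded f -> unit_cell x ->
  leb.-integrable `[0, 1[ (EFin \o (fun t => f (upd m x t))).
Proof.
move=> [mf [K fK]] cx; apply: measurable_bounded_integrable => //.
- by rewrite /= lebesgue_measure_itv /= lte_fin ltr01 ltry.
- apply: (measurable_comp measurable_unit_cell _ mf).
    by move=> _ [t /= t01 <-]; apply: upd_cell => //; rewrite in_itv in t01.
  by apply: measurable_funTS; exact: measurable_upd.
- exists K; split; first exact: num_real.
  move=> M KM t /=; rewrite in_itv /= => t01.
  by apply: le_trans (ltW KM); apply: fK; exact: upd_cell.
Qed.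

(** Adding a constant K makes a bounded function nonnegative, as
    [vol4_slice_le] requires; the constant contributes K to each slice, the
    slices of the cell being of length 1. *)
Lemma slice_intDcst m f x K : cell_bounded f -> unit_cell x ->
  (\int[leb]_t (((fun y => (f y + K)%:E) \_ unit_cell) (upd m x t)) =
   (slice_int m f x + K)%:E)%E.
Proof.
move=> bf cx.
transitivity (\int[leb]_(t in `[0%R, 1%R[) (f (upd m x t) + K)%:E)%E.
  rewrite [RHS]integral_mkcond; apply: eq_integral => t _.
  rewrite /patch; case: ifPn => [|tn].
    by rewrite inE => /upd_cell_inv t01; rewrite ifT// inE /= in_itv.
  rewrite ifF//; apply: contraNF tn; rewrite !inE /= in_itv /=.
  exact: upd_cell.
have iK : leb.-integrable `[0, 1[ (EFin \o (fun=> K)).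
  apply: measurable_bounded_integrable => //.
    by rewrite /= lebesgue_measure_itv /= lte_fin ltr01 ltry.
  by exists `|K|; split; [exact: num_real | move=> M /ltW KM t _].
have If := cell_bounded_slice m bf cx.
under eq_integral do rewrite EFinD.
rewrite integralD//= /slice_int /Rintegral EFinD fineK; last first.
  exact: integrable_fin_num If.
by congr (_ + _)%E; rewrite integral_cst//= lebesgue_measure_itv /= lte_fin ltr01 oppr0 adde0 mule1.
Qed.

Lemma cintDcst f K : cell_bounded f ->
  (\int[vol4]_x (((fun y => (f y + K)%:E) \_ unit_cell) x) =
   (cint f + K)%:E)%E.
Proof.
move=> bf; rewrite -integral_mkcond.
have bK := cell_bounded_cst K.
rewrite -[in RHS](cint_cst K) -cintD// /cint /Rintegral fineK//.
apply: integrable_fin_num; first exact: measurable_unit_cell.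
exact: (cell_bounded_integrable (cell_boundedD bf bK)).
Qed.

(** Lines that miss the cell contribute nothing; on a line that meets it,
    the slice through a point of the cell is available. *)
Lemma cint_slice_le m f g : cell_bounded f -> cell_bounded g ->
  (forall x, unit_cell x -> slice_int m f x <= slice_int m g x) ->
  cint f <= cint g.
Proof.
move=> bf bg fg.
have [[mf [K fK]] [mg [L gL]]] := (bf, bg).
pose M := Num.max K L.
suff : ((cint f + M)%:E <= (cint g + M)%:E)%E by rewrite lee_fin lerD2r.
rewrite -!cintDcst//.
have M0 h : (forall x, unit_cell x -> `|h x| <= M) ->
    forall x, (0 <= ((fun y => (h y + M)%:E) \_ unit_cell) x)%E.
  move=> hM x; rewrite /patch; case: ifPn => // /set_mem /hM.
  by rewrite lee_fin ler_norml -lerBlDr sub0r => /andP[].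
have fM x : unit_cell x -> `|f x| <= M by move=> /fK /le_trans->//; rewrite le_max lexx.
have gM x : unit_cell x -> `|g x| <= M by move=> /gL /le_trans->//; rewrite le_max lexx orbT.
have mM h : cell_bounded h -> measurable_fun setT
    ((fun y => (h y + M)%:E) \_ unit_cell : mR * mR * mR * mR -> \bar R).
  move=> [mh _]; apply/(measurable_restrictT _ measurable_unit_cell).
  by apply/measurable_EFinP; exact: measurable_funD.
apply: (vol4_slice_le (m := m)) => [||||x]; [exact: mM|exact: mM|exact: M0|exact: M0|].
(* The slice depends on x only through its other coordinates, so that x may be
   moved into the cell along the line. *)
have [[t ct]|nt] := pselect (exists t, unit_cell (upd m x t)).
  have E h := upd_upd m x t h.
  under eq_integral do rewrite -E.
  under [in leRHS]eq_integral do rewrite -E.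
  by rewrite !slice_intDcst// lee_fin lerD2r; exact: fg.
rewrite integral0_eq ?integral_ge0 // => t _; first exact: M0.
by rewrite /patch ifF//; apply/negP; rewrite inE => ct; apply: nt; exists t.
Qed.

Lemma cint_slice_eq m f g : cell_bounded f -> cell_bounded g ->
  (forall x, unit_cell x -> slice_int m f x = slice_int m g x) ->
  cint f = cint g.
Proof.
move=> bf bg fg; apply/eqP; rewrite eq_le; apply/andP; split.
- by apply: (cint_slice_le (m := m)) => // x /fg ->.
- by apply: (cint_slice_le (m := m)) => // x /fg ->.
Qed.

(** The quadratic form of (a, b) given by the integral of (a f - b g)^2 is
    nonnegative, so its discriminant is nonpositive. *)
Lemma cint_cauchy_schwarz f g : cell_bounded f -> cell_bounded g ->
  cint (fun x => f x * g x) ^+ 2 <=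
  cint (fun x => f x ^+ 2) * cint (fun x => g x ^+ 2).
Proof.
move=> bf bg.
pose A := cint (fun x => f x ^+ 2); pose B := cint (fun x => f x * g x).
pose C := cint (fun x => g x ^+ 2).
have H (a b : R) : 0 <= a ^+ 2 * A - 2 * a * b * B + b ^+ 2 * C.
  have : 0 <= cint (fun x => (a * f x - b * g x) ^+ 2).
    by apply: cint_ge0 => x _; exact: sqr_ge0.
  rewrite (_ : (fun x => _) = (fun x => (a ^+ 2 * f x ^+ 2 +
      (- (2 * a * b)) * (f x * g x)) + b ^+ 2 * g x ^+ 2)); last first.
    by apply/funext => x; ring.
  have bff := cell_bounded_sqr bf; have bgg := cell_bounded_sqr bg.
  have bfg := cell_boundedM bf bg.
  rewrite !cintD ?cintZ ?mulNr//; try by repeat (apply: cell_boundedD || apply: cell_boundedZ).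
have A0 : 0 <= A by apply: cint_ge0 => x _; exact: sqr_ge0.
have C0 : 0 <= C by apply: cint_ge0 => x _; exact: sqr_ge0.
rewrite -/A -/B -/C.
have [C00|Cn] := eqVneq C 0.
  rewrite C00 mulr0; have [->|B0] := eqVneq B 0; first by rewrite expr0n.
  have := H 1 ((A + 1) / B); rewrite C00 mulr0 addr0 mulr1 expr1n mul1r.
  by rewrite -mulrA divfK//; lra.
have Cp : 0 < C by rewrite lt_def Cn.
(* The minimizing choice of (a, b). *)
have := H C B; nra.
Qed.

End CellIntegral.

(** * Dyadic cubes and step functions *)

Section Dyadic.
Context (R : realType).
Local Notation mR := (measurableTypeR R).
Local Notation leb := (@lebesgue_measure R).
Local Notation R4 := (R * R * R * R)%type.
Implicit Types (f g : R4 -> R) (l : nat).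

(** The indicator of the dyadic interval [a 2^{-l}, (a+1) 2^{-l}[. *)
Definition dyadic (l a : nat) (t : R) : R := \1_(`[a%:R, a%:R + 1[) (2 ^+ l * t).

Lemma dyadicE l a t : dyadic l a t = (a%:R <= 2 ^+ l * t < a%:R + 1)%R%:R.
Proof. by rewrite /dyadic indicE mem_setE in_itv. Qed.

Lemma dyadic_ge0 l a t : 0 <= dyadic l a t.
Proof. by rewrite dyadicE ler0n. Qed.

Lemma dyadic_sqr l a t : dyadic l a t ^+ 2 = dyadic l a t.
Proof. by rewrite dyadicE; case: andP => _; rewrite ?expr1n ?expr0n. Qed.

Let natr_double a : (a.*2)%:R = 2 * a%:R :> R.
Proof. by rewrite -mul2n natrM. Qed.

Let natr_doubleS a : (a.*2.+1)%:R = 2 * a%:R + 1 :> R.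
Proof. by rewrite -[LHS]natr1 natr_double. Qed.

Lemma dyadic_split l a t :
  dyadic l a t = dyadic l.+1 a.*2 t + dyadic l.+1 a.*2.+1 t.
Proof.
rewrite !dyadicE exprS -mulrA natr_doubleS natr_double.
set y := 2 ^+ l * t.
have [h1|h1] := lerP a%:R y; have [h2|h2] := ltrP y (a%:R + 1);
have [h3|h3] := lerP (2 * a%:R) (2 * y);
have [h4|h4] := ltrP (2 * y) (2 * a%:R + 1);
have [h5|h5] := lerP (2 * a%:R + 1) (2 * y);
have [h6|h6] := ltrP (2 * y) (2 * a%:R + 1 + 1) => //=; rewrite ?addr0 ?add0r //;
exfalso; lra.
Qed.

(** Both one-dimensional Haar functions of level l are signed sums of the two
    halves of a dyadic interval, the sign of the right half depending on b. *)
Lemma haar1E l a b t : haar1 l a b t = 2 `^ (l%:R / 2) *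
  \sum_(s : bool) (-1) ^+ (b && s) * dyadic l.+1 (a.*2 + s) t.
Proof.
rewrite /haar1; congr (_ * _); rewrite big_bool /= andbT andbF addn1 addn0 expr0 mul1r.
case: b; last by rewrite expr0 mul1r addrC -dyadic_split /dyadic.
rewrite expr1 mulN1r addrC !dyadicE !indicE !mem_setE !in_itv /= exprS -mulrA.
rewrite natr_doubleS natr_double; set y := 2 ^+ l * t.
have -> : (2 * a%:R <= 2 * y < 2 * a%:R + 1) = (a%:R <= y < a%:R + 2^-1).
  by apply/idP/idP => /andP[? ?]; apply/andP; split; lra.
have -> // : (2 * a%:R + 1 <= 2 * y < 2 * a%:R + 1 + 1) =
   (a%:R + 2^-1 <= y < a%:R + 1).
by apply/idP/idP => /andP[? ?]; apply/andP; split; lra.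
Qed.

Lemma sum_dyadic l t : 0 <= t < 1 -> \sum_(a < 2 ^ l) dyadic l a t = 1.
Proof.
move=> /andP[t0 t1].
have H n : \sum_(a < n) dyadic l a t = (2 ^+ l * t < n%:R)%R%:R.
  elim: n => [|n IH].
    by rewrite big_ord0; case: ltrP => //; rewrite ltNge mulr_ge0.
  rewrite big_ord_recr /= IH dyadicE -[n.+1%:R]natr1.
  have [h1|h1] := ltrP (2 ^+ l * t) n%:R; last by rewrite add0r.
  by rewrite addr0 (lt_trans h1)// ltrDl.
by rewrite H natrX gtr_pMr ?t1// exprn_gt0.
Qed.

Lemma measurable_dyadic l a : measurable_fun setT (dyadic l a : mR -> R).
Proof.
apply: (@measurableT_comp _ _ _ _ _ _ _ _ (fun t : mR => 2 ^+ l * t)) => //.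
exact: measurable_funM.
Qed.

Lemma dyadic_int l (a : nat) : (a < 2 ^ l)%N ->
  \int[leb]_(t in `[0, 1[) dyadic l a t = 2 ^- l.
Proof.
move=> al; rewrite /Rintegral.
have E0 : 0 < (2 ^+ l : R) by rewrite exprn_gt0.
pose J := `[a%:R / 2 ^+ l, (a%:R + 1) / 2 ^+ l[%classic : set R.
have a1 : (a%:R + 1 : R) <= 2 ^+ l by rewrite natr1 -natrX ler_nat.
have -> : (\int[leb]_(t in `[0%R, 1%R[) (dyadic l a t)%:E)%E =
          (\int[leb]_(t in `[0%R, 1%R[) (\1_J t)%:E)%E.
  apply: eq_integral => t _; rewrite dyadicE indicE mem_setE in_itv /=.
  by rewrite ler_pdivrMr// ltr_pdivlMr// ![_ * 2 ^+ _]mulrC.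
rewrite integral_indic//; last exact: measurable_itv.
have -> : J `&` `[0, 1[ = J.
  apply/setIidl => t; rewrite /J /= !in_itv /= => /andP[h1 h2]; apply/andP; split.
    by apply: (le_trans _ h1); rewrite divr_ge0// ltW.
  by apply: (lt_le_trans h2); rewrite ler_pdivrMr// mul1r.
rewrite /J /= lebesgue_measure_itv /= lte_fin ltr_pM2r ?invr_gt0// ltrDl ltr01.
by rewrite -EFinB /= -mulrBl addrC addKr mul1r.
Qed.

Definition cube l : finType := {ffun 'I_4 -> 'I_(2 ^ l)}.

Definition chi l (al : cube l) (x : R4) : R :=
  \prod_(m < 4) dyadic l (al m) (coord x m).

Lemma coord_upd m n (x : R4) t :
  coord (upd m x t) n = if n == m then t else coord x n.
Proof.
by case: m => [[|[|[|[|//]]]] Hm]; case: n => [[|[|[|[|//]]]] Hn].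
Qed.

Lemma measurable_coord m : measurable_fun setT (coord^~ m : mR * mR * mR * mR -> mR).
Proof.
have m1 : measurable_fun setT (fst : mR * mR * mR * mR -> _) by exact: measurable_fst.
have m2 : measurable_fun setT (fun x : mR * mR * mR * mR => x.1.1).
  exact: (measurableT_comp measurable_fst m1).
case: m => [[|[|[|[|//]]]] Hm]; rewrite /coord /=.
- exact: (measurableT_comp measurable_fst m2).
- exact: (measurableT_comp measurable_snd m2).
- exact: (measurableT_comp measurable_snd m1).
- exact: measurable_snd.
Qed.

Lemma dyadic_bounded l a m : cell_bounded (fun x : R4 => dyadic l a (coord x m)).
Proof.
split.
  apply: measurable_funTS.
  exact: (measurableT_comp (measurable_dyadic l a) (measurable_coord m)).
by exists 1 => x _; rewrite dyadicE; case: andP => _; rewrite ?normr1 ?normr0.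
Qed.

Lemma chi_bounded l (al : cube l) : cell_bounded (chi al).
Proof. by apply: cell_bounded_prod => m; exact: dyadic_bounded. Qed.

Lemma chi_ge0 l (al : cube l) x : 0 <= chi al x.
Proof. by apply: prodr_ge0 => m _; exact: dyadic_ge0. Qed.

Lemma chi_sqr l (al : cube l) x : chi al x ^+ 2 = chi al x.
Proof. by rewrite /chi -prodrXl; apply: eq_bigr => m _; exact: dyadic_sqr. Qed.

Lemma sum_chi l x : unit_cell x -> \sum_(al : cube l) chi al x = 1.
Proof.
move=> cx; rewrite /chi -(bigA_distr_bigA (fun m (a : 'I_(2 ^ l)) => dyadic l a (coord x m))).
by apply: big1 => m _; apply: sum_dyadic; exact: cx.
Qed.

(** Fubini's theorem for a product of functions of one coordinate each: the
    factors are replaced by their integrals one coordinate at a time. *)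
Lemma cint_prod_coord (g : 'I_4 -> R -> R) (c : 'I_4 -> R) :
  (forall m, cell_bounded (fun x : R4 => g m (coord x m))) ->
  (forall m, leb.-integrable `[0, 1[ (EFin \o g m)) ->
  (forall m, \int[leb]_(t in `[0, 1[) g m t = c m) ->
  cint (fun x : R4 => \prod_(m < 4) g m (coord x m)) = \prod_(m < 4) c m.
Proof.
move=> bg ig gc.
(* F n has its first n factors already integrated. *)
pose F n (m : 'I_4) (x : R4) := if (m < n)%N then c m else g m (coord x m).
have bF n m : cell_bounded (F n m).
  by rewrite /F; case: (m < n)%N => //; exact: cell_bounded_cst.
have bP n : cell_bounded (fun x : R4 => \prod_(m < 4) F n m x).
  by apply: cell_bounded_prod => m; exact: bF.
have step n : (n < 4)%N -> cint (fun x : R4 => \prod_(m < 4) F n m x) =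
    cint (fun x : R4 => \prod_(m < 4) F n.+1 m x).
  move=> n4; pose m0 := Ordinal n4.
  apply: (cint_slice_eq (m := m0)) => // x cx; rewrite /slice_int.
  pose Q := \prod_(m < 4 | m != m0) F n m x.
  have E t : \prod_(m < 4) F n m (upd m0 x t) = Q * g m0 t.
    rewrite (bigD1 m0)//= mulrC; congr (_ * _).
      by apply: eq_bigr => m /negbTE mm; rewrite /F coord_upd mm.
    by rewrite /F ltnn coord_upd eqxx.
  have E' t : \prod_(m < 4) F n.+1 m (upd m0 x t) = Q * c m0.
    rewrite (bigD1 m0)//= mulrC; congr (_ * _); last by rewrite /F leqnn.
    apply: eq_bigr => m mm; rewrite /F coord_upd (negbTE mm) ltnS.
    by rewrite leq_eqVlt (_ : (m == n :> nat) = false)//; exact/negbTE.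
  under eq_Rintegral do rewrite E.
  under [RHS]eq_Rintegral do rewrite E'.
  rewrite RintegralZl// gc Rintegral_cst//=.
  by rewrite lebesgue_measure_itv /= lte_fin ltr01 oppr0 adde0 mulr1.
have -> : (fun x : R4 => \prod_(m < 4) g m (coord x m)) =
   (fun x : R4 => \prod_(m < 4) F 0%N m x) by [].
rewrite step// step// step// step//.
rewrite -[RHS]cint_cst; congr (cint _); apply/funext => x.
by apply: eq_bigr => m _; rewrite /F ltn_ord.
Qed.

Lemma cint_chi l (al : cube l) : cint (chi al) = 16 ^- l.
Proof.
rewrite /chi (@cint_prod_coord (fun m => dyadic l (al m)) (fun=> 2 ^- l)).
- by rewrite prodr_const card_ord exprVn -exprM mulnC exprM -natrX.
- by move=> m; exact: dyadic_bounded.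
- move=> m; apply: measurable_bounded_integrable => //.
  + by rewrite /= lebesgue_measure_itv /= lte_fin ltr01 ltry.
  + by apply: measurable_funTS; exact: measurable_dyadic.
  + exists 1; split; first exact: num_real.
    move=> M /ltW KM t _; apply: le_trans KM; rewrite dyadicE.
    by case: andP => _; rewrite ?normr1 ?normr0.
- by move=> m; apply: dyadic_int.
Qed.

Definition corner l (al : cube l) : R4 :=
  let p (m : nat) := (al (inord m))%:R / 2 ^+ l in (p 0, p 1, p 2, p 3)%N.

Lemma coord_corner l (al : cube l) m : coord (corner al) m = (al m)%:R / 2 ^+ l.
Proof.
by case: m => [[|[|[|[|//]]]] Hm]; rewrite /corner /coord /=;
  congr ((al _)%:R / _); apply/val_inj; rewrite /= inordK.
Qed.

Lemma chi_near_corner l (al : cube l) x m : chi al x != 0 ->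
  `|coord x m - coord (corner al) m| <= 2 ^- l.
Proof.
have E0 : 0 < (2 ^+ l : R) by rewrite exprn_gt0.
move=> /prodf_neq0 /(_ m isT); rewrite dyadicE coord_corner.
case: andP => [[h1 h2] _|_ /eqP//].
rewrite ger0_norm; last by rewrite subr_ge0 ler_pdivrMr// mulrC.
rewrite lerBlDr (_ : _ + _ = (1 + (al m)%:R) / 2 ^+ l); last by rewrite mulrDl mul1r.
by rewrite ler_pdivlMr// mulrC addrC ltW.
Qed.

Lemma ball_coordP (x y : R4) (e : R) :
  ball x e y <-> forall m, `|coord x m - coord y m| < e.
Proof.
case: x => [[[x0 x1] x2] x3]; case: y => [[[y0 y1] y2] y3].
split=> [[[[b0 b1] b2] b3] [[|[|[|[|//]]]] Hm]|H] //.
have i0 : (0 < 4)%N by []. have i1 : (1 < 4)%N by [].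
have i2 : (2 < 4)%N by []. have i3 : (3 < 4)%N by [].
by split; [split; [split; [exact: (H (Ordinal i0))|exact: (H (Ordinal i1))]|
  exact: (H (Ordinal i2))]|exact: (H (Ordinal i3))].
Qed.

(** The compactness of the closed cube gives, in the form of near coverings, one
    dyadic scale valid for all its points; the second point y is free, so the
    half-open boundary of the cell causes no difficulty. *)
Lemma uniform_continuity f (e : R) : continuous f -> 0 < e ->
  exists l0, forall l x y, (l0 <= l)%N -> unit_cell x ->
    (forall m, `|coord x m - coord y m| <= 2 ^- l) -> `|f x - f y| < e.
Proof.
move=> cf e0.
pose K : set R4 := `[0, 1]%classic `*` `[0, 1]%classic `*` `[0, 1]%classic `*` `[0, 1]%classic.
have cK : compact K.
  by do 3 (apply: compact_setX; last exact: segment_compact); exact: segment_compact.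
move/compact_near_coveringP: cK => /(_ nat \oo (fun l x => forall y : R4,
    (forall m, `|coord x m - coord y m| <= 2 ^- l) -> `|f x - f y| < e)) H.
have [|l0 _ Hl0] := H _.
  move=> x Kx.
  have e2 : 0 < e / 2 by rewrite divr_gt0.
  have /nbhs_ballP[dl /= dl0 Hd] := cf x _ (nbhsx_ballx (f x) (e / 2) e2).
  have d2 : 0 < dl / 2 by rewrite divr_gt0.
  exists (ball x (dl / 2), [set l | 2 ^- l < dl / 2]).
    split => /=; first exact: nbhsx_ballx.
    have := near_infty_natSinv_expn_lt (PosNum d2).
    by apply: filterS => l /=; rewrite div1r.
  move=> [z l] /= [/ball_coordP bz lz] y yz.
  have fz : `|f x - f z| < e / 2.
    by apply: Hd; apply/ball_coordP => m; apply: (lt_le_trans (bz m)); lra.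
  have fy : `|f x - f y| < e / 2.
    apply: Hd; apply/ball_coordP => m.
    have := ler_distD (coord z m) (coord x m) (coord y m).
    have := bz m; have := yz m; lra.
  have := ler_distD (f x) (f z) (f y); rewrite [`|f z - f x|]distrC; lra.
exists l0 => l x y ll /unit_cellE[h0 h1 h2 h3]; apply: Hl0 => //.
by split; [split; [split|]|]; rewrite /= in_itv /=; apply/andP; split; lra.
Qed.

(** A step function on the dyadic cubes of side 2^{-l} that is uniformly close
    to f on the cell when f is continuous and l is large. *)
Definition step l f (x : R4) : R := \sum_(al : cube l) f (corner al) * chi al x.

Lemma step_bounded l f : cell_bounded (step l f).
Proof.
by apply: cell_bounded_sum => al; apply: cell_boundedZ; exact: chi_bounded.
Qed.

Lemma step_approx f (e : R) : continuous f -> 0 < e ->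
  exists l0, forall l x, (l0 <= l)%N -> unit_cell x -> `|f x - step l f x| <= e.
Proof.
move=> cf e0; have [l0 H] := uniform_continuity cf e0; exists l0 => l x ll cx.
(* At x only the cube containing x contributes, and its corner is close to x. *)
rewrite -[f x]mulr1 -(sum_chi l cx) mulr_sumr -sumrB.
apply: (le_trans (ler_norm_sum _ _ _)); rewrite -[leRHS]mulr1 -(sum_chi l cx) mulr_sumr.
apply: ler_sum => al _; rewrite -mulrBl normrM (ger0_norm (chi_ge0 _ _)).
have [->|c0] := eqVneq (chi al x) 0; first by rewrite !mulr0.
apply: ler_wpM2r; first exact: chi_ge0.
by apply: ltW; apply: (H l) => // m; exact: chi_near_corner.
Qed.

(** Measurability for the product sigma-algebra follows from the convergence of
    the step functions. *)
Lemma continuous_bounded f : continuous f -> cell_bounded f.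
Proof.
move=> cf; split.
  apply: (@measurable_fun_cvg _ (mR * mR * mR * mR)%type R unit_cell (step^~ f) f).
    by move=> l; have [] := step_bounded l f.
  move=> x cx; apply/cvgrPdist_le => e e0.
  have [l0 H] := step_approx cf e0.
  by exists l0 => // l /= ll; exact: H.
have [l0 H] := step_approx cf ltr01.
have [_ [K HK]] := step_bounded l0 f.
exists (K + 1) => x cx; have := H l0 x (leqnn _) cx; have := HK x cx.
have := ler_normD (step l0 f x) (f x - step l0 f x); rewrite subrKC; lra.
Qed.

End Dyadic.

(** * Haar coefficients and averages over cubes *)

Section HaarIdentity.
Context (R : realType).
Local Notation R4 := (R * R * R * R)%type.
Implicit Types (f g : R4 -> R) (l : nat).

Lemma child_subproof l (a : 'I_(2 ^ l)) (s : bool) : (a.*2 + s < 2 ^ l.+1)%N.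
Proof.
have al := ltn_ord a; rewrite expnS mul2n.
apply: (@leq_trans a.+1.*2); last by rewrite leq_double.
by rewrite doubleS; case: s; rewrite ?addn1 ?addn0 ?ltnS ?leqnSn.
Qed.

(** Cubes of level l+1 inside a cube of level l correspond to the sets of
    directions in which the upper half is taken. *)
Definition child l (al : cube l) (s : {ffun 'I_4 -> bool}) : cube l.+1 :=
  [ffun m => Ordinal (child_subproof (al m) (s m))].

Lemma parent_subproof l (a : 'I_(2 ^ l.+1)) : (a./2 < 2 ^ l)%N.
Proof. by rewrite ltn_half_double -mul2n -expnS. Qed.

Definition parent l (al : cube l.+1) : cube l :=
  [ffun m => Ordinal (parent_subproof (al m))].

Definition parity l (al : cube l.+1) : {ffun 'I_4 -> bool} :=
  [ffun m => odd (al m)].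

Lemma child_parent l (al : cube l.+1) : child (parent al) (parity al) = al.
Proof.
apply/ffunP => m; apply/val_inj; rewrite !ffunE /=.
by rewrite addnC odd_double_half.
Qed.

Lemma parent_child l (al : cube l) s : parent (child al s) = al.
Proof.
apply/ffunP => m; apply/val_inj; rewrite !ffunE /=.
by rewrite addnC half_bit_double.
Qed.

Lemma parity_child l (al : cube l) s : parity (child al s) = s.
Proof. by apply/ffunP => m; rewrite !ffunE /= oddD odd_double; case: (s m). Qed.

Lemma sum_child l (F : cube l.+1 -> R) :
  \sum_(al : cube l) \sum_(s : {ffun 'I_4 -> bool}) F (child al s) =
  \sum_al F al.
Proof.
rewrite pair_big /=.
rewrite [RHS](reindex (fun p : cube l * {ffun 'I_4 -> bool} => child p.1 p.2)) //.
exists (fun al => (parent al, parity al)) => [[al s] _|al _] /=.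
  by rewrite parent_child parity_child.
exact: child_parent.
Qed.

(** The sign of the Haar function of type b on the child s of its cube; as b
    and s vary these are the characters of the group {0,1}^4. *)
Definition sgn4 (b s : {ffun 'I_4 -> bool}) : R := \prod_(m < 4) (-1) ^+ (b m && s m).

Lemma chi_child l (al : cube l) (x : R4) :
  chi al x = \sum_(s : {ffun 'I_4 -> bool}) chi (child al s) x.
Proof.
transitivity (\prod_(m < 4) \sum_(s : bool) dyadic l.+1 ((al m).*2 + s) (coord x m)).
  by apply: eq_bigr => m _; rewrite dyadic_split big_bool /= addn1 addn0 addrC.
rewrite bigA_distr_bigA; apply: eq_bigr => s _.
by apply: eq_bigr => m _; rewrite ffunE.
Qed.

Lemma haar_chi l (i : haar_index l) (x : R4) :
  haar i x = 4 ^+ l * \sum_(s : {ffun 'I_4 -> bool})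
     sgn4 (val i).2 s * chi (child (val i).1 s) x.
Proof.
rewrite /haar; under eq_bigr do rewrite haar1E.
rewrite big_split /= prodr_const card_ord; congr (_ * _).
  rewrite -powR_mulrn ?powR_ge0// -powRrM.
  rewrite (_ : l%:R / 2 * 4%:R = 2%:R * l%:R); last by field.
  by rewrite powRrM !powR_mulrn ?exprn_ge0// -natrX.
rewrite bigA_distr_bigA; apply: eq_bigr => s _.
by rewrite /sgn4 /chi -big_split /=; apply: eq_bigr => m _; rewrite ffunE.
Qed.

Lemma haar_bounded l (i : haar_index l) : cell_bounded (haar i : R4 -> R).
Proof.
rewrite (_ : haar i = fun x => 4 ^+ l * \sum_(s : {ffun 'I_4 -> bool})
     sgn4 (val i).2 s * chi (child (val i).1 s) x); last first.
  by apply/funext => x; exact: haar_chi.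
apply: cell_boundedZ; apply: cell_bounded_sum => s; apply: cell_boundedZ.
exact: chi_bounded.
Qed.

Lemma sgn4_orthogonal s t :
  \sum_(b : {ffun 'I_4 -> bool}) sgn4 b s * sgn4 b t = (16 * (s == t)%:R)%R.
Proof.
pose G (m : 'I_4) (b : bool) : R := (-1) ^+ (b && s m) * (-1) ^+ (b && t m).
under eq_bigr do rewrite /sgn4 -big_split /=.
rewrite -(bigA_distr_bigA G) /G.
have [<-|st] := eqVneq s t.
  rewrite (eq_bigr (fun=> 2)); first by rewrite prodr_const card_ord -natrX mulr1.
  by move=> m _; rewrite big_bool /=; case: (s m); rewrite ?expr0 ?expr1 ?mulrNN mulr1.
rewrite mulr0; have [m stm] : exists m, s m != t m.
  apply/existsP; rewrite -negb_forall; apply: contraNN st => /forallP h.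
  by apply/eqP/ffunP => m; exact/eqP.
apply/eqP/prodf_eq0; exists m => //; apply/eqP; rewrite big_bool /=.
by move: stm; case: (s m); case: (t m) => //= _; rewrite ?expr0 ?expr1 ?mulr1 ?mul1r addNr.
Qed.

(** Up to the factor 16 the sign matrix is orthogonal. *)
Lemma sgn4_parseval (c : {ffun 'I_4 -> bool} -> R) :
  \sum_b (\sum_s sgn4 b s * c s) ^+ 2 = 16 * \sum_s c s ^+ 2.
Proof.
transitivity (\sum_b \sum_s \sum_t (sgn4 b s * sgn4 b t) * (c s * c t)).
  apply: eq_bigr => b _; rewrite expr2 mulr_suml; apply: eq_bigr => s _.
  by rewrite mulr_sumr; apply: eq_bigr => t _; rewrite mulrACA.
rewrite exchange_big /= mulr_sumr; apply: eq_bigr => s _.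
rewrite exchange_big /= (bigD1 s)//= [X in _ + X]big1 ?addr0.
  by rewrite -mulr_suml sgn4_orthogonal eqxx mulr1 expr2.
by move=> t ts; rewrite -mulr_suml sgn4_orthogonal eq_sym (negbTE ts) mulr0 mul0r.
Qed.

Lemma sgn4_0 s : sgn4 [ffun=> false] s = 1.
Proof. by apply: big1 => m _; rewrite ffunE. Qed.

Lemma sum_haar_index l (F : cube l * {ffun 'I_4 -> bool} -> R) :
  \sum_(i : haar_index l) F (val i) =
  \sum_(al : cube l) \sum_(b : {ffun 'I_4 -> bool} | b != [ffun=> false]) F (al, b).
Proof.
rewrite pair_big_dep /=.
rewrite -(@big_sub _ _ _ _ [pred p : cube l * {ffun 'I_4 -> bool} | p.2 != [ffun=> false]] F).
by apply: eq_bigr => -[].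
Qed.

(** The squared L^2 norm of the function obtained by averaging f over the
    cubes of side 2^{-l}, which have volume 16^{-l}. *)
Definition cube_energy l f : R := 16 ^+ l * \sum_(al : cube l) cint (fun x => chi al x * f x) ^+ 2.

Definition haar_coef f l (i : haar_index l) : R := cint (fun x => haar i x * f x).

(** On each cube, the sixteen sign patterns applied to the integrals over the
    children preserve sums of squares; the trivial pattern gives the integral
    over the cube itself, and the fifteen others the Haar coefficients. *)
Lemma haar_level_energy l f : cell_bounded f ->
  \sum_(i : haar_index l) haar_coef f i ^+ 2 = cube_energy l.+1 f - cube_energy l f.
Proof.
move=> bf.
pose c l (al : cube l) := cint (fun x => chi al x * f x).
have bc l' (al : cube l') : cell_bounded (fun x => chi al x * f x).
  by apply: cell_boundedM => //; exact: chi_bounded.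
have cE (al : cube l) : c l al = \sum_s c l.+1 (child al s).
  rewrite /c -cint_sum//; congr cint; apply/funext => x.
  by rewrite chi_child mulr_suml.
have hE (i : haar_index l) : haar_coef f i =
   4 ^+ l * \sum_s sgn4 (val i).2 s * c l.+1 (child (val i).1 s).
  rewrite /haar_coef; under [X in cint X]eq_fun do rewrite haar_chi -mulrA mulr_suml.
  rewrite cintZ; last first.
    apply: cell_bounded_sum => s; under eq_fun do rewrite -mulrA.
    exact: cell_boundedZ.
  under [X in cint X]eq_fun do under eq_bigr do rewrite -mulrA.
  rewrite cint_sum; last by move=> s; exact: cell_boundedZ.
  by congr (_ * _); apply: eq_bigr => s _; rewrite cintZ.
rewrite (eq_bigr _ (fun i _ => congr1 (fun u => u ^+ 2) (hE i))).
pose F (p : cube l * {ffun 'I_4 -> bool}) :=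
  (4 ^+ l * \sum_s sgn4 p.2 s * c l.+1 (child p.1 s)) ^+ 2.
rewrite (sum_haar_index F) /F /=.
rewrite /cube_energy -sum_child exprS [16 * _]mulrC -mulrA !mulr_sumr -sumrB.
apply: eq_bigr => al _; rewrite -sgn4_parseval -/(c l al).
rewrite [X in _ = _ * X - _](bigD1 [ffun=> false])//= mulrDr addrAC.
under [X in _ * X ^+ 2 - _]eq_bigr do rewrite sgn4_0 mul1r.
rewrite -cE subrr add0r mulr_sumr; apply: eq_bigr => b _.
by rewrite exprMn exprAC -[4 ^+ 2]natrX.
Qed.

Lemma cube_energy0 f : cell_bounded f -> cube_energy 0 f = cint f ^+ 2.
Proof.
move=> bf; rewrite /cube_energy expr0 mul1r.
pose al0 : cube 0 := [ffun=> ord0].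
rewrite (bigD1 al0)//= big1 ?addr0.
  congr (_ ^+ 2); apply: cint_eq => x cx; rewrite -[RHS]mul1r; congr (_ * _).
  rewrite -(sum_chi 0 cx) (bigD1 al0)//= big1 ?addr0// => al /eqP[].
  by apply/ffunP => m; rewrite ffunE; exact: ord1.
by move=> al /eqP[]; apply/ffunP => m; rewrite ffunE; exact: ord1.
Qed.

Lemma haar_energy l f : cell_bounded f ->
  \sum_(k < l) \sum_(i : haar_index k) haar_coef f i ^+ 2 =
  cube_energy l f - cint f ^+ 2.
Proof.
move=> bf; elim: l => [|l IH]; first by rewrite big_ord0 cube_energy0// subrr.
by rewrite big_ord_recr /= IH haar_level_energy//; ring.
Qed.

Lemma sum_cint_chi l f : cell_bounded f ->
  \sum_(al : cube l) cint (fun x => chi al x * f x) = cint f.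
Proof.
move=> bf; rewrite -cint_sum; last first.
  by move=> al; apply: cell_boundedM => //; exact: chi_bounded.
by apply: cint_eq => x cx; rewrite -mulr_suml sum_chi// mul1r.
Qed.

Lemma cint_chi_cauchy_schwarz l (al : cube l) f : cell_bounded f ->
  cint (fun x => chi al x * f x) ^+ 2 <= 16 ^- l * cint (fun x => chi al x * f x ^+ 2).
Proof.
move=> bf; have bc := chi_bounded R al.
have := cint_cauchy_schwarz bc (cell_boundedM bc bf).
under eq_fun do rewrite mulrA -expr2 chi_sqr.
under [X in _ <= cint X * _]eq_fun do rewrite chi_sqr.
by under [X in _ <= _ * cint X]eq_fun do rewrite exprMn chi_sqr; rewrite cint_chi.
Qed.

Lemma cube_energy_le l f : cell_bounded f -> cube_energy l f <= cint (fun x => f x ^+ 2).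
Proof.
move=> bf; rewrite -(sum_cint_chi l (cell_bounded_sqr bf)) /cube_energy mulr_sumr.
apply: ler_sum => al _; rewrite mulrC -ler_pdivlMr ?exprn_gt0// mulrC.
exact: cint_chi_cauchy_schwarz.
Qed.

(** Averaging over the cubes is the orthogonal projection onto the step
    functions, and therefore gives the best approximation among them; here it
    is compared with the sampled values. *)
Lemma cube_energy_gap l f : cell_bounded f ->
  cint (fun x => f x ^+ 2) - cube_energy l f <= cint (fun x => (f x - step l f x) ^+ 2).
Proof.
move=> bf; pose v (al : cube l) := f (corner R al).
pose c (al : cube l) := cint (fun x => chi al x * f x).
have bc (al : cube l) : cell_bounded (chi al : R4 -> R) := chi_bounded R al.
have bcf (al : cube l) : cell_bounded (fun x => chi al x * f x) := cell_boundedM (bc al) bf.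
have -> : cint (fun x => (f x - step l f x) ^+ 2) =
   cint (fun x => f x ^+ 2) - \sum_al (2 * v al * c al - 16 ^- l * v al ^+ 2).
  transitivity (cint (fun x => f x ^+ 2 - \sum_(al : cube l)
      (2 * v al * (chi al x * f x) - v al ^+ 2 * chi al x))).
    apply: cint_eq => x cx.
    rewrite -[LHS]mul1r -[f x ^+ 2]mul1r -{1 2}(sum_chi l cx) !mulr_suml -sumrB.
    apply: eq_bigr => al _.
    have [c0|c0] := eqVneq (chi al x) 0; first by rewrite c0 !(mul0r, mulr0) subrr subr0.
    have c1 : chi al x = 1.
      by apply: (mulfI c0); rewrite -expr2 chi_sqr mulr1.
    (* The other indicators vanish at x, being nonnegative of sum 1 with chi al. *)
    have -> : step l f x = v al.
      rewrite /step (bigD1 al)//= c1 mulr1 big1 ?addr0// => be ba.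
      have : \sum_(be : cube l | be != al) chi be x = 0.
        by have := sum_chi l cx; rewrite (bigD1 al)//= c1; lra.
      move/eqP; rewrite psumr_eq0; last by move=> ? _; exact: chi_ge0.
      by move=> /allP /(_ be (mem_index_enum _)) /implyP /(_ ba) /eqP ->; rewrite mulr0.
    by rewrite c1; ring.
  have bd (al : cube l) : cell_bounded (fun x =>
      2 * v al * (chi al x * f x) - v al ^+ 2 * chi al x).
    by apply: cell_boundedB; exact: cell_boundedZ.
  rewrite cintB; [|exact: cell_bounded_sqr|exact: cell_bounded_sum].
  rewrite cint_sum//.
  congr (_ - _); apply: eq_bigr => al _.
  by rewrite cintB ?cintZ ?cint_chi//; [rewrite mulrC [_ * 16 ^- l]mulrC mulrC|exact: cell_boundedZ..].
rewrite lerD2l lerN2 /cube_energy mulr_sumr; apply: ler_sum => al _.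
rewrite -/(c al); set q : R := 16 ^+ l; have q0 : 0 < q by rewrite exprn_gt0.
(* Completing the square in the value v al. *)
have : 0 <= q * (c al - q^-1 * v al) ^+ 2 by rewrite mulr_ge0 ?sqr_ge0// ltW.
rewrite (_ : q * _ = q * c al ^+ 2 - (2 * v al * c al - q^-1 * v al ^+ 2)) ?subr_ge0//.
by field; rewrite gt_eqF.
Qed.

Lemma cube_energy_cvg f : continuous f ->
  (fun l => cube_energy l f) @ \oo --> cint (fun x => f x ^+ 2).
Proof.
move=> cf; have bf := continuous_bounded cf.
apply/cvgrPdist_le => e e0.
have e1 : 0 < Num.min e 1 by rewrite lt_min e0 ltr01.
have [l0 H] := step_approx cf e1.
exists l0 => // l /= ll; rewrite ger0_norm ?subr_ge0 ?cube_energy_le//.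
apply: (le_trans (cube_energy_gap l bf)).
have bs := cell_bounded_sqr (cell_boundedB bf (step_bounded l f)).
rewrite -[leRHS]cint_cst; apply: cint_le => //; first exact: cell_bounded_cst.
move=> x cx; have := H l x ll cx; rewrite le_min => /andP[h1 h2].
rewrite -real_normK ?num_real// expr2 -[leRHS]mulr1.
by apply: ler_pM.
Qed.

End HaarIdentity.

(** * Haar coefficients of differentiable functions *)

Section SliceCalculus.
Context (R : realType).
Local Notation mR := (measurableTypeR R).
Local Notation leb := (@lebesgue_measure R).
Local Notation R4 := (R * R * R * R)%type.
Implicit Types (F G f g : R4 -> R) (m : 'I_4) (x : R4).

Lemma upd_shift m x (s h : R) :
  upd m x (h + s) = h *: (basis_vec m : R4) + upd m x s.
Proof.
rewrite /upd /basis_vec; case: m => [[|[|[|[|//]]]] Hm] /=;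
by congr (_, _, _, _); rewrite /= ?add0r ?addr0 /GRing.scale /= ?mulr1 ?mulr0 ?add0r.
Qed.

Lemma continuous_upd m x : continuous (upd m x).
Proof.
move=> t; apply/cvg_ballP => e e0.
apply: filterS (nbhsx_ballx t e e0) => s ts; apply/ball_coordP => n.
by rewrite !coord_upd; case: ifP => // _; rewrite subrr normr0.
Qed.

Lemma is_derive_slice m F (dF : R) x t :
  is_derive (upd m x t) (basis_vec m) F dF ->
  is_derive t (1 : R) (fun s => F (upd m x s)) dF.
Proof.
move=> [dv dE].
have E : (fun h : R => h^-1 *: (((fun s => F (upd m x s)) \o shift t) (h *: (1 : R)) - F (upd m x t)))
  = (fun h : R => h^-1 *: ((F \o shift (upd m x t)) (h *: (basis_vec m : R4)) - F (upd m x t))).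
  by apply/funext => h /=; rewrite -upd_shift /GRing.scale /= mulr1.
by split; rewrite /derivable /derive E.
Qed.

(** Calculus along the lines of one direction at a time is enough, so that only
    one partial derivative enters; it is kept as a separate function G. *)
Definition slice_derivative m F G :=
  [/\ forall x, is_derive x (basis_vec m) F (G x), continuous F & continuous G].

Lemma slice_FTC m F G x (a b : R) : slice_derivative m F G -> a < b ->
  \int[leb]_(t in `[a, b]) G (upd m x t) = F (upd m x b) - F (upd m x a).
Proof.
move=> [dF cF cG] ab.
have cs (H : R4 -> R) : continuous H -> continuous (fun s => H (upd m x s)).
  move=> cH s; exact: (cvg_comp (upd m x) H (@continuous_upd m x s) (cH _)).
have dFs t : is_derive t (1 : R) (fun s => F (upd m x s)) (G (upd m x t)).
  exact: is_derive_slice.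
rewrite /Rintegral (@continuous_FTC2 _ _ (fun s => F (upd m x s)))//.
- exact/continuous_subspaceT/cs.
- split.
  + by move=> t _; have [] := dFs t.
  + by apply: cvg_at_right_filter; exact: (cs _ cF a).
  + by apply: cvg_at_left_filter; exact: (cs _ cF b).
- by move=> t _; rewrite derive1E; have [_ ->] := dFs t.
Qed.

Lemma slice_int_le m F G x : cell_bounded F -> cell_bounded G -> unit_cell x ->
  (forall t, 0 <= t < 1 -> F (upd m x t) <= G (upd m x t)) ->
  slice_int m F x <= slice_int m G x.
Proof.
move=> bF bG cx FG.
apply: (le_Rintegral _ (cell_bounded_slice m bF cx) (cell_bounded_slice m bG cx)) => //.
Qed.

Lemma slice_intD m F G x : cell_bounded F -> cell_bounded G -> unit_cell x ->
  slice_int m (fun y => F y + G y) x = slice_int m F x + slice_int m G x.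
Proof.
move=> bF bG cx.
exact: (RintegralD _ (cell_bounded_slice m bF cx) (cell_bounded_slice m bG cx)).
Qed.

Lemma slice_intZ m c F x : cell_bounded F -> unit_cell x ->
  slice_int m (fun y => c * F y) x = c * slice_int m F x.
Proof.
by move=> bF cx; exact: (RintegralZl _ _ (cell_bounded_slice m bF cx)).
Qed.

Lemma slice_int_closed m F x : cell_bounded F -> unit_cell x ->
  slice_int m F x = \int[leb]_(t in `[0, 1]) F (upd m x t).
Proof.
move=> bF cx; apply: Rintegral_itv_bndo_bndc.
exact: (cell_bounded_slice m bF cx).
Qed.

Lemma upd_period m x : upd m x 1 = upd m x 0 + basis_vec m.
Proof. by have := upd_shift m x 0 1; rewrite addr0 scale1r addrC. Qed.

(** The fundamental theorem of calculus along each line closes up over a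
    period. *)
Lemma cint_derivative_periodic m F G : torus_periodic F ->
  slice_derivative m F G -> cint G = 0.
Proof.
move=> pF sF; have [_ _ cG] := sF.
have bG := continuous_bounded cG; have b0 := cell_bounded_cst (0 : R).
rewrite -[RHS](cint_cst (0 : R)); apply: (cint_slice_eq (m := m)) => // x cx.
rewrite slice_int_closed// (slice_FTC x sF ltr01) upd_period pF subrr.
by rewrite /slice_int Rintegral_cst//= mul0r.
Qed.

(** Both s and t lie in the dyadic interval a of level l, so the segment
    between them does, and the increment is the integral of the derivative
    over it. *)
Lemma dyadic_osc m F G l a x s t : slice_derivative m F G -> unit_cell x ->
  0 <= s < 1 -> 0 <= t < 1 -> dyadic l a s != 0 -> dyadic l a t != 0 ->
  `|F (upd m x t) - F (upd m x s)| <=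
  slice_int m (fun y => dyadic l a (coord y m) * `|G y|) x.
Proof.
move=> sF cx; have [_ _ cG] := sF.
have bG := continuous_bounded cG.
have bDG : cell_bounded (fun y : R4 => dyadic l a (coord y m) * `|G y|).
  by apply: cell_boundedM; [exact: dyadic_bounded|exact: cell_bounded_norm].
wlog st : s t / s < t.
  move=> H hs ht ds dt; have [st|ts|->] := ltgtP s t.
  - exact: H.
  - by rewrite distrC; exact: H.
  - rewrite subrr normr0; apply: Rintegral_ge0 => u _.
    by rewrite mulr_ge0// dyadic_ge0.
move=> /andP[s0 s1] /andP[t0 t1]; rewrite !dyadicE.
case: andP => [[a1 a2] _|_ /eqP//]; case: andP => [[a3 a4] _|_ /eqP//].
have E0 : 0 < (2 ^+ l : R) by rewrite exprn_gt0.
rewrite -(slice_FTC x sF st).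
have sub : `[s, t]%classic `<=` `[0 : R, 1[%classic.
  by move=> u /=; rewrite !in_itv /= => /andP[h1 h2]; apply/andP; split; lra.
have iG : leb.-integrable `[s, t] (EFin \o (fun u => G (upd m x u))).
  by apply: (@integrableS _ _ _ leb `[0, 1[%classic) => //; exact: cell_bounded_slice.
apply: (le_trans (le_normr_Rintegral _ iG)) => //.
have iDG := cell_bounded_slice m bDG cx.
have iDGs : leb.-integrable `[s, t]
    (EFin \o (fun u => dyadic l a (coord (upd m x u) m) * `|G (upd m x u)|)).
  by apply: (@integrableS _ _ _ leb `[0, 1[%classic).
have -> : \int[leb]_(u in `[s, t]) `|G (upd m x u)| = \int[leb]_(u in `[s, t])
    (dyadic l a (coord (upd m x u) m) * `|G (upd m x u)|).
  apply: eq_Rintegral => u; rewrite inE /= in_itv /= => /andP[su ut].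
  rewrite coord_upd eqxx dyadicE.
  have -> : (a%:R <= 2 ^+ l * u < a%:R + 1) = true; last by rewrite mul1r.
  apply/andP; split.
    by apply: (le_trans a1); rewrite ler_pM2l.
  by apply: le_lt_trans a4; rewrite ler_pM2l.
apply: fine_le; [exact: integrable_fin_num iDGs|exact: integrable_fin_num iDG|].
apply: ge0_subset_integral => //.
- exact: measurable_int iDG.
- by move=> u _; rewrite lee_fin mulr_ge0// dyadic_ge0.
Qed.

Lemma slice_int_dyadic m l a x : (a < 2 ^ l)%N ->
  slice_int m (fun y : R4 => dyadic l a (coord y m)) x = 2 ^- l.
Proof.
move=> al; rewrite -(dyadic_int R al); apply: eq_Rintegral => t _.
by rewrite coord_upd eqxx.
Qed.

(** The difference of the two halves has integral 0, so F may be replaced by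
    its increment from the left end of the dyadic interval, which
    [dyadic_osc] bounds. *)
Lemma slice_haar1_le m F G l a x : slice_derivative m F G -> unit_cell x ->
  (a < 2 ^ l)%N ->
  slice_int m (fun y => (dyadic l.+1 a.*2 (coord y m) -
                         dyadic l.+1 a.*2.+1 (coord y m)) * F y) x <=
  2 ^- l * slice_int m (fun y => dyadic l a (coord y m) * `|G y|) x.
Proof.
move=> sF cx al; have [_ cF cG] := sF.
set V := slice_int m (fun y => _ * `|G y|) x.
pose W (y : R4) := dyadic l.+1 a.*2 (coord y m) - dyadic l.+1 a.*2.+1 (coord y m).
pose D (y : R4) := dyadic l a (coord y m).
have bF := continuous_bounded cF.
have bD : cell_bounded D by exact: dyadic_bounded.
have bW : cell_bounded W by apply: cell_boundedB; exact: dyadic_bounded.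
pose c : R := a%:R / 2 ^+ l.
have E0 : 0 < (2 ^+ l : R) by rewrite exprn_gt0.
have c01 : 0 <= c < 1.
  apply/andP; split; first by rewrite divr_ge0// ltW.
  by rewrite ltr_pdivrMr// mul1r -natrX ltr_nat.
have dc : dyadic l a c != 0.
  have c2 : 2 ^+ l * c = a%:R by rewrite mulrC divfK// gt_eqF.
  by rewrite dyadicE c2 lexx ltrDl ltr01 pnatr_eq0.
have a2 : (a.*2 < 2 ^ l.+1)%N by rewrite expnS mul2n ltn_double.
have a3 : (a.*2.+1 < 2 ^ l.+1)%N by rewrite expnS mul2n ltn_Sdouble.
have W0 : slice_int m W x = 0.
  have := slice_intD m (dyadic_bounded R l.+1 a.*2 m)
    (cell_boundedZ (-1) (dyadic_bounded R l.+1 a.*2.+1 m)) cx.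
  rewrite slice_intZ ?slice_int_dyadic//; last exact: dyadic_bounded.
  rewrite mulN1r subrr => <-; apply: eq_Rintegral => t _.
  by rewrite /W mulN1r.
have D1 : slice_int m D x = 2 ^- l by exact: slice_int_dyadic.
(* W integrates to 0 and D to 2^{-l}, so that the right-hand side is the
   integral of a pointwise upper bound of W F. *)
have -> : 2 ^- l * V = slice_int m (fun y => F (upd m x c) * W y + V * D y) x.
  rewrite slice_intD; [|exact: cell_boundedZ..|by []].
  by rewrite !slice_intZ// W0 mulr0 add0r D1 mulrC.
apply: slice_int_le => //; first exact: cell_boundedM.
  by apply: cell_boundedD; exact: cell_boundedZ.
move=> t t01; rewrite -/(W _).
have [D0|D0] := eqVneq (D (upd m x t)) 0.
  have : W (upd m x t) = 0.
    move: D0; rewrite /D /W dyadic_split.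
    have := dyadic_ge0 l.+1 a.*2 (coord (upd m x t) m).
    have := dyadic_ge0 l.+1 a.*2.+1 (coord (upd m x t) m); lra.
  by move=> ->; rewrite D0 !mulr0 mul0r addr0.
have D11 : D (upd m x t) = 1.
  by apply: (mulfI D0); rewrite -expr2 dyadic_sqr mulr1.
have W1 : `|W (upd m x t)| <= 1.
  rewrite ler_norml; move: D11; rewrite /D /W dyadic_split.
  have := dyadic_ge0 l.+1 a.*2 (coord (upd m x t) m).
  have := dyadic_ge0 l.+1 a.*2.+1 (coord (upd m x t) m) => h1 h2 h3.
  by apply/andP; split; lra.
have dt : dyadic l a t != 0 by move: D0; rewrite /D coord_upd eqxx.
have := dyadic_osc sF cx c01 t01 dc dt; rewrite -/V => HV.
rewrite D11 mulr1 -lerBlDl [F (upd m x c) * _]mulrC -mulrBr.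
apply: (le_trans (ler_norm _)); rewrite normrM -[leRHS]mul1r.
by apply: ler_pM.
Qed.

(** In direction m the Haar function is a difference of two halves of an
    interval, to which [slice_haar1_le] applies; the other three factors are
    dominated by multiples of indicators.  Each of the four factors has
    amplitude 2^{l/2}, and the interval has length 2^{-l}. *)
Lemma haar_coef_le m F G l (i : haar_index l) : slice_derivative m F G ->
  (val i).2 m ->
  haar_coef F i <= 2 ^+ l * cint (fun x => chi (val i).1 x * `|G x|).
Proof.
move=> sF im; have [_ cF cG] := sF.
have bF := continuous_bounded cF; have bG := continuous_bounded cG.
set al := (val i).1.
have bc : cell_bounded (chi al : R4 -> R) by exact: chi_bounded.
have bcG := cell_boundedM bc (cell_bounded_norm bG).
rewrite -cintZ//; apply: (cint_slice_le (m := m)).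
- by apply: cell_boundedM => //; exact: haar_bounded.
- exact: cell_boundedZ.
move=> x cx.
pose A (x : R4) : R := \prod_(n < 4 | n != m) haar1 l (al n) ((val i).2 n) (coord x n).
pose Q (x : R4) : R := \prod_(n < 4 | n != m) dyadic l (al n) (coord x n).
have Aupd t : A (upd m x t) = A x.
  by apply: eq_bigr => n /negbTE nm; rewrite coord_upd nm.
have Qupd t : Q (upd m x t) = Q x.
  by apply: eq_bigr => n /negbTE nm; rewrite coord_upd nm.
pose r : R := 2 `^ (l%:R / 2).
have r0 : 0 < r by rewrite powR_gt0.
have r2 : r ^+ 2 = 2 ^+ l.
  by rewrite -powR_mulrn ?powR_ge0// -powRrM divfK ?pnatr_eq0// powR_mulrn.
(* Q is the indicator of the slab over the cube in the directions other than m. *)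
have AQ : `|A x| <= r ^+ 3 * Q x.
  have -> : r ^+ 3 * Q x = \prod_(n < 4 | n != m) (r * dyadic l (al n) (coord x n)).
    by rewrite big_split /= prodr_const cardC1 card_ord.
  rewrite normr_prod; apply: ler_prod => n _; rewrite normr_ge0 /= haar1E normrM.
  rewrite gtr0_norm// ler_pM2l// big_bool /= addn1 addn0 andbT andbF expr0 mul1r.
  rewrite (dyadic_split l).
  apply: (le_trans (ler_normD _ _)); rewrite normrM normrX normrN1 expr1n mul1r.
  by rewrite !ger0_norm ?dyadic_ge0// addrC.
have hE t : haar i (upd m x t) * F (upd m x t) =
   A x * r * ((dyadic l.+1 (al m).*2 (coord (upd m x t) m) -
       dyadic l.+1 (al m).*2.+1 (coord (upd m x t) m)) * F (upd m x t)).
  rewrite /haar (bigD1 m)//= -/(A _) Aupd im haar1E -/r big_bool /=.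
  by rewrite addn1 addn0 expr1 expr0; ring.
have cE t : 2 ^+ l * (chi al (upd m x t) * `|G (upd m x t)|) =
   2 ^+ l * Q x * (dyadic l (al m) (coord (upd m x t) m) * `|G (upd m x t)|).
  by rewrite /chi (bigD1 m)//= -/(Q _) Qupd; ring.
pose W (y : R4) := (dyadic l.+1 (al m).*2 (coord y m) - dyadic l.+1 (al m).*2.+1 (coord y m)) * F y.
have bW : cell_bounded W.
  by apply: cell_boundedM => //; apply: cell_boundedB; exact: dyadic_bounded.
pose D (y : R4) := dyadic l (al m) (coord y m) * `|G y|.
have bD : cell_bounded D.
  by apply: cell_boundedM; [exact: dyadic_bounded|exact: cell_bounded_norm].
have -> : slice_int m (fun y => haar i y * F y) x = A x * r * slice_int m W x.
  by rewrite -slice_intZ//; apply: eq_Rintegral => t _; exact: hE.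
have -> : slice_int m (fun y => 2 ^+ l * (chi al y * `|G y|)) x =
    2 ^+ l * Q x * slice_int m D x.
  by rewrite -slice_intZ//; apply: eq_Rintegral => t _; exact: cE.
have D0 : 0 <= slice_int m D x.
  by apply: Rintegral_ge0 => t _; rewrite mulr_ge0// dyadic_ge0.
(* The estimate for - F gives the other sign. *)
have hW : `|slice_int m W x| <= 2 ^- l * slice_int m D x.
  rewrite ler_norml lerNl; apply/andP; split; last exact: slice_haar1_le.
  have sN : slice_derivative m (fun y => - F y) (fun y => - G y).
    split; [move=> y; have [dF _ _] := sF; exact: is_deriveN| |].
    - by move=> y; apply: cvgN; exact: cF.
    - by move=> y; apply: cvgN; exact: cG.
  have := slice_haar1_le sN cx (ltn_ord (al m)).
  rewrite (_ : slice_int m (fun y => _ * `|- G y|) x = slice_int m D x); last first.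
    by apply: eq_Rintegral => t _; rewrite normrN.
  apply: le_trans; rewrite -mulN1r -slice_intZ// le_eqVlt; apply/orP; left.
  by apply/eqP/eq_Rintegral => t _; rewrite /W mulN1r mulrN.
apply: (le_trans (ler_norm _)); rewrite !normrM (gtr0_norm r0).
apply: (@le_trans _ _ (r ^+ 3 * Q x * r * (2 ^- l * slice_int m D x))).
  apply: ler_pM => //; first by rewrite mulr_ge0// ltW.
  by rewrite ler_pM2r.
have -> : r ^+ 3 * Q x * r * (2 ^- l * slice_int m D x) =
  (r ^+ 2 * 2 ^- l) * r ^+ 2 * Q x * slice_int m D x by ring.
by rewrite r2 divff ?mul1r// expf_neq0.
Qed.

(** Cauchy-Schwarz on a cube of volume 16^{-l}: (2^l)^2 16^{-l} = 4^{-l}. *)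
Lemma haar_coef_sqr_le m F G l (i : haar_index l) : slice_derivative m F G ->
  (val i).2 m ->
  haar_coef F i ^+ 2 <= 4 ^- l * cint (fun x => chi (val i).1 x * G x ^+ 2).
Proof.
move=> sF im; have [_ cF cG] := sF; have bG := continuous_bounded cG.
have H1 := haar_coef_le sF im.
have sN : slice_derivative m (fun y => - F y) (fun y => - G y).
  split; [move=> y; have [dF _ _] := sF; exact: is_deriveN| |].
  - by move=> y; apply: cvgN; exact: cF.
  - by move=> y; apply: cvgN; exact: cG.
have H2 := haar_coef_le sN im.
have E2 : haar_coef (fun y => - F y) i = - haar_coef F i.
  rewrite /haar_coef -mulN1r -cintZ; last first.
    by apply: cell_boundedM; [exact: haar_bounded|exact: continuous_bounded].
  by congr cint; apply/funext => x; rewrite mulN1r mulrN.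
have E3 : cint (fun x => chi (val i).1 x * `|- G x|) = cint (fun x => chi (val i).1 x * `|G x|).
  by congr cint; apply/funext => x; rewrite normrN.
rewrite E2 E3 in H2.
have H3 := cint_chi_cauchy_schwarz (val i).1 (cell_bounded_norm bG).
have E4 : cint (fun x => chi (val i).1 x * `|G x| ^+ 2) = cint (fun x => chi (val i).1 x * G x ^+ 2).
  by congr cint; apply/funext => x; rewrite real_normK ?num_real.
rewrite E4 in H3.
set S := cint (fun x => _ * `|G x|) in H1 H2 H3.
apply: (@le_trans _ _ ((2 ^+ l * S) ^+ 2)).
  have HS : `|haar_coef F i| <= 2 ^+ l * S by rewrite ler_norml lerNl H2 H1.
  by rewrite -[leLHS]real_normK ?num_real// lerXn2r// nnegrE (le_trans _ HS).
rewrite exprMn (_ : 4 ^- l = (2 ^+ l) ^+ 2 * 16 ^- l :> R).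
  by rewrite -mulrA ler_pM2l// exprn_gt0// exprn_gt0.
rewrite exprAC -[2 ^+ 2]natrX -exprVn -exprVn -exprMn; congr (_ ^+ _).
by field.
Qed.

(** Every Haar function has a direction m of type 1, in which
    [haar_coef_sqr_le] applies; each cube carries at most 16 of them, and the
    cubes partition the cell. *)
Lemma haar_level_le F (G : 'I_4 -> R4 -> R) l :
  (forall m, slice_derivative m F (G m)) ->
  \sum_(i : haar_index l) haar_coef F i ^+ 2 <=
  16 * 4 ^- l * \sum_m cint (fun x => G m x ^+ 2).
Proof.
move=> sF.
have bG m : cell_bounded (G m) by have [_ _ /continuous_bounded] := sF m.
pose T (al : cube l) := 4 ^- l * \sum_m cint (fun x => chi al x * G m x ^+ 2).
have T0 al : 0 <= T al.
  rewrite mulr_ge0 ?invr_ge0 ?exprn_ge0//; apply: sumr_ge0 => m _.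
  by apply: cint_ge0 => x _; rewrite mulr_ge0 ?sqr_ge0 ?chi_ge0.
have H (i : haar_index l) : haar_coef F i ^+ 2 <= T (val i).1.
  have [m im] : exists m, (val i).2 m.
    apply/existsP; have := valP i; apply: contraNT.
    rewrite negb_exists => /forallP h; apply/eqP/ffunP => m; rewrite ffunE.
    exact/negbTE.
  apply: (le_trans (haar_coef_sqr_le (sF m) im)); rewrite /T ler_pM2l ?invr_gt0 ?exprn_gt0//.
  rewrite (bigD1 m)//= lerDl; apply: sumr_ge0 => n _.
  by apply: cint_ge0 => x _; rewrite mulr_ge0 ?sqr_ge0 ?chi_ge0.
apply: (le_trans (ler_sum _ (fun i _ => H i))).
rewrite (sum_haar_index (fun p : cube l * {ffun 'I_4 -> bool} => T p.1)) /=.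
apply: (@le_trans _ _ (\sum_(al : cube l) \sum_(b : {ffun 'I_4 -> bool}) T al)).
  by apply: ler_sum => al _; rewrite [leRHS](bigD1 [ffun=> false])//= lerDr.
have cb al : \sum_(b : {ffun 'I_4 -> bool}) T al = 16 * T al.
  by rewrite sumr_const card_ffun card_bool card_ord mulr_natl.
rewrite (eq_bigr _ (fun al _ => cb al)).
rewrite -mulr_sumr -mulr_sumr -mulrA exchange_big /=.
rewrite (eq_bigr (fun m => cint (fun x => G m x ^+ 2))) => [|m _].
  exact: lexx.
by rewrite sum_cint_chi//; exact: cell_bounded_sqr.
Qed.

End SliceCalculus.

(** * The eigenbasis against the Haar system *)

Section Eigenbasis.
Context (R : realType).
Local Notation R4 := (R * R * R * R)%type.
Variables (phi : nat -> R4 -> R) (lam : nat -> R).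
Hypothesis Hphi : laplace_eigenbasis phi lam.

Lemma eigen_continuous j : continuous (phi j).
Proof. by have [] := eigen_C2 Hphi j. Qed.

Lemma eigen_bounded j : cell_bounded (phi j).
Proof. exact: continuous_bounded (@eigen_continuous j). Qed.

Lemma eigen_slice_derivative j m : slice_derivative m (phi j) (partial m (phi j)).
Proof.
have [cf d1 _] := eigen_C2 Hphi j; have [df cdf] := d1 m.
by split=> // x; apply/derivableP; exact: df.
Qed.

Lemma partial_slice_derivative j m :
  slice_derivative m (partial m (phi j)) (partial m (partial m (phi j))).
Proof.
have [_ d1 d2] := eigen_C2 Hphi j; have [_ cdf] := d1 m; have [ddf cddf] := d2 m m.
by split=> // x; apply/derivableP; exact: ddf.
Qed.

Lemma partial_periodic j m : torus_periodic (partial m (phi j)).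
Proof.
move=> x n; rewrite /partial /derive.
have -> // : (fun h : R => h^-1 *: ((phi j \o shift (x + basis_vec n)) (h *: (basis_vec m : R4))
      - phi j (x + basis_vec n))) =
    (fun h => h^-1 *: ((phi j \o shift x) (h *: (basis_vec m : R4)) - phi j x)).
by apply/funext => h /=; rewrite addrA !(eigen_periodic Hphi).
Qed.

Lemma cint_eigen i j : cint (fun x => phi i x * phi j x) = (i == j)%:R.
Proof. exact: (eigen_orthonormal Hphi). Qed.

Lemma cint_eigen_sqr j : cint (fun x => phi j x ^+ 2) = 1.
Proof. by have := cint_eigen j j; rewrite eqxx. Qed.

(** Integration by parts: the integral of the derivative of the periodic
    function phi d(phi) vanishes, so the gradient has squared norm
    <phi, - laplacian phi> = lam. *)
Lemma eigen_gradient j : \sum_m cint (fun x => partial m (phi j) x ^+ 2) = lam j.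
Proof.
have bphi := eigen_bounded j.
have bp m : cell_bounded (partial m (phi j)).
  by have [_ _ /continuous_bounded] := eigen_slice_derivative j m.
have bpp m : cell_bounded (partial m (partial m (phi j))).
  by have [_ _ /continuous_bounded] := partial_slice_derivative j m.
have bM m := cell_boundedM bphi (bpp m).
have E m : cint (fun x => partial m (phi j) x ^+ 2) =
    - cint (fun x => phi j x * partial m (partial m (phi j)) x).
  have [d1 c0 c1] := eigen_slice_derivative j m.
  have [d2 _ c2] := partial_slice_derivative j m.
  have sF : slice_derivative m (fun x => phi j x * partial m (phi j) x)
     (fun x => phi j x * partial m (partial m (phi j)) x + partial m (phi j) x ^+ 2).
    split.
    - by move=> x; exact: (is_deriveM (d1 x) (d2 x)).
    - by move=> x; apply: cvgM; [exact: c0|exact: c1].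
    - move=> x; apply: cvgD; first by apply: cvgM; [exact: c0|exact: c2].
      by apply: cvgM; exact: c1.
  have pF : torus_periodic (fun x => phi j x * partial m (phi j) x).
    by move=> x n; rewrite (eigen_periodic Hphi) partial_periodic.
  have := cint_derivative_periodic pF sF.
  rewrite cintD//; last exact: cell_bounded_sqr.
  by move/eqP; rewrite addrC addr_eq0 => /eqP.
under eq_bigr do rewrite E.
rewrite sumrN -cint_sum// -mulN1r -cintZ; last exact: cell_bounded_sum.
rewrite -[RHS]mulr1 -[in RHS](cint_eigen_sqr j) -[RHS]cintZ; last exact: cell_bounded_sqr.
congr cint; apply/funext => x.
by rewrite expr2 mulrA -(eigen_eq Hphi) /laplacian -mulr_sumr mulN1r mulNr [phi j x * _]mulrC.
Qed.

Lemma lam_ge0 j : 0 <= lam j.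
Proof. by rewrite -(eigen_lam0 Hphi); exact: (eigen_mono Hphi). Qed.

Lemma lam_gt0 j : (0 < j)%N -> 0 < lam j.
Proof. by move=> j0; exact: lt_le_trans (eigen_lam1 Hphi) (eigen_mono Hphi j0). Qed.

(** The sum of 16 * 4^{-k} over k >= l is (64/3) 4^{-l}. *)
Definition energy_const : R := 64 / 3.

(** By [haar_level_energy] and [haar_level_le], the energy plus the remaining
    geometric tail of bounds is nonincreasing in l, and its limit is the
    squared norm 1 of phi_j. *)
Lemma cube_energy_ge l j : 1 - energy_const * 4 ^- l * lam j <= cube_energy l (phi j).
Proof.
have step k : cube_energy k.+1 (phi j) + energy_const * 4 ^- k.+1 * lam j <=
    cube_energy k (phi j) + energy_const * 4 ^- k * lam j.
  have := haar_level_energy k (eigen_bounded j).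
  have := haar_level_le k (eigen_slice_derivative j).
  rewrite eigen_gradient exprS invfM /energy_const; set q := 4 ^- k => h1 h2.
  by rewrite h2 in h1; lra.
have mono k : cube_energy (l + k) (phi j) + energy_const * 4 ^- (l + k) * lam j <=
    cube_energy l (phi j) + energy_const * 4 ^- l * lam j.
  elim: k => [|k IH]; first by rewrite addn0.
  by rewrite addnS; exact: le_trans (step _) IH.
rewrite lerBlDr -[leLHS](cint_eigen_sqr j).
have cv := cube_energy_cvg (@eigen_continuous j).
rewrite -[leLHS](cvg_lim (@Rhausdorff R) cv).
apply: limr_le; first by apply/cvg_ex; eexists; exact: cv.
exists l => // n /= ln; apply: le_trans (_ : _ <= cube_energy n (phi j) + energy_const * 4 ^- n * lam j) _.
  by rewrite lerDl mulr_ge0 ?lam_ge0// mulr_ge0 ?invr_ge0 ?exprn_ge0// /energy_const divr_ge0.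
by have := mono (n - l)%N; rewrite subnKC.
Qed.

Definition comb N (v : nat -> R) : R4 -> R := fun x => \sum_(j < N) v j * phi j x.

Lemma comb_bounded N v : cell_bounded (comb N v).
Proof.
by apply: cell_bounded_sum => j; apply: cell_boundedZ; exact: eigen_bounded.
Qed.

Lemma cint_comb N v g : cell_bounded g ->
  cint (fun x => g x * comb N v x) = \sum_(j < N) v j * cint (fun x => g x * phi j x).
Proof.
move=> bg.
have bgp j := cell_boundedM bg (eigen_bounded j).
transitivity (cint (fun x => \sum_(j < N) v j * (g x * phi j x))).
  congr cint; apply/funext => x; rewrite mulr_sumr.
  by apply: eq_bigr => j _; rewrite mulrCA.
rewrite cint_sum => [|j]; last exact: cell_boundedZ.
by apply: eq_bigr => j _; rewrite cintZ.
Qed.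

Lemma cint_comb_sqr N (v : nat -> R) : cint (fun x => comb N v x ^+ 2) = \sum_(j < N) v j ^+ 2.
Proof.
transitivity (cint (fun x => comb N v x * comb N v x)) => //.
rewrite cint_comb; last exact: comb_bounded.
apply: eq_bigr => j _; rewrite expr2; congr (_ * _).
rewrite (_ : (fun x => _) = (fun x => phi j x * comb N v x)); last first.
  by apply/funext => x; rewrite mulrC.
rewrite cint_comb; last exact: eigen_bounded.
rewrite (bigD1 j)//= cint_eigen eqxx mulr1 big1 ?addr0// => i ij.
by rewrite cint_eigen eq_sym (negbTE ij : (i == j :> nat) = false) mulr0.
Qed.

Lemma haar_coef_comb N v l (i : haar_index l) :
  haar_coef (comb N v) i = \sum_(j < N) v j * coefs phi (haar i) j.
Proof. by rewrite /haar_coef cint_comb//; exact: haar_bounded. Qed.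

(** The Haar functions together with the constant 1 are orthonormal, and this
    is Bessel's inequality for them, read off the energy of the averages. *)
Lemma comb_energy_le l N (v : nat -> R) :
  \sum_(k < l) \sum_(i : haar_index k) (\sum_(j < N) v j * coefs phi (haar i) j) ^+ 2
  + (\sum_(j < N) v j * cint (phi j)) ^+ 2 <= \sum_(j < N) v j ^+ 2.
Proof.
rewrite -(cint_comb_sqr N v); apply: le_trans (cube_energy_le l (comb_bounded N v)).
have := haar_energy l (comb_bounded N v).
rewrite (_ : cint (comb N v) = \sum_(j < N) v j * cint (phi j)); last first.
  have := cint_comb N v (cell_bounded_cst (1 : R)).
  have one g : (fun x : R4 => 1 * g x) = g by apply/funext => x; rewrite mul1r.
  by rewrite one => ->; apply: eq_bigr => j _; rewrite one.
under eq_bigr do under eq_bigr do rewrite haar_coef_comb.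
by move=> ->; rewrite subrK.
Qed.

Lemma haar_bessel l N (v : nat -> R) :
  \sum_(k < l) \sum_(i : haar_index k) (\sum_(j < N) v j * coefs phi (haar i) j) ^+ 2
  <= \sum_(j < N) v j ^+ 2.
Proof. by apply: le_trans (comb_energy_le l N v); rewrite lerDl sqr_ge0. Qed.

(** As lam 0 = 0, the bound [cube_energy_ge] says that the mean a of phi_0
    satisfies a^2 >= 1.  Bessel's inequality with the single function 1, tested
    on a phi_0 + b phi_j where b is the mean of phi_j, gives
    (a^2 + b^2)^2 <= a^2 + b^2, which forces b = 0. *)
Lemma cint_eigen_pos j : (0 < j)%N -> cint (phi j) = 0.
Proof.
move=> j0.
have m0 : 1 <= cint (phi 0%N) ^+ 2.
  have := cube_energy_ge 0 0; rewrite (eigen_lam0 Hphi) mulr0 subr0 cube_energy0//.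
  exact: eigen_bounded.
(* The coefficients of a phi_0 + b phi_j. *)
pose v i := if i == 0%N then cint (phi 0%N) else if i == j then cint (phi j) else 0.
have := comb_energy_le 0 j.+1 v; rewrite big_ord0 add0r.
have vE (F : nat -> R) : \sum_(i < j.+1) v i * F i =
   cint (phi 0%N) * F 0%N + cint (phi j) * F j.
  rewrite (bigD1 ord0)//= (bigD1 ord_max)//=; last by rewrite -val_eqE /= -lt0n.
  rewrite big1 ?addr0 => [|i /andP[i0 ij]].
    by rewrite /v /= (gtn_eqF j0) eqxx.
  by rewrite /v -!val_eqE /= in i0 ij *; rewrite (negbTE i0) (negbTE ij) mul0r.
have -> : \sum_(i < j.+1) v i ^+ 2 = \sum_(i < j.+1) v i * v i by [].
rewrite (vE v) (vE (fun i => cint (phi i))) /v /= (gtn_eqF j0) !eqxx.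
set a := cint (phi 0%N) in m0 *; set b := cint (phi j); move=> H.
(* (a^2 + b^2)^2 <= a^2 + b^2 and a^2 >= 1. *)
have b2 : b ^+ 2 = 0 by have := sqr_ge0 b; nra.
by apply/eqP; rewrite -sqrf_eq0 b2.
Qed.

Lemma haar_mass_ge l j : (0 < j)%N ->
  1 - energy_const * 4 ^- l * lam j <=
  \sum_(k < l) \sum_(i : haar_index k) coefs phi (haar i) j ^+ 2.
Proof.
move=> j0; apply: (le_trans (cube_energy_ge l j)).
have := haar_energy l (eigen_bounded j).
by rewrite cint_eigen_pos// expr0n subr0 => <-.
Qed.

(** Bessel's inequality for the phi_j and the indicator of one cube: the
    combination of the phi_j with the coefficients of the indicator is tested
    in [cube_energy_le]. *)
Lemma cube_bessel l N (al : cube l) :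
  \sum_(j < N) cint (fun x => chi al x * phi j x) ^+ 2 <= 16 ^- l.
Proof.
pose v j := cint (fun x => chi al x * phi j x).
set B := \sum_(j < N) _.
have B0 : 0 <= B by apply: sumr_ge0 => j _; exact: sqr_ge0.
have E : cint (fun x => chi al x * comb N v x) = B.
  by rewrite cint_comb//; exact: chi_bounded.
have := cube_energy_le l (comb_bounded N v); rewrite cint_comb_sqr -/B.
rewrite /cube_energy (bigD1 al)//= E => H.
have q0 : 0 < 16 ^+ l :> R by rewrite exprn_gt0.
have {}H : 16 ^+ l * B ^+ 2 <= B.
  apply: le_trans H; rewrite ler_pM2l// lerDl.
  by apply: sumr_ge0 => be _; exact: sqr_ge0.
have [->|Bn] := eqVneq B 0; first by rewrite invr_ge0 ltW.
have Bp : 0 < B by rewrite lt_def Bn.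
by rewrite -[leRHS]div1r ler_pdivlMr// mulrC -(ler_pM2r Bp) mul1r -mulrA -expr2.
Qed.

(** With N = 2 * 16^l eigenfunctions, the total energy at level l is at most
    16^l, the number of cubes.  By [cube_energy_ge] it is also at least
    N (1 - (64/3) 4^{-l} L), where L is the largest of the eigenvalues, so that
    (64/3) 4^{-l} L >= 1/2. *)
Lemma weyl_lower_bound l : 3 / 128 * 4 ^+ l <= lam (2 * 16 ^ l).-1.
Proof.
set N := (2 * 16 ^ l)%N; set L := lam N.-1.
have N0 : (0 < N)%N by rewrite muln_gt0 expn_gt0.
have h1 : \sum_(j < N) cube_energy l (phi j) <= 16 ^+ l.
  rewrite /cube_energy -mulr_sumr exchange_big /=.
  rewrite -[leRHS]mulr1 ler_pM2l ?exprn_gt0//.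
  apply: (le_trans (ler_sum _ (fun al _ => cube_bessel N al))).
  rewrite sumr_const card_ffun !card_ord -expnM mulnC expnM -[_ *+ _]mulr_natl natrX.
  by rewrite divff// expf_neq0.
have h2 : \sum_(j < N) (1 - energy_const * 4 ^- l * L) <= \sum_(j < N) cube_energy l (phi j).
  apply: ler_sum => j _; apply: le_trans (cube_energy_ge l j).
  rewrite lerD2l lerN2 ler_wpM2l//.
    by rewrite /energy_const divr_ge0// ?exprn_ge0.
  by apply: (eigen_mono Hphi); rewrite -ltnS prednK.
have := le_trans h2 h1; rewrite sumr_const card_ord -[X in X <= _ -> _]mulr_natl natrM natrX.
set q : R := 4 ^+ l; have q0 : 0 < q by rewrite exprn_gt0.
have r0 : 0 < 16 ^+ l :> R by rewrite exprn_gt0.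
rewrite -[X in _ <= X -> _]mul1r mulrAC ler_pM2r// /energy_const => H.
have : q^-1 * L >= 3 / 128 by lra.
by rewrite -(ler_pM2r q0) [q^-1 * L * q]mulrAC mulVf ?gt_eqF// mul1r.
Qed.

End Eigenbasis.

(** * Square-summable sequences *)

Section SquareSummable.
Context (R : realType).
Implicit Types (x y z u : nat -> R).

Lemma nneg_series_cvg u (C : R) : (forall j, 0 <= u j) ->
  (forall N, \sum_(j < N) u j <= C) -> cvgn (series u) /\ limn (series u) <= C.
Proof.
move=> u0 uC.
have c : cvgn (series u).
  apply: nondecreasing_is_cvgn; first exact: nondecreasing_series.
  by exists C => _ [n _ <-]; rewrite seriesEord; exact: uC.
by split=> //; apply: limr_le => //; exists 0%N => // n _; rewrite seriesEord; exact: uC.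
Qed.

Lemma nneg_partial_le u N : (forall j, 0 <= u j) -> cvgn (series u) ->
  \sum_(j < N) u j <= limn (series u).
Proof.
move=> u0 cu; have nd : nondecreasing_seq (series u) by exact: nondecreasing_series.
by have := nondecreasing_cvgn_le nd cu N; rewrite {1}seriesEord.
Qed.

Definition l2 x := cvgn (series (fun j => x j * x j)).

Lemma l2_pairing_cvg x y : l2 x -> l2 y -> cvgn (series (fun j => x j * y j)).
Proof.
move=> lx ly; apply: normed_cvg.
apply: (@series_le_cvg _ _ (fun j => x j * x j + y j * y j)) => //.
- by move=> n; exact: normr_ge0.
- by move=> n; rewrite addr_ge0// -expr2 sqr_ge0.
- move=> n; rewrite ler_norml.
  have := sqr_ge0 (x n + y n); have := sqr_ge0 (x n - y n); rewrite sqrrB sqrrD.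
  by rewrite !expr2 => h1 h2; apply/andP; split; nra.
- exact: is_cvg_seriesD lx ly.
Qed.

Lemma pairingC x y : pairing x y = pairing y x.
Proof. by rewrite /pairing; congr (limn (series _)); apply/funext => j; rewrite mulrC. Qed.

Lemma pairingDl x y z : l2 x -> l2 y -> l2 z ->
  pairing (fun j => x j + y j) z = pairing x z + pairing y z.
Proof.
move=> lx ly lz; rewrite /pairing -lim_seriesD; [|exact: l2_pairing_cvg..].
by congr (limn (series _)); apply/funext => j; rewrite mulrDl.
Qed.

Lemma pairingZl (c : R) x z : l2 x -> l2 z ->
  pairing (fun j => c * x j) z = c * pairing x z.
Proof.
move=> lx lz.
rewrite /pairing -[RHS](@lim_seriesZ _ _ c); last exact: l2_pairing_cvg.
by congr (limn (series _)); apply/funext => j; exact/esym/mulrA.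
Qed.

Lemma l2Z (c : R) x : l2 x -> l2 (fun j => c * x j).
Proof.
move=> lx; rewrite /l2 (_ : (fun j => _) = c ^+ 2 *: (fun j => x j * x j)).
  exact: is_cvg_seriesZ.
by apply/funext => j; rewrite mulrACA -expr2.
Qed.

Lemma l2D x y : l2 x -> l2 y -> l2 (fun j => x j + y j).
Proof.
move=> lx ly.
have c : cvgn (series (2 *: (fun j => x j * x j) + 2 *: (fun j => y j * y j))).
  by apply: is_cvg_seriesD; exact: is_cvg_seriesZ.
apply: (series_le_cvg _ _ _ c) => n.
- by rewrite -expr2 sqr_ge0.
- rewrite -[leRHS]/(2 * (x n * x n) + 2 * (y n * y n)).
  by rewrite addr_ge0// mulr_ge0// -expr2 sqr_ge0.
- rewrite -[leRHS]/(2 * (x n * x n) + 2 * (y n * y n)).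
  by have := sqr_ge0 (x n - y n); nra.
Qed.

Lemma pairing_sqrD x y : l2 x -> l2 y ->
  pairing (fun j => x j + y j) (fun j => x j + y j) =
  pairing x x + 2 * pairing x y + pairing y y.
Proof.
move=> lx ly; have lD := l2D lx ly; rewrite (pairingDl lx ly lD).
rewrite (pairingC x) (pairingC y (fun j => x j + y j)) !pairingDl// (pairingC y x).
by ring.
Qed.

Lemma pairing_self_ge0 x : 0 <= pairing x x.
Proof.
have [lx|nl] := pselect (l2 x); last by rewrite /pairing dvgP.
by apply: limr_ge => //; exists 0%N => // n _; apply: sumr_ge0 => j _; rewrite -expr2 sqr_ge0.
Qed.

Lemma l2_finite x N : (forall j, (N <= j)%N -> x j = 0) -> l2 x.
Proof.
move=> x0; suff [] : cvgn (series (fun j => x j * x j)) /\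
  limn (series (fun j => x j * x j)) <= \sum_(j < N) x j * x j by [].
apply: nneg_series_cvg => [j|n].
  by rewrite -expr2 sqr_ge0.
have x2 j : 0 <= x j * x j by rewrite -expr2 sqr_ge0.
rewrite -(big_mkord xpredT (fun j => x j * x j)) -(big_mkord xpredT (fun j => x j * x j)).
have [nN|Nn] := leqP n N.
  by rewrite [leRHS](big_cat_nat (leq0n _) nN)//= lerDl sumr_ge0.
rewrite (big_cat_nat (leq0n _) (ltnW Nn))//= gerDl big_nat_cond big1 // => j.
by rewrite andbT => /andP[/x0 -> _]; rewrite mul0r.
Qed.

Lemma l2_unit_coef j : l2 (unit_coef j).
Proof.
apply: (@l2_finite _ j.+1) => i ji; rewrite /unit_coef.
by rewrite (_ : (i == j) = false)//; apply/negbTE; rewrite neq_ltn ji orbT.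
Qed.

Lemma pairing_unit_coef j y : pairing (unit_coef j) y = y j.
Proof.
apply/cvg_lim => //; apply: cvg_near_cst; exists j.+1 => // n /= jn.
rewrite seriesEord /= (bigD1 (Ordinal jn))//= /unit_coef eqxx mul1r big1 ?addr0// => i.
by rewrite -val_eqE /= => /negbTE ->; rewrite mul0r.
Qed.

Definition head N x : nat -> R := fun j => if (j < N)%N then x j else 0.
Definition tail N x : nat -> R := fun j => if (j < N)%N then 0 else x j.

Lemma head_tail N x : x = (fun j => head N x j + tail N x j).
Proof. by apply/funext => j; rewrite /head /tail; case: ifP; rewrite ?addr0 ?add0r. Qed.

Lemma l2_head N x : l2 (head N x).
Proof. by apply: (@l2_finite _ N) => j; rewrite /head ltnNge => ->. Qed.

Lemma l2_tail N x : l2 x -> l2 (tail N x).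
Proof.
move=> lx; apply: (series_le_cvg _ _ _ lx) => j; [by rewrite -expr2 sqr_ge0..|].
by rewrite /tail; case: ifP => _; rewrite ?mul0r -?expr2 ?sqr_ge0.
Qed.

Lemma pairing_tail_cvg x : l2 x -> (fun N => pairing (tail N x) (tail N x)) @ \oo --> 0.
Proof.
move=> lx.
have E N : pairing (tail N x) (tail N x) =
    pairing x x - series (fun j => x j * x j) N.
  apply/cvg_lim => //.
  have : (fun n => series (fun j => x j * x j) n - series (fun j => x j * x j) N) @ \oo
    --> pairing x x - series (fun j => x j * x j) N.
    by apply: cvgB; [exact: lx|exact: cvg_cst].
  apply: cvg_trans; apply: near_eq_cvg; exists N => // n /= Nn.
  rewrite !seriesEnat /= [X in X - _](big_cat_nat (leq0n _) Nn)//= addrAC subrr add0r.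
  rewrite [RHS](big_cat_nat (leq0n _) Nn)//= [X in _ = X + _]big_nat_cond [X in _ = X + _]big1 ?add0r.
    rewrite !big_nat; apply: eq_bigr => j /andP[Nj _].
    by rewrite /tail ltnNge Nj.
  by move=> j; rewrite andbT /tail => /andP[_ ->]; rewrite mul0r.
under eq_fun do rewrite E; rewrite -(subrr (pairing x x)).
by apply: cvgB; [exact: cvg_cst|exact: lx].
Qed.

Section Rows.
Variables (I : nat -> finType) (M : forall k, I k -> nat -> R).
Hypothesis bessel : forall l N (v : nat -> R),
  \sum_(k < l) \sum_(i : I k) (\sum_(j < N) v j * M i j) ^+ 2 <= \sum_(j < N) v j ^+ 2.
Hypothesis mass : forall j, (0 < j)%N ->
  (fun l => \sum_(k < l) \sum_(i : I k) M i j ^+ 2) @ \oo --> (1 : R).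

(** Testing Bessel's inequality on the row itself, the partial sum B of its
    squares satisfies B^2 <= B. *)
Lemma row_l2 k (i : I k) : l2 (M i).
Proof.
suff [] : cvgn (series (fun j => M i j * M i j)) /\
  limn (series (fun j => M i j * M i j)) <= 1 by [].
apply: nneg_series_cvg => [j|N]; first by rewrite -expr2 sqr_ge0.
have H := bessel k.+1 N (M i).
rewrite big_ord_recr /= (bigD1 i)//= in H; pose B := \sum_(j < N) M i j * M i j.
rewrite -/B; have B0 : 0 <= B by apply: sumr_ge0 => j _; rewrite -expr2 sqr_ge0.
have {}H : B ^+ 2 <= B.
  apply: le_trans H; rewrite addrCA lerDl addr_ge0//.
    by apply: sumr_ge0 => k' _; apply: sumr_ge0 => i' _; exact: sqr_ge0.
  by apply: sumr_ge0 => i' _; exact: sqr_ge0.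
have [//|B1] := lerP B 1; nra.
Qed.

(** The rows M i play the role of an orthonormal system, of which only Bessel's
    inequality and the limits of the column sums are known. *)
Definition row_energy l x : R := \sum_(k < l) \sum_(i : I k) pairing x (M i) ^+ 2.

Lemma row_energy_le l x : l2 x -> row_energy l x <= pairing x x.
Proof.
move=> lx.
have c : (fun N => \sum_(k < l) \sum_(i : I k) (\sum_(j < N) x j * M i j) ^+ 2) @ \oo
   --> row_energy l x.
  apply: cvg_big => [|k _]; first exact: add_continuous.
  apply: cvg_big => [|i _]; first exact: add_continuous.
  have c : (fun N => \sum_(j < N) x j * M i j) @ \oo --> pairing x (M i).
    have := l2_pairing_cvg lx (@row_l2 _ i); rewrite /pairing /series /=.
    by under eq_fun do rewrite big_mkord.
  by under eq_fun do rewrite expr2; rewrite expr2; apply: cvgM.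
have x2 j : 0 <= x j * x j by rewrite -expr2 sqr_ge0.
rewrite -(cvg_lim (@Rhausdorff R) c); apply: limr_le.
  by apply/cvg_ex; eexists; exact: c.
exists 0%N => // N _; apply: (le_trans (bessel l N x)).
exact: nneg_partial_le x2 lx.
Qed.

Definition row_defect l x : R := pairing x x - row_energy l x.

Lemma row_defect_ge0 l x : l2 x -> 0 <= row_defect l x.
Proof. by move=> lx; rewrite subr_ge0 row_energy_le. Qed.

Lemma row_defectZ l c x : l2 x -> row_defect l (fun j => c * x j) = c ^+ 2 * row_defect l x.
Proof.
move=> lx; rewrite /row_defect mulrBr pairingZl//; last exact: l2Z.
rewrite pairingC pairingZl// mulrA -expr2; congr (_ - _).
rewrite /row_energy mulr_sumr; apply: eq_bigr => k _.
rewrite mulr_sumr; apply: eq_bigr => i _.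
by rewrite pairingZl ?exprMn//; exact: row_l2.
Qed.

(** The defect is a nonnegative quadratic form: the parallelogram identity
    bounds its value at x + y by the sum of the values at x + y and x - y. *)
Lemma row_defectD l x y : l2 x -> l2 y ->
  row_defect l (fun j => x j + y j) <= 2 * row_defect l x + 2 * row_defect l y.
Proof.
move=> lx ly.
(* y' is - y, written as a multiple so that the linearity of the pairing applies. *)
pose y' j := (-1) * y j.
have ly' : l2 y' by exact: l2Z.
have lD := l2D lx ly; have lB := l2D lx ly'.
have P : row_defect l (fun j => x j + y j) + row_defect l (fun j => x j + y' j) =
  2 * row_defect l x + 2 * row_defect l y.
  have n1 : pairing (fun j => x j + y j) (fun j => x j + y j) +
     pairing (fun j => x j + y' j) (fun j => x j + y' j) =
     2 * pairing x x + 2 * pairing y y.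
    have xy' : pairing x y' = - pairing x y.
      by rewrite pairingC /y' pairingZl// mulN1r pairingC.
    have y'y' : pairing y' y' = pairing y y.
      by rewrite {1}/y' pairingZl// pairingC /y' pairingZl//; ring.
    by rewrite !pairing_sqrD// xy' y'y'; ring.
  have n2 : row_energy l (fun j => x j + y j) + row_energy l (fun j => x j + y' j) =
     2 * row_energy l x + 2 * row_energy l y.
    rewrite /row_energy !mulr_sumr -!big_split /=; apply: eq_bigr => k _.
    rewrite !mulr_sumr -!big_split /=; apply: eq_bigr => i _.
    have lM := @row_l2 _ i.
    by rewrite !pairingDl// /y' pairingZl//; ring.
  by rewrite /row_defect; lra.
by rewrite -P lerDl row_defect_ge0.
Qed.

Lemma row_defect_cvgD x y : l2 x -> l2 y ->
  (fun l => row_defect l x) @ \oo --> 0 -> (fun l => row_defect l y) @ \oo --> 0 ->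
  (fun l => row_defect l (fun j => x j + y j)) @ \oo --> 0.
Proof.
move=> lx ly cx cy.
apply: (@squeeze_cvgr _ _ _ _ (fun=> 0) (fun l => 2 * row_defect l x + 2 * row_defect l y)).
- by near=> l; rewrite row_defect_ge0 ?row_defectD//; exact: l2D.
- exact: cvg_cst.
- rewrite (_ : 0 = 2 * 0 + 2 * 0); last by ring.
  by apply: cvgD; apply: cvgM => //; exact: cvg_cst.
Unshelve. all: by end_near. Qed.

Lemma row_defect_unit j : (0 < j)%N -> (fun l => row_defect l (unit_coef j)) @ \oo --> 0.
Proof.
move=> j0; rewrite /row_defect -(subrr (1 : R)).
apply: cvgB; first by rewrite pairing_unit_coef /unit_coef eqxx; exact: cvg_cst.
have := mass j0; rewrite /row_energy.
by under [X in _ -> X @ _ --> _]eq_fun do under eq_bigr do under eq_bigr do rewrite pairing_unit_coef.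
Qed.

Lemma row_defect_head x N : x 0%N = 0 -> (fun l => row_defect l (head N x)) @ \oo --> 0.
Proof.
move=> x0; elim: N => [|N IH].
  have -> : head 0 x = (fun j => 0 * unit_coef 1 j) by apply/funext => j; rewrite mul0r.
  under eq_fun do rewrite (row_defectZ _ _ (@l2_unit_coef 1)) expr0n mul0r.
  exact: cvg_cst.
have -> : head N.+1 x = (fun j => head N x j + x N * unit_coef N j).
  apply/funext => j; rewrite /head /unit_coef ltnS leq_eqVlt.
  have [->|jN] := eqVneq j N; first by rewrite ltnn mulr1 add0r.
  by rewrite mulr0 addr0.
apply: row_defect_cvgD => //; first exact: l2_head.
  exact/l2Z/l2_unit_coef.
under eq_fun do rewrite (row_defectZ _ _ (@l2_unit_coef N)).
have [->|N0] := posnP N.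
  by rewrite x0 expr0n; under eq_fun do rewrite mul0r; exact: cvg_cst.
rewrite -(mulr0 (x N ^+ 2)); apply: cvgM; first exact: cvg_cst.
exact: row_defect_unit.
Qed.

(** The finitely supported sequences vanishing at 0 are combinations of unit
    sequences, and the defect of a tail is at most its squared norm. *)
Lemma row_parseval x : l2 x -> x 0%N = 0 -> (fun l => row_defect l x) @ \oo --> 0.
Proof.
move=> lx x0; apply/cvgrPdist_le => e e0.
have e4 : 0 < e / 4 by rewrite divr_gt0.
have /cvgrPdist_le/(_ _ e4)[N _ /(_ N (leqnn N))/=] := pairing_tail_cvg lx.
rewrite sub0r normrN ger0_norm ?pairing_self_ge0// => hN.
have /cvgrPdist_le/(_ _ e4)[l0 _ Hl] := row_defect_head N x0.
exists l0 => // l /Hl /=; rewrite !sub0r !normrN !ger0_norm ?row_defect_ge0//; last exact: l2_head.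
have := row_defectD l (@l2_head N x) (@l2_tail N x lx); rewrite -head_tail.
have : row_defect l (tail N x) <= pairing (tail N x) (tail N x).
  rewrite gerBl; apply: sumr_ge0 => k _; apply: sumr_ge0 => i _; exact: sqr_ge0.
by lra.
Qed.

End Rows.
End SquareSummable.

(** * Spectral sums *)

Section SpectralSums.
Context (R : realType).
Variable lam : nat -> R.
Hypothesis lam_pos : forall j, (0 < j)%N -> 0 < lam j.
Hypothesis lam_mono : forall i j, (i <= j)%N -> lam i <= lam j.

Lemma sobolev_partial s (u : nat -> R) : sobolev lam s u ->
  exists C, forall N, \sum_(j < N) (1 + lam j) `^ s * u j ^+ 2 <= C.
Proof.
rewrite /sobolev /sobolev_sqnorm /= => fin.
pose t j := (1 + lam j) `^ s * u j ^+ 2.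
have t0 j : 0 <= t j by rewrite mulr_ge0 ?powR_ge0 ?sqr_ge0.
exists (fine (\sum_(0 <= j <oo) (t j)%:E)%E) => N.
rewrite -lee_fin fineK; last first.
  by rewrite ge0_fin_numE// nneseries_ge0// => j _ _; rewrite lee_fin.
rewrite -sumEFin -(big_mkord xpredT (fun j => (t j)%:E)).
by apply: (@nneseries_lim_ge R _ xpredT 0 N) => j _ _; rewrite lee_fin.
Qed.

Lemma sobolev_green_l2 (u : nat -> R) : sobolev lam (- 2) u -> l2 (green lam u).
Proof.
move=> /sobolev_partial[C HC].
have l1 : 0 < lam 1%N by exact: lam_pos.
pose K : R := (1 + (lam 1%N)^-1) ^+ 2.
have K0 : 0 < K by rewrite exprn_gt0// addr_gt0// invr_gt0.
suff [] : cvgn (series (fun j => green lam u j * green lam u j)) /\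
  limn (series (fun j => green lam u j * green lam u j)) <= K * C by [].
apply: nneg_series_cvg => [j|N]; first by rewrite -expr2 sqr_ge0.
apply: le_trans (_ : _ <= K * \sum_(j < N) (1 + lam j) `^ (- 2) * u j ^+ 2) _; last first.
  by rewrite ler_pM2l.
rewrite mulr_sumr; apply: ler_sum => j _; rewrite /green.
have [_|j0] := eqVneq (j : nat) 0%N.
  by rewrite mul0r mulr_ge0 ?(ltW K0)// mulr_ge0 ?powR_ge0 ?sqr_ge0.
have lj : 0 < lam j by rewrite lam_pos// lt0n.
have l1j : lam 1%N <= lam j by rewrite lam_mono// lt0n.
rewrite powRN powR_mulrn; last by rewrite addr_ge0// ltW.
rewrite -expr2 exprMn mulrC mulrA ler_wpM2r ?sqr_ge0// /K -exprVn -exprMn.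
have k0 : 0 < 1 + (lam 1%N)^-1 by rewrite addr_gt0 ?invr_gt0.
have m0 : 0 < 1 + lam j by rewrite addr_gt0.
have h : (lam j)^-1 <= (1 + (lam 1%N)^-1) / (1 + lam j).
  rewrite ler_pdivlMr// mulrDr mulr1 mulVf ?gt_eqF// addrC lerD2l.
  by rewrite lef_pV2 ?posrE.
by rewrite lerXn2r// nnegrE ltW// ?divr_gt0 ?invr_gt0.
Qed.

Lemma green_zero (u : nat -> R) : green lam u 0%N = 0.
Proof. by []. Qed.

Lemma pairing_green (u c : nat -> R) : pairing u (green lam c) = pairing (green lam u) c.
Proof.
rewrite /pairing; congr (limn (series _)); apply/funext => j.
by rewrite /green; case: eqP => _; rewrite ?mulr0 ?mul0r// mulrAC mulrA.
Qed.

Lemma biharmonic_form_green (u : nat -> R) : l2 (green lam u) ->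
  biharmonic_form lam u u = 8 * pi ^+ 2 * pairing (green lam u) (green lam u).
Proof.
move=> lu; rewrite /biharmonic_form; congr (_ * _); apply/cvg_lim => //.
have H : (series (fun j => green lam u j * green lam u j) \o S) @ \oo -->
    pairing (green lam u) (green lam u).
  by have := lu; rewrite /l2 -(cvg_shiftS _).
apply: cvg_trans H; apply: near_eq_cvg; exists 0%N => // n _.
rewrite /= !seriesEord /= big_ord_recl green_zero mul0r add0r; apply: eq_bigr => j _.
by rewrite /green /= /bump /= add1n; rewrite expr2 invfM; ring.
Qed.

Hypothesis weyl : forall l, 3 / 128 * 4 ^+ l <= lam (2 * 16 ^ l).-1.

(** The variance of the field in the direction phi_j, weighted by the
    H^{-eps} norm and up to the factor 8 pi^2. *)
Definition weyl_term (eps : R) (j : nat) : R :=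
  if j == 0%N then 0 else (1 + lam j) `^ (- eps) * (lam j) ^- 2.

Lemma weyl_term_ge0 eps j : 0 <= weyl_term eps j.
Proof.
rewrite /weyl_term; case: eqP => // _.
by rewrite mulr_ge0 ?powR_ge0// invr_ge0 sqr_ge0.
Qed.

(** Cut the indices at 2 * 16^l.  In the block between two cuts there are at
    most 32 * 16^l terms, where lam is at least (3/128) 4^l, so that
    the block sums to at most a multiple of 16^l 4^{-2l} 4^{- eps l}, the
    general term of a convergent geometric series. *)
Lemma weyl_summable (eps : R) : 0 < eps -> cvgn (series (weyl_term eps)).
Proof.
(* c is the constant of the lower bound on lam, q the ratio of the geometric series. *)
move=> e0; pose c : R := 3 / 128; pose q : R := 4 `^ (- eps).
have c0 : 0 < c by rewrite divr_gt0.
have q0 : 0 < q by rewrite powR_gt0.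
have q1 : q < 1.
  rewrite /q powRN invf_lt1 ?powR_gt0//.
  rewrite [ltLHS](_ : 1 = 1 `^ eps :> R); last by rewrite powR1.
  by apply: gt0_ltr_powR; rewrite ?nnegrE ?ltr1n.
pose b l := (2 * 16 ^ l).-1.
have bS l : (b l <= b l.+1)%N by rewrite /b -!subn1 leq_sub2r// leq_mul2l leq_exp2l// leqnSn.
pose T l := \sum_(0 <= j < b l) weyl_term eps j.
pose D : R := 32 * c ^- 2 * c `^ (- eps).
have D0 : 0 <= D by rewrite mulr_ge0 ?powR_ge0// mulr_ge0// invr_ge0 sqr_ge0.
have blk l : T l.+1 <= T l + D * q ^+ l.
  rewrite /T (big_cat_nat (leq0n _) (bS l))//= lerD2l.
  pose m : R := (c * 4 ^+ l) `^ (- eps) * (c * 4 ^+ l) ^- 2.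
  have cl0 : 0 < c * 4 ^+ l by rewrite mulr_gt0// exprn_gt0.
  have m0 : 0 <= m by rewrite mulr_ge0 ?powR_ge0// invr_ge0 sqr_ge0.
  apply: (@le_trans _ _ (\sum_(b l <= j < b l.+1) m)).
    rewrite !big_nat; apply: ler_sum => j /andP[bj _].
    rewrite /weyl_term; case: eqP => // _.
    have lj : c * 4 ^+ l <= lam j by exact: le_trans (weyl l) (lam_mono bj).
    have lj0 : 0 < lam j by exact: lt_le_trans lj.
    rewrite ler_pM ?powR_ge0 ?invr_ge0 ?sqr_ge0//.
      rewrite !powRN lef_pV2 ?posrE ?powR_gt0 ?addr_gt0//.
      rewrite ge0_ler_powR ?(ltW e0)// ?nnegrE ?addr_ge0 ?(ltW cl0) ?(ltW lj0)//.
      by apply: (le_trans lj); rewrite lerDr.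
    by rewrite lef_pV2 ?posrE ?exprn_gt0// lerXn2r// nnegrE ltW.
  rewrite sumr_const_nat -mulr_natl.
  apply: (@le_trans _ _ ((2 * 16 ^ l.+1)%N%:R * m)).
    by rewrite ler_wpM2r// ler_nat (leq_trans (leq_subr _ _))// leq_pred.
  rewrite le_eqVlt; apply/orP; left; apply/eqP.
  rewrite /m /D /q natrM natrX exprS powRM ?exprn_ge0 ?(ltW c0)//.
  rewrite -[4 ^+ l]powR_mulrn// -powRrM mulrC [l%:R * _]mulrC powRrM powR_mulrn ?powR_ge0//.
  rewrite powR_mulrn// (_ : 16 = 4 ^+ 2 :> R); last by rewrite -natrX.
  have p0 : (4 ^+ l : R) != 0 by rewrite expf_neq0.
  by rewrite -exprM mulnC exprM; field; rewrite p0 gt_eqF.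
have bT l : T l <= D / (1 - q).
  have : T l <= D * series (geometric 1 q) l.
    elim: l => [|l IH].
      rewrite /T /b expn0 muln1 /= big_nat1 /weyl_term eqxx mulr_ge0//.
      by apply: sumr_ge0 => i _; rewrite mulr_ge0// exprn_ge0// ltW.
    apply: (le_trans (blk l)).
    have -> : series (geometric 1 q) l.+1 = series (geometric 1 q) l + q ^+ l.
      by rewrite seriesEord /= big_ord_recr /= mul1r.
    by rewrite mulrDr lerD2r.
  move/le_trans; apply; rewrite ler_wpM2l//.
  rewrite geometric_seriesE ?lt_eqF//= mul1r ler_pdivrMr ?subr_gt0// mulVf ?gt_eqF ?subr_gt0//.
  by rewrite gerDl oppr_le0 exprn_ge0// ltW.
suff [] : cvgn (series (weyl_term eps)) /\ limn (series (weyl_term eps)) <= D / (1 - q) by [].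
apply: nneg_series_cvg => [j|N]; first exact: weyl_term_ge0.
apply: le_trans (bT N); rewrite /T -(big_mkord xpredT (weyl_term eps)).
have Nb : (N <= b N)%N.
  rewrite -ltnS prednK ?muln_gt0 ?expn_gt0//.
  by apply: (leq_trans (ltn_expl N (isT : 1 < 16)%N)); rewrite leq_pmull.
rewrite [leRHS](big_cat_nat (leq0n _) Nb)//= lerDl.
by apply: sumr_ge0 => j _; exact: weyl_term_ge0.
Qed.

End SpectralSums.

(** * Limits of series and Sobolev spaces *)

Section SeriesLimits.
Context (R : realType).
Implicit Types (f w u v : nat -> R).

Lemma nneseries_le_bound f (C : R) : (forall j, 0 <= f j) ->
  (forall N, \sum_(j < N) f j <= C) -> (\sum_(0 <= j <oo) (f j)%:E <= C%:E)%E.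
Proof.
move=> f0 fC; apply: lime_le.
  by apply: is_cvg_nneseries => j _ _; rewrite lee_fin.
by apply: nearW => n; rewrite big_mkord sumEFin lee_fin.
Qed.

Lemma ereal_cvg0 (F : nat -> \bar R) : (forall l, (0 <= F l)%E) ->
  (forall e, 0 < e -> \forall l \near \oo, (F l <= e%:E)%E) -> F @ \oo --> 0%E.
Proof.
move=> F0 H.
have fin : \forall l \near \oo, F l \is a fin_num.
  apply: filterS (H 1 ltr01) => l h; rewrite ge0_fin_numE//.
  exact: (le_lt_trans h (ltry _)).
apply/fine_cvgP; split=> //; apply/cvgrPdist_le => e e0.
apply: filterS2 (H e e0) fin => l h fl.
by rewrite sub0r normrN ger0_norm ?fine_ge0// -lee_fin fineK.
Qed.

Lemma ereal_squeeze0 (F : nat -> \bar R) (r : nat -> R) : (forall l, (0 <= F l)%E) ->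
  (forall l, (F l <= (r l)%:E)%E) -> r @ \oo --> 0 -> F @ \oo --> 0%E.
Proof.
move=> F0 Fr r0; apply: ereal_cvg0 => // e e0.
have /cvgrPdist_le/(_ _ e0) := r0; apply: filterS => l; rewrite sub0r normrN => h.
by apply: (le_trans (Fr l)); rewrite lee_fin; exact: le_trans (ler_norm _) h.
Qed.

(** Dominated convergence for series, uniformly in the number of terms: the tail
    is controlled by w and finitely many terms tend to 0. *)
Lemma series_dominated (F : nat -> nat -> R) w : (forall l j, 0 <= F l j <= w j) ->
  cvgn (series w) -> (forall j, F ^~ j @ \oo --> 0) ->
  forall e, 0 < e -> \forall l \near \oo, forall N, \sum_(j < N) F l j <= e.
Proof.
move=> Fw cw F0 e e0; have e2 : 0 < e / 2 by rewrite divr_gt0.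
have w0 j : 0 <= w j by have /andP[] := Fw 0%N j; exact: le_trans.
have /cvgrPdist_le/(_ _ e2)[N0 _ /(_ N0 (leqnn N0)) /= HN0] := cw.
have cf : (fun l => \sum_(j < N0) F l j) @ \oo --> \sum_(j < N0) (0 : R).
  apply: cvg_big => [|j _]; first exact: add_continuous.
  exact: F0.
rewrite big1 // in cf.
have /cvgrPdist_le/(_ _ e2) := cf; apply: filterS => l; rewrite sub0r normrN => hl N.
have F0l j : 0 <= F l j by have /andP[] := Fw l j.
apply: (@le_trans _ _ (\sum_(j < maxn N N0) F l j)).
  rewrite -!(big_mkord xpredT (F l)) [leRHS](big_cat_nat (leq0n _) (leq_maxl N N0))//=.
  by rewrite lerDl sumr_ge0.
rewrite -!(big_mkord xpredT (F l)) (big_cat_nat (leq0n _) (leq_maxr N N0))//=.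
rewrite (splitr e); apply: lerD.
  by rewrite big_mkord; exact: le_trans (ler_norm _) hl.
apply: (@le_trans _ _ (\sum_(N0 <= j < maxn N N0) w j)).
  by apply: ler_sum => j _; have /andP[] := Fw l j.
have := nneg_partial_le (maxn N N0) w0 cw.
rewrite -(big_mkord xpredT w) (big_cat_nat (leq0n _) (leq_maxr N N0))//= => h.
have := le_trans (ler_norm _) HN0; rewrite seriesEnat /=; lra.
Qed.

End SeriesLimits.

Section SobolevSpaces.
Context (R : realType).
Variable lam : nat -> R.
Implicit Types (u v : nat -> R).

Lemma sobolev_unit_coef s j : sobolev lam s (unit_coef j).
Proof.
rewrite /sobolev /sobolev_sqnorm /=.
apply: (@le_lt_trans _ _ ((1 + lam j) `^ s)%:E); last exact: ltry.
apply: nneseries_le_bound => [i|N]; first by rewrite mulr_ge0 ?powR_ge0 ?sqr_ge0.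
have [jN|Nj] := ltnP j N.
  rewrite (bigD1 (Ordinal jN))//= big1 ?addr0; first by rewrite /unit_coef eqxx expr1n mulr1.
  move=> i; rewrite -val_eqE /= => ij.
  by rewrite /unit_coef (negbTE ij) expr0n mulr0.
rewrite big1 ?powR_ge0// => i _; rewrite /unit_coef (ltn_eqF (leq_trans (ltn_ord i) Nj)).
by rewrite expr0n mulr0.
Qed.

Lemma sobolev_lin s (a b : R) u v : sobolev lam s u -> sobolev lam s v ->
  sobolev lam s (fun j => a * u j + b * v j).
Proof.
move=> /sobolev_partial[Cu Hu] /sobolev_partial[Cv Hv].
apply: (@le_lt_trans _ _ (2 * a ^+ 2 * Cu + 2 * b ^+ 2 * Cv)%:E); last exact: ltry.
apply: nneseries_le_bound => [i|N]; first by rewrite mulr_ge0 ?powR_ge0 ?sqr_ge0.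
apply: le_trans (_ : _ <= 2 * a ^+ 2 * (\sum_(j < N) (1 + lam j) `^ s * u j ^+ 2) +
   2 * b ^+ 2 * (\sum_(j < N) (1 + lam j) `^ s * v j ^+ 2)) _; last first.
  by apply: lerD; apply: ler_wpM2l => //; apply: mulr_ge0 => //; exact: sqr_ge0.
rewrite !mulr_sumr -big_split /=; apply: ler_sum => j _.
rewrite -subr_ge0.
rewrite (_ : _ - _ = (1 + lam j) `^ s * (a * u j - b * v j) ^+ 2); last by ring.
by rewrite mulr_ge0 ?powR_ge0 ?sqr_ge0.
Qed.

Lemma green_lin (a b : R) u v :
  green lam (fun j => a * u j + b * v j) = fun j => a * green lam u j + b * green lam v j.
Proof.
apply/funext => j; rewrite /green; case: eqP => _; first by rewrite !mulr0 addr0.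
by rewrite mulrDl !mulrA.
Qed.

Lemma green_unit_coef j : green lam (unit_coef j) =
  fun i => (if j == 0%N then 0 else (lam j)^-1) * unit_coef j i.
Proof.
apply/funext => i; rewrite /green /unit_coef.
have [->|ij] := eqVneq i j; last by rewrite mulr0 mul0r if_same.
by case: ifP; rewrite ?mul0r// mul1r mulr1.
Qed.

Lemma sobolev_mono s s' u : (forall j, 0 <= lam j) -> s <= s' ->
  sobolev lam s' u -> sobolev lam s u.
Proof.
move=> lam0 ss /sobolev_partial[C HC].
apply: (@le_lt_trans _ _ C%:E); last exact: ltry.
apply: nneseries_le_bound => [i|N]; first by rewrite mulr_ge0 ?powR_ge0 ?sqr_ge0.
apply: le_trans (HC N); apply: ler_sum => j _.
by rewrite ler_wpM2r ?sqr_ge0// ler_powR// lerDl.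
Qed.

Lemma pairing_sumr (I : Type) (r : seq I) (b : I -> R) (M : I -> nat -> R) (g : nat -> R) :
  l2 g -> (forall i, l2 (M i)) ->
  pairing g (fun j => \sum_(i <- r) b i * M i j) = \sum_(i <- r) b i * pairing g (M i).
Proof.
move=> lg lM; apply/cvg_lim => //.
have -> : series (fun j => g j * \sum_(i <- r) b i * M i j) =
    fun n => \sum_(i <- r) b i * series (fun j => g j * M i j) n.
  apply/funext => n; rewrite seriesEnat /=.
  transitivity (\sum_(0 <= j < n) \sum_(i <- r) b i * (g j * M i j)).
    by apply: eq_bigr => j _; rewrite mulr_sumr; apply: eq_bigr => i _; rewrite mulrCA.
  by rewrite exchange_big /=; apply: eq_bigr => i _; rewrite mulr_sumr.
apply: cvg_big => [|i _]; first exact: add_continuous.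
exact: (cvgM (cvg_cst (b i)) (l2_pairing_cvg lg (lM i))).
Qed.

End SobolevSpaces.

(** * Normal laws *)

Section NormalLaw.
Context (R : realType).
Local Notation mR := (measurableTypeR R).
Local Notation leb := (@lebesgue_measure R).

(** The open upper rays are the complements of the closed lower ones, and form
    a pi-system generating the Borel sets. *)
Lemma probability_eq_rays (mu nu : probability mR R) :
  (forall t : R, mu `]-oo, t]%classic = nu `]-oo, t]%classic) ->
  forall A, measurable A -> mu A = nu A.
Proof.
move=> H A mA.
have E (m : probability mR R) (t : R) : m `]t, +oo[%classic = (1 - m `]-oo, t]%classic)%E.
  by rewrite -probability_setC// setCitvl.
apply: (@measure_unique _ _ mR (@RGenOInfty.G R) (fun n => `](- n%:R : R), +oo[%classic)) => //.
- exact: RGenOInfty.measurableE.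
- move=> _ _ [x ->] [y ->]; exists (Num.max x y).
  apply/seteqP; split=> z /=; rewrite !in_itv /= !andbT gt_max.
    by move=> [-> ->].
  by move=> /andP[].
- by move=> n; exists (- n%:R).
- apply/seteqP; split=> // z _;   exists (Num.truncn `|z|).+1 => //=; rewrite in_itv /= andbT.
  rewrite ltrNl; apply: (le_lt_trans (ler_norm _)); rewrite normrN.
  exact: truncnS_gt.
- move=> _ [x ->]; transitivity (1 - nu `]-oo, x]%classic)%E; last exact/esym/E.
  by rewrite -H; exact: E.
- by move=> n; rewrite (le_lt_trans (probability_le1 _ _))// ltry.
Qed.

Lemma ge0_integral_normal (s : R) (f : mR -> \bar R) :
  measurable_fun setT f -> (forall x, 0 <= f x)%E ->
  (\int[normal_prob 0 s]_x f x = \int[leb]_x (f x * (normal_pdf 0 s x)%:E))%E.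
Proof.
move=> mf f0.
have dom := normal_prob_dominates (0 : R) s.
rewrite -(Radon_Nikodym_SigmaFinite.change_of_variables dom)//.
have mp : measurable_fun setT (EFin \o normal_pdf 0 s : mR -> \bar R).
  by apply/measurable_EFinP; exact: measurable_normal_pdf.
have iRN := Radon_Nikodym_SigmaFinite.f_integrable dom.
apply: ae_eq_integral => //.
- by apply: emeasurable_funM => //; exact: measurable_int iRN.
- exact: emeasurable_funM.
- apply: ae_eqe_mul2l; apply: integral_ae_eq => //.
  by move=> E _ mE; rewrite -Radon_Nikodym_SigmaFinite.f_integral.
Qed.

Lemma ge0_integral_affine_ray (c e t : R) (G : R -> R) : 0 < c -> continuous G ->
  (forall x, 0 <= G x) ->
  (\int[leb]_(x in `]-oo, (c * t + e)%R]) (G x)%:E =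
   \int[leb]_(x in `]-oo, t]) (G (c * x + e) * c)%:E)%E.
Proof.
move=> c0 cG G0; pose F (x : R) := c * x + e.
have dF (x : R) : is_derive x 1 F c.
  rewrite -[c]addr0; apply: is_deriveD.
  by rewrite -[c in is_derive _ _ _ c]mulr1; exact: is_deriveZ.
have F' : F^`()%classic = cst c.
  by apply/funext => x; rewrite derive1E; have [_ ->] := dF x.
have cF : continuous F.
  by move=> x; apply: differentiable_continuous; apply/derivable1_diffP; have [] := dF x.
rewrite -[(c * t + e)%R]/(F t) increasing_ge0_integration_by_substitutionNy ?F'//.
- by move=> x y _ _ xy; rewrite /F ltrD2r ltr_pM2l.
- by move=> x _; exact: cvg_cst.
- exact: is_cvg_cst.
- exact: cvg_cst.
- split; first by move=> x _; have [] := dF x.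
  by apply: cvg_at_left_filter; exact: cF.
- apply/cvgrNyPle => M; exists ((M - e) / c); split; first exact: num_real.
  by move=> x /= xM; rewrite /F -lerBrDr mulrC -ler_pdivlMr// ltW.
- exact/continuous_subspaceT.
Qed.

Lemma normal_pdf_expr (m s x : R) : s != 0 ->
  normal_pdf m s x = normal_peak s * expR (- (x - m) ^+ 2 / (s ^+ 2 *+ 2)).
Proof. by move=> s0; rewrite normal_pdfE. Qed.

(** Completing the square in x: as a function of x the product of the two
    densities is a multiple of a normal density. *)
Lemma normal_pdf_mul (a b x z : R) : 0 < a -> 0 < b ->
  normal_pdf 0 b (z - x) * normal_pdf 0 a x =
  normal_pdf 0 (Num.sqrt (a ^+ 2 + b ^+ 2)) z *
  normal_pdf (z * a ^+ 2 / (a ^+ 2 + b ^+ 2)) (a * b / Num.sqrt (a ^+ 2 + b ^+ 2)) x.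
Proof.
move=> a0 b0; set c := Num.sqrt _.
have d0 : 0 < a ^+ 2 + b ^+ 2 by rewrite addr_gt0// exprn_gt0.
have c0 : 0 < c by rewrite sqrtr_gt0.
have c2 : c ^+ 2 = a ^+ 2 + b ^+ 2 by rewrite sqr_sqrtr// ltW.
have m0 : 0 < a * b / c by rewrite divr_gt0// mulr_gt0.
rewrite !normal_pdf_expr ?gt_eqF// mulrACA [RHS]mulrACA; congr (_ * _).
  have p0 (u : R) : 0 <= u ^+ 2 * pi *+ 2 by rewrite mulrn_wge0// mulr_ge0 ?sqr_ge0 ?pi_ge0.
  rewrite /normal_peak -!invfM -!sqrtrM//.
  congr (_^-1); congr (Num.sqrt _); rewrite expr_div_n exprMn.
  by field; rewrite gt_eqF.
rewrite -!expRD; congr expR; rewrite !subr0.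
rewrite expr_div_n exprMn c2.
by field; rewrite !gt_eqF// ?exprn_gt0.
Qed.

(** After the shift of variable z = x + y, Tonelli's theorem integrates x first;
    by [normal_pdf_mul] a density integrating to 1 factors out. *)
Lemma normal_convolution (a b t : R) : 0 < a -> 0 < b ->
  ((normal_prob 0 a \x normal_prob 0 b) [set z : mR * mR | (z.1 + z.2 <= t)%R] =
  normal_prob (0 : R) (Num.sqrt (a ^+ 2 + b ^+ 2)) `]-oo, t]%classic)%E.
Proof.
move=> a0 b0; rewrite /product_measure1.
have mS : measurable [set z : mR * mR | (z.1 + z.2 <= t)%R].
  rewrite -[X in measurable X]setTI.
  have mf : measurable_fun setT (fun z : mR * mR => z.1 + z.2).
    by apply: measurable_funD; [exact: measurable_fst|exact: measurable_snd].
  have := mf measurableT _ (measurable_itv `]-oo, t]).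
  by congr (measurable (_ `&` _)); apply/seteqP; split=> z /=; rewrite in_itv.
have mg := measurable_fun_xsection (normal_prob 0 b) mS.
rewrite (ge0_integral_normal a mg); last by move=> x; exact: measure_ge0.
(* p is the pair (x, z), with z the value of the sum. *)
pose H (p : mR * mR) : \bar R :=
  (\1_`]-oo, t]%classic p.2 * (normal_pdf 0 b (p.2 - p.1) * normal_pdf 0 a p.1))%:E.
have mH : measurable_fun setT H.
  apply/measurable_EFinP; apply: measurable_funM.
    apply: (measurableT_comp _ measurable_snd).
    by apply: measurable_indic; exact: measurable_itv.
  apply: measurable_funM.
    apply: (measurableT_comp (measurable_normal_pdf 0 b)).
    by apply: measurable_funB; [exact: measurable_snd|exact: measurable_fst].
  exact: (measurableT_comp (measurable_normal_pdf 0 a) measurable_fst).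
have H0 p : (0 <= H p)%E by rewrite lee_fin !mulr_ge0 ?normal_pdf_ge0.
transitivity (\int[leb]_x \int[leb]_z H (x, z))%E.
  apply: eq_integral => x _ /=.
  have -> : xsection [set z : mR * mR | (z.1 + z.2 <= t)%R] x = `]-oo, t - x]%classic.
    apply/predeqP => y; rewrite /xsection /= in_itv /= lerBrDl.
    by split=> [/set_mem//|h]; exact: mem_set.
  rewrite /normal_prob.
  have -> : (t - x = 1 * t + (- x))%R by rewrite mul1r.
  rewrite ge0_integral_affine_ray//; last first.
  - by move=> y; exact: normal_pdf_ge0.
  - by apply: continuous_normal_pdf; rewrite gt_eqF.
  rewrite integral_mkcond -ge0_integralZr//.
  - apply: eq_integral => z _; rewrite /H /= patchE mul1r mulr1 indicE.
    by case: ifPn => _; rewrite ?mul1r ?mul0r ?mul0e ?EFinM.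
  - apply/(measurable_restrictT _ (measurable_itv _))/measurable_EFinP/measurable_funTS.
    apply: measurable_funM => //; apply: (measurableT_comp (measurable_normal_pdf 0 b)).
    by apply: measurable_funD => //; exact: measurable_funM.
  - by move=> z _; rewrite patchE; case: ifP => // _; rewrite lee_fin mulr1 normal_pdf_ge0.
  - by rewrite lee_fin normal_pdf_ge0.
rewrite (fubini_tonelli (m1 := leb) (m2 := leb) H)//=.
rewrite /fubini_G /normal_prob [RHS]integral_mkcond; apply: eq_integral => z _ /=.
rewrite patchE; case: ifPn => zt; last first.
  by rewrite integral0_eq// => x _; rewrite /H /= indicE (negbTE zt) mul0r.
pose c := Num.sqrt (a ^+ 2 + b ^+ 2).
transitivity (\int[leb]_x ((normal_pdf 0 c z)%:E *
   (normal_pdf (z * a ^+ 2 / (a ^+ 2 + b ^+ 2)) (a * b / c) x)%:E))%E.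
  by apply: eq_integral => x _; rewrite /H /= indicE zt mul1r normal_pdf_mul// EFinM.
rewrite ge0_integralZl//.
- by rewrite integral_normal_pdf mule1.
- by apply/measurable_EFinP; exact: measurable_normal_pdf.
- by move=> x _; rewrite lee_fin normal_pdf_ge0.
- by rewrite lee_fin normal_pdf_ge0.
Qed.

Lemma normal_pdf_even (s x : R) : s != 0 -> normal_pdf 0 s (- x) = normal_pdf 0 s x.
Proof. by move=> s0; rewrite !normal_pdf_expr// !subr0 sqrrN. Qed.

Lemma normal_prob_opp (s t : R) : s != 0 ->
  normal_prob 0 s `[- t, +oo[%classic = normal_prob 0 s `]-oo, t]%classic.
Proof.
move=> s0; rewrite /normal_prob -[in RHS](opprK t).
rewrite (@ge0_integration_by_substitutionNy _ (normal_pdf 0 s) (- t)%R) ?opprK//.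
- by apply: eq_integral => x _ /=; rewrite normal_pdf_even.
- by apply: continuous_subspaceT; exact: continuous_normal_pdf.
- by move=> x _; exact: normal_pdf_ge0.
Qed.

Lemma normal_prob_scale (s r t : R) : 0 < s -> 0 < r ->
  normal_prob 0 (r * s) `]-oo, r * t]%classic = normal_prob 0 s `]-oo, t]%classic.
Proof.
move=> s0 r0; rewrite /normal_prob -[(r * t)%R in LHS]addr0 ge0_integral_affine_ray//.
- apply: eq_integral => x _; rewrite addr0 !normal_pdf_expr ?mulf_neq0 ?gt_eqF//.
  congr EFin; rewrite mulrAC; congr (_ * _).
    rewrite /normal_peak exprMn -mulrnAr -mulrA sqrtrM ?sqr_ge0// sqrtr_sqr gtr0_norm//.
    by rewrite invfM -mulrnAr mulrAC mulVf ?mul1r ?gt_eqF.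
  rewrite !subr0; congr expR; rewrite !exprMn.
  by field; rewrite !gt_eqF.
- by apply: continuous_normal_pdf; rewrite mulf_neq0 ?gt_eqF.
- by move=> x; exact: normal_pdf_ge0.
Qed.

End NormalLaw.

Section NormalMoment.
Context (R : realType).
Local Notation mR := (measurableTypeR R).
Local Notation leb := (@lebesgue_measure R).

Lemma normal_pdf_cvg0 (s : R) : 0 < s -> normal_pdf 0 s x @[x --> +oo] --> 0.
Proof.
move=> s0.
have h : (fun x : R => x ^+ 2 / (s ^+ 2 *+ 2)) x @[x --> +oo] --> +oo.
  apply/cvgryPge => M; pose K := s ^+ 2 *+ 2.
  have K0 : 0 < K by rewrite pmulrn_rgt0// exprn_gt0.
  exists (Num.max 1 (M * K)); split; first exact: num_real.
  move=> x /=; rewrite gt_max => /andP[x1 xM]; rewrite ler_pdivlMr//.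
  by apply: (le_trans (ltW xM)); rewrite expr2 ler_peMl// ltW// (lt_trans ltr01).
have h2 : (fun x : R => expR (- (x ^+ 2 / (s ^+ 2 *+ 2)))) x @[x --> +oo] --> (0 : R).
  exact: (cvg_comp _ _ h (@cvgr_expR R)).
have h3 : (fun x : R => normal_peak s * expR (- (x ^+ 2 / (s ^+ 2 *+ 2)))) x @[x --> +oo]
    --> normal_peak s * 0 by apply: cvgM h2; exact: cvg_cst.
rewrite mulr0 in h3; apply: cvg_trans h3; apply: near_eq_cvg; near=> x.
by rewrite normal_pdf_expr ?gt_eqF// subr0 mulNr.
Unshelve. all: by end_near.
Qed.

Lemma is_derive_normal_pdf (s x : R) : 0 < s ->
  is_derive x 1 (fun y => - s ^+ 2 * normal_pdf 0 s y) (x * normal_pdf 0 s x).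
Proof.
move=> s0; have sn : s != 0 by rewrite gt_eqF.
rewrite (_ : (fun y => _) = (fun y => (- s ^+ 2 * normal_peak s) *
    expR (- (s ^+ 2 *+ 2)^-1 * (y * y)))); last first.
  apply/funext => y; rewrite normal_pdf_expr// subr0 -[RHS]mulrA; congr (_ * (_ * expR _)).
  by rewrite !mulNr mulrC expr2.
have d1 : is_derive x (1 : R) (fun y : R => y * y) (x *: 1 + x *: 1).
  exact: is_deriveM.
have d2 : is_derive x (1 : R) (fun y : R => - (s ^+ 2 *+ 2)^-1 * (y * y))
    (- (s ^+ 2 *+ 2)^-1 *: (x *: (1 : R) + x *: 1)) by exact: is_deriveZ.
have d3 := is_derive1_comp (is_derive_expR _) d2.
have d4 := is_deriveZ (- s ^+ 2 * normal_peak s) d3.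
apply: (is_derive_eq d4).
rewrite normal_pdf_expr// subr0 /GRing.scale /=.
rewrite (_ : - x ^+ 2 / (s ^+ 2 *+ 2) = - (s ^+ 2 *+ 2)^-1 * (x * x)); last by field.
by field.
Qed.

Lemma measurable_normal_pdfM (s : R) (f : mR -> R) : measurable_fun setT f ->
  measurable_fun setT (fun z : mR => f z * normal_pdf 0 s z).
Proof. by move=> mf; apply: measurable_funM => //; exact: measurable_normal_pdf. Qed.

Lemma normal_tail_moment (s y : R) : 0 < s -> 0 <= y ->
  (\int[leb]_(z in `[y, +oo[) (z * normal_pdf 0 s z)%:E = (s ^+ 2 * normal_pdf 0 s y)%:E)%E.
Proof.
move=> s0 y0; have d x := is_derive_normal_pdf x s0.
have cp : continuous (normal_pdf 0 s) by apply: continuous_normal_pdf; rewrite gt_eqF.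
rewrite (@ge0_continuous_FTC2y _ _ (fun x => - s ^+ 2 * normal_pdf 0 s x) _ 0).
- by rewrite sub0e -EFinN mulNr opprK.
- by move=> x yx; rewrite mulr_ge0 ?normal_pdf_ge0// (le_trans y0).
- apply: continuous_subspaceT => x; apply: cvgM; [exact: cvg_id|exact: cp].
- have h : (fun x => - s ^+ 2 * normal_pdf 0 s x) x @[x --> +oo] --> - s ^+ 2 * 0.
    by apply: cvgM; [exact: cvg_cst|exact: normal_pdf_cvg0].
  by rewrite mulr0 in h.
- by move=> x _; have [] := d x.
- apply: cvg_at_right_filter; apply: cvgM; [exact: cvg_cst|exact: cp].
- by move=> x _; rewrite derive1E; have [_ ->] := d x.
Qed.

Lemma normal_half (s : R) : 0 < s ->
  (2%:E * \int[leb]_(x in [set x | (0 <= x)%R]) (normal_pdf 0 s x)%:E = 1)%E.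
Proof.
move=> s0; rewrite -ge0_symfun_integralT ?integral_normal_pdf//.
- by move=> x; exact: normal_pdf_ge0.
- by apply: continuous_normal_pdf; rewrite gt_eqF.
- by move=> x /=; rewrite normal_pdf_even ?gt_eqF.
Qed.

(** On the half-line write z^2 as z times the length of [0, z] and exchange the
    integrals: the inner one is [normal_tail_moment], which leaves s^2 times
    the integral of the density. *)
Lemma normal_second_moment (s : R) : 0 < s ->
  (\int[normal_prob 0 s]_x (x ^+ 2)%:E = (s ^+ 2)%:E)%E.
Proof.
move=> s0; have cp : continuous (normal_pdf 0 s) by apply: continuous_normal_pdf; rewrite gt_eqF.
have mp := measurable_normal_pdf 0 s.
rewrite (ge0_integral_normal s); first last.
- by move=> x; rewrite lee_fin sqr_ge0.
- by apply/measurable_EFinP; exact: measurable_funX.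
under eq_integral do rewrite -EFinM.
rewrite (@ge0_symfun_integralT _ (fun x => x ^+ 2 * normal_pdf 0 s x)); first last.
- by move=> x /=; rewrite sqrrN normal_pdf_even ?gt_eqF.
- by move=> x; exact: (cvgM (@exprn_continuous R 2 x) (cp x)).
- by move=> x; rewrite mulr_ge0 ?sqr_ge0 ?normal_pdf_ge0.
have Eset : [set x : R | 0 <= x] = `[0, +oo[%classic.
  by apply/seteqP; split=> x /=; rewrite in_itv /= andbT.
rewrite -[RHS]mule1 -(normal_half s0) muleCA; congr (_ * _)%E; rewrite Eset.
(* p is the pair (z, y) with y running over [0, z]. *)
pose H (p : mR * mR) : \bar R :=
  ((0 <= p.2 <= p.1)%R%:R * (p.1 * normal_pdf 0 s p.1))%:E.
have mH : measurable_fun setT H.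
  apply/measurable_EFinP; apply: measurable_funM.
    rewrite (_ : (fun _ => _) = \1_[set p : mR * mR | (0 <= p.2 <= p.1)%R]); last first.
      by apply/funext => p; rewrite indicE mem_setE.
    apply: measurable_indic.
    have mge (g : mR * mR -> R) : measurable_fun setT g ->
        measurable [set p : mR * mR | (0 <= g p)%R].
      move=> mg; have := mg measurableT _ (measurable_itv `[0, +oo[).
      by rewrite setTI; congr measurable; apply/seteqP; split=> p /=; rewrite in_itv /= andbT.
    rewrite (_ : [set _ | _] = [set p : mR * mR | (0 <= p.2)%R] `&`
       [set p : mR * mR | (0 <= p.1 - p.2)%R]); last first.
      apply/seteqP; split=> p /=; rewrite subr_ge0; first by move=> /andP[-> ->].
      by move=> [-> ->].
    apply: measurableI; apply: mge; first exact: measurable_snd.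
    by apply: measurable_funB; [exact: measurable_fst|exact: measurable_snd].
  exact: (measurableT_comp (measurable_normal_pdfM s (@measurable_id _ mR setT)) measurable_fst).
have H0 p : (0 <= H p)%E.
  rewrite /H lee_fin; case: (boolP (0 <= p.2 <= p.1)%R) => [/andP[p0 pp]|_]; last by rewrite mul0r.
  by rewrite mul1r mulr_ge0 ?normal_pdf_ge0 ?(le_trans p0).
transitivity (\int[leb]_z \int[leb]_y H (z, y))%E.
  rewrite integral_mkcond; apply: eq_integral => z _; rewrite patchE mem_setE in_itv /= andbT.
  have [z0|z0] := lerP 0 z; last first.
    rewrite integral0_eq// => y _; rewrite /H /=.
    by case: andP => [[y0 yz]|_]; [have := le_trans y0 yz; rewrite leNgt z0|rewrite mul0r].
  transitivity (\int[leb]_(y in `[0%R, z]) (z * normal_pdf 0 s z)%:E)%E.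
    rewrite integral_cst//= lebesgue_measure_itv /= lte_fin.
    have [z1|z1] := ltP 0 z; first by rewrite sube0 -EFinM expr2; congr EFin; ring.
    have -> : z = 0 by apply/eqP; rewrite eq_le z0 z1.
    by rewrite expr0n !mul0r mule0.
  rewrite integral_mkcond; apply: eq_integral => y _.
  rewrite patchE mem_setE in_itv /= /H /=.
  by case: (_ && _); rewrite ?mul1r ?mul0r.
rewrite (fubini_tonelli (m1 := leb) (m2 := leb) H)//= /fubini_G.
rewrite -ge0_integralZl//; first last.
- by rewrite lee_fin sqr_ge0.
- by move=> x _; rewrite lee_fin normal_pdf_ge0.
- by apply/measurable_EFinP/measurable_funTS.
rewrite [RHS]integral_mkcond; apply: eq_integral => y _; rewrite patchE mem_setE in_itv /= andbT.
have [y0|y0] := lerP 0 y; last first.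
  by rewrite integral0_eq// => z _; rewrite /H /= leNgt y0 mul0r.
rewrite -EFinM -normal_tail_moment// [RHS]integral_mkcond; apply: eq_integral => z _.
rewrite patchE mem_setE in_itv /= andbT /H /= y0 /=.
by case: (_ <= _); rewrite ?mul1r ?mul0r.
Qed.

End NormalMoment.

(** * Sums of independent standard normal variables *)

Section GaussianSums.
Context (R : realType) (d : measure_display) (T : measurableType d).
Context (P : probability T R).
Local Notation mR := (measurableTypeR R).

Definition mkRV (Y : T -> R) (mY : measurable_fun setT Y) : {RV P >-> R} :=
  HB.pack Y (isMeasurableFun.Build _ _ _ _ Y mY).

Definition law (Y : T -> mR) (mY : measurable_fun setT Y) : probability mR R :=
  distribution P (HB.pack_for {mfun T >-> mR} Y (isMeasurableFun.Build _ _ _ _ Y mY)).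

(** The case split allows for variance 0, where [normal_prob] is not the Dirac
    mass. *)
Definition gaussian_law (Y : T -> R) (s : R) := forall A : set mR, measurable A ->
  P (Y @^-1` A) = if s == 0 then dirac (0 : R) A else normal_prob 0 s A.

Lemma law_eq_rays (Y : T -> R) (nu : probability mR R) : measurable_fun setT Y ->
  (forall t : R, P (Y @^-1` `]-oo, t]%classic) = nu `]-oo, t]%classic) ->
  forall A : set mR, measurable A -> P (Y @^-1` A) = nu A.
Proof.
move=> mY H A mA.
exact: (@probability_eq_rays R (law mY) nu H A mA).
Qed.

Lemma std_scale_law (X : T -> R) (r : R) : measurable_fun setT X ->
  (forall A : set mR, measurable A -> P (X @^-1` A) = normal_prob 0 1 A) -> r != 0 ->
  forall A : set mR, measurable A -> P ((fun w => r * X w) @^-1` A) = normal_prob 0 `|r| A.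
Proof.
move=> mX lX r0; apply: law_eq_rays; first exact: measurable_funM.
move=> t; have [rp|rn] := ltP 0 r.
  rewrite (_ : _ @^-1` _ = X @^-1` `]-oo, t / r]%classic); last first.
    by apply/seteqP; split=> w /=; rewrite !in_itv /= ler_pdivlMr// mulrC.
  rewrite (lX _ (measurable_itv _)).
  rewrite -(@normal_prob_scale R 1 r)// mulr1 gtr0_norm// mulrC divfK//.
have {}rn : r < 0 by rewrite lt_def eq_sym r0.
rewrite (_ : _ @^-1` _ = X @^-1` `[- (- (t / r)), +oo[%classic); last first.
  by apply/seteqP; split=> w /=; rewrite !in_itv /= andbT opprK ler_ndivrMr// mulrC.
rewrite (lX _ (measurable_itv _)).
rewrite normal_prob_opp ?oner_eq0// -(@normal_prob_scale R 1 `|r|)// ?normr_gt0// mulr1.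
by rewrite ltr0_norm// mulrNN mulrC divfK.
Qed.

Lemma gaussian_second_moment (Y : T -> R) s : measurable_fun setT Y -> 0 <= s ->
  gaussian_law Y s -> ('E_P[fun w => (Y w ^+ 2)%R] = (s ^+ 2)%:E)%E.
Proof.
move=> mY s0 lY.
have m2 : measurable_fun setT (fun x : mR => (x ^+ 2)%:E).
  by apply/measurable_EFinP; exact: measurable_funX.
transitivity (\int[law mY]_x ((x ^+ 2)%:E))%E.
  rewrite /law ge0_integral_distribution//.
    by rewrite unlock.
  by move=> y; rewrite lee_fin sqr_ge0.
have [s00|sn] := eqVneq s 0.
  rewrite (@eq_measure_integral _ _ _ _ (dirac (0 : mR))) => [|A mA _].
    by rewrite integral_dirac//= diracT mul1e s00.
  by have := lY A mA; rewrite s00 eqxx.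
rewrite (@eq_measure_integral _ _ _ _ (normal_prob 0 s)) => [|A mA _].
  by rewrite normal_second_moment// lt_def sn.
by have := lY A mA; rewrite (negbTE sn).
Qed.

Variables (I : choiceType) (X : I -> {RV P >-> R}).
Hypothesis iid : iid_std_normal X.

Lemma std_law i (A : set mR) : measurable A -> P (X i @^-1` A) = normal_prob 0 1 A.
Proof. by case: iid => H _ mA; exact: (H i A mA). Qed.

(** Finite intersections of events on the X i with i in K: a pi-system that
    generates the sigma-algebra of these variables. *)
Definition cylinder (K : set I) : set (set T) := [set E | exists (J : seq I) (A : I -> set R),
  (forall i, i \in J -> K i /\ measurable (A i : set mR)) /\
  E = \bigcap_(i in [set` J]) (X i @^-1` A i)].

Lemma cylinder_measurable K : cylinder K `<=` measurable.
Proof.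
move=> _ [J [A [JA ->]]]; apply: fin_bigcap_measurable => // i /= iJ.
by apply: measurable_funPTI; have [] := JA i iJ.
Qed.

Lemma cylinderI K : setI_closed (cylinder K).
Proof.
move=> _ _ [J1 [A1 [H1 ->]]] [J2 [A2 [H2 ->]]].
exists (J1 ++ J2), (fun i => (if i \in J1 then A1 i else setT) `&`
  (if i \in J2 then A2 i else setT)); split.
  move=> i; rewrite mem_cat => iJ; split.
    by case/orP: iJ => [/H1|/H2] [].
  apply: measurableI.
    by case: ifP => [/H1[]//|_]; exact: measurableT.
  by case: ifP => [/H2[]//|_]; exact: measurableT.
apply/seteqP; split=> w.
  move=> [h1 h2] i /=; rewrite mem_cat => iJ; split.
    by case: ifP => [iJ1|//]; exact: h1.
  by case: ifP => [iJ2|//]; exact: h2.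
move=> h; split=> i /= iJ; have := h i; rewrite /= mem_cat iJ ?orbT => /(_ isT) [].
  by [].
by [].
Qed.

Lemma cylinder_setT K : cylinder K setT.
Proof.
exists [::], (fun=> setT); split => //.
by apply/seteqP; split.
Qed.

Lemma cylinder_gen K i (B : set mR) : K i -> measurable B -> cylinder K (X i @^-1` B).
Proof.
move=> Ki mB; exists [:: i], (fun=> B); split.
  by move=> j; rewrite inE => /eqP ->.
apply/seteqP; split=> w /= h; last by apply: h; rewrite /= inE.
by move=> j /=; rewrite inE => /eqP ->.
Qed.

Lemma sigma_cylinder_measurable K : <<s cylinder K >> `<=` measurable.
Proof.
by apply: smallest_sub; [exact: sigma_algebra_measurable|exact: cylinder_measurable].
Qed.

Lemma cylinder_indep K p E (B : set mR) : ~ K p -> cylinder K E -> measurable B ->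
  (P (E `&` X p @^-1` B) = P E * P (X p @^-1` B))%E.
Proof.
move=> Kp [J [A [JA ->]]] mB; have [_ ind] := iid.
have pJ : p \notin undup J by rewrite mem_undup; apply/negP => /JA[].
pose A' i := if i == p then B else A i.
have mA' i : i \in p :: undup J -> measurable (A' i : set mR).
  rewrite inE mem_undup /A'; case: eqP => [_ _|_ /= /JA[]//].
  exact: mB.
have := ind (p :: undup J) A'; rewrite /= pJ undup_uniq => /(_ isT mA').
rewrite big_cons {2}/A' eqxx.
have -> : \bigcap_(i in [set` p :: undup J]) X i @^-1` A' i =
   \bigcap_(i in [set` J]) X i @^-1` A i `&` X p @^-1` B.
  apply/seteqP; split=> w.
    move=> h; split=> [i /= iJ|].
      have := h i; rewrite /= inE mem_undup iJ orbT => /(_ isT); rewrite /A'.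
      by case: eqP => // ip; move: pJ; rewrite mem_undup -ip iJ.
    by have := h p; rewrite /= inE eqxx => /(_ isT); rewrite /A' eqxx.
  move=> [h1 h2] i /=; rewrite inE mem_undup /A' => /predU1P[->|iJ].
    by rewrite eqxx.
  by case: eqP => [->//|_]; exact: h1.
move=> ->; rewrite muleC; congr (_ * _)%E.
have -> : \bigcap_(i in [set` J]) X i @^-1` A i =
   \bigcap_(i in [set` undup J]) X i @^-1` A i.
  by congr bigcap; apply/seteqP; split=> i /=; rewrite mem_undup.
rewrite (ind _ _ (undup_uniq J)); last by move=> i; rewrite mem_undup => /JA[].
apply: eq_big_seq => i iJ; rewrite /A'; case: eqP => // ip.
by move: pJ; rewrite -ip iJ.
Qed.

(** Both sides are finite measures in E which agree on the cylinders, a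
    pi-system. *)
Lemma sigma_indep K p E (B : set mR) : ~ K p -> <<s cylinder K >> E -> measurable B ->
  (P (E `&` X p @^-1` B) = P E * P (X p @^-1` B))%E.
Proof.
move=> Kp sE mB.
have mF : measurable (X p @^-1` B) by exact: measurable_funPTI.
have fP : P (X p @^-1` B) \is a fin_num by exact: fin_num_measure.
have p0 : (0 <= fine (P (X p @^-1` B)))%R by rewrite fine_ge0.
have := @g_sigma_algebra_measure_unique _ R T (cylinder K) (@cylinder_measurable K)
  (fun=> setT) (fun=> cylinder_setT K) _ (mrestr P mF) (mscale (NngNum p0) P) (@cylinderI K).
have msE A : mscale (NngNum p0) P A = (P A * P (X p @^-1` B))%E.
  by rewrite /mscale /= fineK// muleC.
move=> H; rewrite -msE; apply: H => //.
- by apply/seteqP; split=> // x _; exists 0%N.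
- by move=> A cA; apply: etrans (cylinder_indep Kp cA mB) _; exact/esym/msE.
- by move=> _; apply: le_lt_trans (probability_le1 P (measurableI _ _ measurableT mF)) (ltry _).
Qed.

Definition lin (a : I -> R) (J : seq I) : T -> R := fun w => \sum_(p <- J) a p * X p w.

Lemma measurable_lin a J : measurable_fun setT (lin a J).
Proof. by apply: measurable_sum => p; exact: measurable_funM. Qed.

Lemma sigma_lin K a J (B : set mR) : (forall p, p \in J -> K p) -> measurable B ->
  <<s cylinder K >> (lin a J @^-1` B).
Proof.
move=> JK mB.
have mJ : measurable_fun setT (lin a J : g_sigma_algebraType (cylinder K) -> mR).
  elim: J JK => [|p J IH] JK.
    rewrite (_ : lin a [::] = fun=> 0); first exact: measurable_cst.
    by apply/funext => w; rewrite /lin big_nil.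
  rewrite (_ : lin a (p :: J) = fun w => a p * X p w + lin a J w); last first.
    by apply/funext => w; rewrite /lin big_cons.
  apply: measurable_funD; last by apply: IH => q qJ; apply: JK; rewrite inE qJ orbT.
  apply: measurable_funM; first exact: measurable_cst.
  move=> _ C mC; rewrite setTI; apply: sub_sigma_algebra.
  by apply: cylinder_gen => //; apply: JK; rewrite inE eqxx.
by have := mJ measurableT B mB; rewrite setTI.
Qed.

(** By induction on J: the new term is independent of the previous sum, so the
    joint law is a product and [normal_convolution] applies.  The degenerate
    cases, a zero coefficient or a previous sum of variance 0, are Dirac
    masses and are treated apart. *)
Lemma gaussian_lin a J : uniq J ->
  gaussian_law (lin a J) (Num.sqrt (\sum_(p <- J) a p ^+ 2)).
Proof.
elim: J => [_|p J IH /= /andP[pJ uJ]].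
  move=> A mA; rewrite big_nil sqrtr0 eqxx.
  rewrite (_ : lin a [::] = fun=> 0); last by apply/funext => w; rewrite /lin big_nil.
  rewrite diracE; case: (boolP (0 \in A)) => [/set_mem A0|A0].
    by rewrite (_ : _ @^-1` _ = setT) ?probability_setT//; apply/seteqP; split.
  rewrite (_ : _ @^-1` _ = set0) ?measure0//; apply/seteqP; split=> // w /= A00.
  by move: A0; rewrite mem_set.
have {}IH := IH uJ.
have -> : lin a (p :: J) = fun w => a p * X p w + lin a J w.
  by apply/funext => w; rewrite /lin big_cons.
rewrite big_cons; set s2 := \sum_(q <- J) _ in IH *.
have s20 : 0 <= s2 by apply: sumr_ge0 => q _; exact: sqr_ge0.
have [r0|r0] := eqVneq (a p) 0.
  rewrite r0 expr0n add0r (_ : (fun w => _) = lin a J)//.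
  by apply/funext => w; rewrite mul0r add0r.
set r := a p in r0 *; pose W w := r * X p w.
have mX : measurable_fun setT (X p : T -> R) by exact: measurable_funP.
have mW : measurable_fun setT W by exact: measurable_funM.
have mZ := measurable_lin a J.
have lW : forall A : set mR, measurable A -> P (W @^-1` A) = normal_prob 0 `|r| A.
  by apply: std_scale_law => // A mA; exact: std_law.
have mD : measurable_fun setT (fun w => W w + lin a J w) by exact: measurable_funD.
have r2 : 0 < r ^+ 2 by rewrite exprn_even_gt0.
have sp : 0 < r ^+ 2 + s2 by rewrite ltr_wpDr.
move=> A mA; rewrite (gt_eqF (_ : 0 < Num.sqrt (r ^+ 2 + s2))) ?sqrtr_gt0//.
have [s0|sn] := eqVneq s2 0.
  rewrite s0 addr0 sqrtr_sqr.
  have N1 : P (lin a J @^-1` [set~ 0]) = 0%E.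
    rewrite IH; last by apply: measurableC; exact: measurable_set1.
    by rewrite s0 sqrtr0 eqxx diracE; case: (boolP (_ \in _)) => // /set_mem [].
  rewrite -lW//.
  have mN : measurable (lin a J @^-1` [set~ 0]).
    by rewrite -[X in measurable X]setTI; apply: mZ => //; apply: measurableC; exact: measurable_set1.
  have key (U V : set T) : measurable U -> measurable V ->
      U `\` lin a J @^-1` [set~ 0] `<=` V -> (P U <= P V)%E.
    move=> mU mV UV; rewrite -[leRHS]adde0 -N1.
    apply: le_trans (measureU2 P mV mN); apply: le_measure.
    - by rewrite inE.
    - by rewrite inE; exact: measurableU.
    - move=> w Uw; have [nw|nw] := pselect ((lin a J @^-1` [set~ 0]) w); first by right.
      by left; apply: UV.
  apply/eqP; rewrite eq_le; apply/andP; split; apply: key.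
  - by rewrite -[X in measurable X]setTI; apply: mD.
  - by rewrite -[X in measurable X]setTI; apply: mW.
  - by move=> w [/= h /contrapT /= h0]; move: h; rewrite ?h0 ?addr0.
  - by rewrite -[X in measurable X]setTI; apply: mW.
  - by rewrite -[X in measurable X]setTI; apply: mD.
  - by move=> w [/= h /contrapT /= h0]; rewrite ?h0 ?addr0.
pose s := Num.sqrt s2; have s0 : 0 < s by rewrite sqrtr_gt0 lt_def sn.
have -> : Num.sqrt (r ^+ 2 + s2) = Num.sqrt (s ^+ 2 + `|r| ^+ 2).
  by rewrite sqr_sqrtr// real_normK ?num_real// addrC.
move: A mA; apply: law_eq_rays => // t.
have nr0 : 0 < `|r| by rewrite normr_gt0.
apply: etrans _ (normal_convolution t s0 nr0).
have mZW : measurable_fun setT (fun w => (lin a J w, W w) : mR * mR).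
  exact: measurable_fun_pair.
pose m' : {measure set (mR * mR)%type -> \bar R} := distribution P
  (HB.pack_for {mfun T >-> (mR * mR)%type} (fun w => (lin a J w, W w) : mR * mR)
    (isMeasurableFun.Build _ _ _ _ (fun w => (lin a J w, W w) : mR * mR) mZW)).
have mS : measurable [set z : mR * mR | (z.1 + z.2 <= t)%R].
  have mf : measurable_fun setT (fun z : mR * mR => z.1 + z.2).
    by apply: measurable_funD; [exact: measurable_fst|exact: measurable_snd].
  have := mf measurableT _ (measurable_itv `]-oo, t]).
  by rewrite setTI; congr measurable; apply/seteqP; split=> z /=; rewrite in_itv.
(* The joint law of the previous sum and the new term is the product law. *)
rewrite (@product_measure_unique _ _ _ _ _ (normal_prob 0 s) (normal_prob 0 `|r|) m' _ _ mS).
  by congr (P _); apply/seteqP; split=> w /=; rewrite in_itv /= addrC.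
move=> A B mA mB.
have pK : ~ [set` J] p by apply/negP.
have sE := @sigma_lin [set` J] a J A (fun q qJ => qJ) mA.
have mB' : measurable ((fun x : R => r * x) @^-1` B : set mR).
  rewrite -[X in measurable X]setTI.
  exact: (@measurable_funM _ _ _ setT (cst r : mR -> R) (fun x : mR => x)).
apply: etrans (sigma_indep pK sE mB') _; congr (_ * _)%E; last exact: lW.
by rewrite IH// (gt_eqF s0).
Qed.

End GaussianSums.

(** * Second moments *)

Section SquareIntegrable.
Context (R : realType) (d : measure_display) (T : measurableType d).
Context (P : probability T R).
Implicit Types (Y Z : T -> R).

Definition msq Y : \bar R := (\int[P]_w ((Y w ^+ 2)%:E))%E.

Lemma expectation_msq Y : 'E_P[fun w => (Y w ^+ 2)%R]%E = msq Y.
Proof. by rewrite unlock. Qed.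

Lemma measurable_sqr Y : measurable_fun setT Y ->
  measurable_fun setT (fun w => ((Y w ^+ 2)%:E)).
Proof. by move=> mY; apply/measurable_EFinP; exact: measurable_funX. Qed.

Lemma msq_ge0 Y : (0 <= msq Y)%E.
Proof. by apply: integral_ge0 => w _; rewrite lee_fin sqr_ge0. Qed.

Lemma msqZ Y c : measurable_fun setT Y -> msq (fun w => c * Y w) = ((c ^+ 2)%:E * msq Y)%E.
Proof.
move=> mY; rewrite /msq -ge0_integralZl//.
- by apply: eq_integral => w _; rewrite exprMn EFinM.
- exact: measurable_sqr.
- by move=> w _; rewrite lee_fin sqr_ge0.
- by rewrite lee_fin sqr_ge0.
Qed.

Lemma msqD Y Z : measurable_fun setT Y -> measurable_fun setT Z ->
  (msq (fun w => Y w + Z w)%R <= 2%:E * msq Y + 2%:E * msq Z)%E.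
Proof.
move=> mY mZ; rewrite /msq -!ge0_integralZl//; try exact: measurable_sqr;
  try by move=> w _; rewrite lee_fin sqr_ge0.
rewrite -ge0_integralD//; first last.
- by apply: measurable_funeM; exact: measurable_sqr.
- by move=> w _; rewrite -EFinM lee_fin mulr_ge0 ?sqr_ge0.
- by apply: measurable_funeM; exact: measurable_sqr.
- by move=> w _; rewrite -EFinM lee_fin mulr_ge0 ?sqr_ge0.
apply: ge0_le_integral => //.
- by move=> w _; rewrite lee_fin sqr_ge0.
- by apply: measurable_sqr; exact: measurable_funD.
- by apply: emeasurable_funD; apply: measurable_funeM; exact: measurable_sqr.
- move=> w _; rewrite -!EFinM -EFinD lee_fin.
  by have := sqr_ge0 (Y w - Z w); nra.
Qed.

Lemma msq_integrable Y : measurable_fun setT Y -> (msq Y < +oo)%E ->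
  P.-integrable setT (EFin \o Y).
Proof.
move=> mY fY.
have i2 : P.-integrable setT (fun w => ((Y w ^+ 2)%:E)).
  apply/integrableP; split; first exact: measurable_sqr.
  under eq_integral do rewrite gee0_abs ?lee_fin ?sqr_ge0//.
  exact: fY.
have i1 : P.-integrable setT (fun w => 1%:E).
  exact: finite_measure_integrable_cst.
apply: (le_integrable measurableT _ _ (integrableD measurableT i1 i2)).
  exact/measurable_EFinP.
move=> w _; apply: (@le_trans _ _ `|(1 + Y w ^+ 2)%:E|%E) => //.
rewrite /= lee_fin [leRHS]ger0_norm ?addr_ge0 ?sqr_ge0//.
by rewrite ler_norml; apply/andP; split; have := sqr_ge0 (Y w - 1); have := sqr_ge0 (Y w + 1); nra.
Qed.

Lemma msq_eq0 Y : measurable_fun setT Y -> msq Y = 0%E -> {ae P, forall w, Y w = 0}.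
Proof.
move=> mY Y0.
have := (ae_eq_integral_abs P measurableT (measurable_sqr mY)).1.
under eq_integral do rewrite gee0_abs ?lee_fin ?sqr_ge0//.
move=> /(_ Y0); apply: filterS => w /(_ I) [] /eqP.
by rewrite sqrf_eq0 => /eqP.
Qed.

End SquareIntegrable.

Section Moments.
Context (R : realType) (d : measure_display) (T : measurableType d).
Context (P : probability T R).
Local Notation mR := (measurableTypeR R).
Variables (I : choiceType) (X : I -> {RV P >-> R}).
Hypothesis iid : iid_std_normal X.

Lemma msq_lin a J : uniq J -> msq P (lin X a J) = (\sum_(p <- J) a p ^+ 2)%:E.
Proof.
move=> uJ; rewrite -expectation_msq.
rewrite (gaussian_second_moment (measurable_lin X a J) _ (gaussian_lin iid a uJ)).
  by rewrite sqr_sqrtr//; apply: sumr_ge0 => p _; exact: sqr_ge0.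
exact: sqrtr_ge0.
Qed.

Lemma lin_integrable a J : uniq J -> P.-integrable setT (EFin \o lin X a J).
Proof.
by move=> uJ; apply: msq_integrable; [exact: measurable_lin|rewrite msq_lin// ltry].
Qed.

Lemma std_integrable p : P.-integrable setT (EFin \o X p).
Proof.
have := @lin_integrable (fun=> 1) [:: p] isT.
congr (integrable _ _ _); apply/funext => w.
by rewrite /= /lin big_seq1 mul1r.
Qed.

(** The positive and negative parts of X p restricted to E have the same tails:
    by independence these are the tails of X p and - X p times P E, and the
    normal law is symmetric.  The integral of a nonnegative variable depends
    only on its tails. *)
Lemma std_integral_sigma K p E : ~ K p -> <<s cylinder X K >> E ->
  (\int[P]_(w in E) (X p w)%:E = 0)%E.
Proof.
move=> Kp sE; have mE := sigma_cylinder_measurable sE.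
have mX : measurable_fun setT (X p : T -> R) by exact: measurable_funP.
(* For c = 1 and c = -1 these are the positive and negative parts. *)
pose Y (c : R) w : R := Num.max (c * X p w) 0 * \1_E w.
have mY c : measurable_fun setT (Y c).
  apply: measurable_funM; last exact: measurable_indic.
  by apply: measurable_maxr => //; exact: measurable_funM.
have Y0 c w : 0 <= Y c w by rewrite mulr_ge0// le_max lexx orbT.
have iY c : P.-integrable setT (EFin \o Y c).
  have iX := integrableZl measurableT c (std_integrable p).
  apply: (le_integrable measurableT _ _ iX); first exact/measurable_EFinP.
  move=> w _; rewrite /= lee_fin (ger0_norm (Y0 _ _)) /Y indicE.
  case: (_ \in _); rewrite ?mulr1 ?mulr0//.
  by rewrite ge_max normr_ge0 ler_norm.
pose cX (c : R) w : R := c * X p w.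
have cc c (t : R) : 0 <= t ->
    (ccdf (mkRV P (mY c)) t = P E * P (cX c @^-1` `]t, +oo[%classic))%E.
  move=> t0.
  have mc : measurable ((fun x : R => c * x) @^-1` `]t, +oo[ : set mR).
    have mm : measurable_fun setT (fun x : mR => c * x) by exact: measurable_funM.
    by have := mm measurableT _ (measurable_itv `]t, +oo[); rewrite setTI.
  apply: etrans (sigma_indep iid Kp sE mc).
  congr (P _); apply/seteqP; split=> w /=; rewrite in_itv /= andbT /Y indicE.
    case: (boolP (w \in E)) => [/set_mem Ew|_]; last by rewrite mulr0 ltNge t0.
    rewrite mulr1 lt_max => /orP[h|]; last by rewrite ltNge t0.
    by split=> //; rewrite in_itv /= h.
  by move=> [Ew]; rewrite in_itv /= andbT (mem_set Ew) mulr1 lt_max => ->.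
have E1 c : (\int[P]_w (Y c w)%:E = \int[lebesgue_measure]_(t in `[0%R, +oo[) ccdf (mkRV P (mY c)) t)%E.
  by have := @ge0_expectation_ccdf _ _ _ P (mkRV P (mY c)) (Y0 c); rewrite unlock.
have E2 : (\int[P]_w (Y 1 w)%:E = \int[P]_w (Y (-1) w)%:E)%E.
  rewrite !E1; apply: eq_integral => t; rewrite inE /= in_itv /= andbT => t0.
  rewrite !cc//; congr (_ * _)%E.
  have law1 (c : R) : `|c| = 1 -> P (cX c @^-1` `]t, +oo[%classic) = normal_prob 0 1 `]t, +oo[%classic.
    move=> c1; rewrite -[X in normal_prob 0 X]c1.
    have c0 : c != 0 by rewrite -normr_eq0 c1 oner_eq0.
    exact: (std_scale_law mX (fun A mA => std_law iid p mA) c0 (measurable_itv _)).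
  by rewrite !law1 ?normrN1 ?normr1.
rewrite integral_mkcond (_ : _ \_ E = ((EFin \o Y 1%R) \- (EFin \o Y (-1)%R))%E).
  rewrite integralB//= [X in (X - _)%E]E2 subee//.
  by apply: integrable_fin_num => //; exact: iY.
apply/funext => w; rewrite patchE /Y /= indicE mul1r mulN1r.
case: ifPn => _; last by rewrite !mulr0 sube0.
rewrite !mulr1 -EFinB; congr EFin.
by case: (lerP 0 (X p w)) => h; [rewrite max_r ?oppr_le0// subr0|rewrite max_l ?oppr_ge0 1?ltW// sub0r opprK].
Qed.

Lemma lin_integral_sigma K a J E : (forall p, p \in J -> ~ K p) ->
  <<s cylinder X K >> E -> (\int[P]_(w in E) (lin X a J w)%:E = 0)%E.
Proof.
move=> JK sE; have mE := sigma_cylinder_measurable sE.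
have iX p : P.-integrable E (EFin \o X p).
  by apply: integrableS (std_integrable p).
elim: J JK => [|p J IH] JK.
  by apply: integral0_eq => w _; rewrite /lin big_nil.
have iL J' : P.-integrable E (EFin \o lin X a J').
  elim: J' => [|q J' IJ].
    rewrite (_ : EFin \o _ = cst 0%E); first exact: integrable0.
    by apply/funext => w; rewrite /= /lin big_nil.
  rewrite (_ : EFin \o _ = ((fun w => (a q)%:E * (X q w)%:E) \+ (EFin \o lin X a J'))%E).
    exact: (integrableD mE (integrableZl mE (a q) (iX q)) IJ).
  by apply/funext => w; rewrite /= /lin big_cons.
rewrite (eq_integral ((fun w => (a p)%:E * (X p w)%:E) \+ (EFin \o lin X a J))%E).
  rewrite (integralD mE (integrableZl mE (a p) (iX p)) (iL J)) /=.
  rewrite (integralZl mE (iX p)) (std_integral_sigma _ sE); last by apply: JK; rewrite inE eqxx.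
  by rewrite mule0 add0e IH// => q qJ; apply: JK; rewrite inE qJ orbT.
by move=> w _; rewrite /= /lin big_cons.
Qed.

End Moments.

(** * Limits in mean square *)

Section L2Limit.
Context (R : realType) (d : measure_display) (T : measurableType d).
Context (P : probability T R).

(** Completeness of L^2 with a rate.  Along a fast subsequence the increments
    are summable in L^1, hence almost everywhere, and the subsequence converges
    almost everywhere; Fatou's lemma carries the bound over to the limit. *)
Lemma L2_limit (S : nat -> T -> R) (r : nat -> R) :
  (forall n, measurable_fun setT (S n)) ->
  (forall m n, (m <= n)%N -> (msq P (fun w => S n w - S m w)%R <= (r m)%:E)%E) ->
  r @ \oo --> 0 ->
  exists2 Y : T -> R, measurable_fun setT Y &
    forall n, (msq P (fun w => S n w - Y w)%R <= (r n)%:E)%E.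
Proof.
move=> mS Sr r0.
have exN k : exists N, forall m, (N <= m)%N -> r m <= 4^-1 ^+ k.
  have e0 : 0 < (4^-1 : R) ^+ k by rewrite exprn_gt0.
  have /cvgrPdist_le/(_ _ e0)[N _ HN] := r0; exists N => m /HN /=.
  by rewrite sub0r normrN; exact: le_trans (ler_norm _).
have [N HN] := choice exN.
(* Summing the N i makes the indices nondecreasing as well as large. *)
pose nk k := (\sum_(i < k.+1) (N i).+1)%N.
have nkS k : (nk k <= nk k.+1)%N by rewrite /nk [leqRHS]big_ord_recr /= leq_addr.
have nkge k : (N k <= nk k)%N.
  by rewrite /nk big_ord_recr /= (leq_trans (leqnSn _))// leq_addl.
have nkk k : (k <= nk k)%N.
  elim: k => // k IH; apply: (leq_ltn_trans IH).
  by rewrite /nk [ltnRHS]big_ord_recr /= addnS ltnS leq_addr.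
pose g k w : R := S (nk k.+1) w - S (nk k) w.
have mg k : measurable_fun setT (g k) by exact: measurable_funB.
(* |g| <= 2^k g^2 + 2^{-k}, and g k has second moment at most 4^{-k}. *)
have intg k : (\int[P]_w (`|g k w|)%:E <= (2 * 2^-1 ^+ k)%:E)%E.
  have k2 : 0 < (2 : R) ^+ k by rewrite exprn_gt0.
  apply: (@le_trans _ _ (\int[P]_w ((2 ^+ k)%:E * (g k w ^+ 2)%:E + (2^-1 ^+ k)%:E))%E).
    apply: ge0_le_integral => //.
    - by apply/measurable_EFinP; exact: measurableT_comp.
    - apply: emeasurable_funD => //; apply: measurable_funeM; exact: measurable_sqr.
    - move=> w _; rewrite -EFinM -EFinD lee_fin exprVn.
      have := sqr_ge0 (2 ^+ k * `|g k w| - 1); rewrite sqrrB1 exprMn real_normK ?num_real// => h.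
      rewrite -(ler_pM2l k2) mulrDr divff ?gt_eqF// mulrA -expr2.
      have := normr_ge0 (g k w); have := sqr_ge0 (g k w); nra.
  rewrite ge0_integralD//; first last.
  - by apply: measurable_funeM; exact: measurable_sqr.
  - by move=> w _; rewrite -EFinM lee_fin mulr_ge0 ?sqr_ge0// ltW.
  rewrite ge0_integralZl//; first last.
  - by move=> w _; rewrite lee_fin sqr_ge0.
  - exact: measurable_sqr.
  rewrite integral_cst//.
  rewrite [X in (_ + _ * X)%E](_ : _ = 1%E); last exact: probability_setT.
  rewrite mule1 mulr2n mulrDl mul1r EFinD leeD2r//.
  apply: (@le_trans _ _ ((2 ^+ k)%:E * (4^-1 ^+ k)%:E)%E).
    apply: lee_wpmul2l; first by rewrite lee_fin ltW.
    by apply: (le_trans (Sr _ _ (nkS k))); rewrite lee_fin; exact: HN.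
  by rewrite -EFinM lee_fin -exprMn (_ : 2 / 4 = 2^-1 :> R)//; field.
have sumfin : {ae P, forall w, (\sum_(0 <= k <oo) (`|g k w|)%:E < +oo)%E}.
  have mag k : measurable_fun setT (fun w => (`|g k w|)%:E).
    by apply/measurable_EFinP; exact: measurableT_comp.
  pose G w := (\sum_(0 <= k <oo) (`|g k w|)%:E)%E.
  have G0 w : (0 <= G w)%E by apply: nneseries_ge0 => k _ _; rewrite lee_fin.
  have iG : P.-integrable setT G.
    apply/integrableP; split.
      by apply: ge0_emeasurable_sum => // k w _ _; rewrite lee_fin.
    under eq_integral do rewrite gee0_abs//.
    rewrite integral_nneseries//.
    apply: (@le_lt_trans _ _ (\sum_(0 <= k <oo) (2 * 2^-1 ^+ k)%:E)%E).
      by apply: lee_nneseries => // k _ _; apply: integral_ge0 => w _; rewrite lee_fin.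
    rewrite (_ : (\sum_(0 <= k <oo) _)%E = (limn (series (geometric (2 : R) 2^-1)))%:E) ?ltry//.
    rewrite -EFin_lim; last first.
      by apply: is_cvg_geometric_series; rewrite ger0_norm// invf_lt1// ltr1n.
    congr (limn _); apply/funext => n; rewrite /= /series /=.
    by rewrite sumEFin.
  have := integrable_ae measurableT iG; apply: filterS => w /(_ I).
  by rewrite ge0_fin_numE.
have Scvg : {ae P, forall w, cvgn (fun k => S (nk k) w)}.
  apply: filterS sumfin => w fin.
  have c1 : cvgn (series (fun k => `|g k w|)).
    have [] // := @nneg_series_cvg R (fun k => `|g k w|) (fine (\sum_(0 <= k <oo) (`|g k w|)%:E)%E) _ _.
    move=> M; rewrite -lee_fin fineK; last first.
      by rewrite ge0_fin_numE// nneseries_ge0// => k _ _; rewrite lee_fin.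
    rewrite -sumEFin -(big_mkord xpredT (fun k => (`|g k w|)%:E)).
    by apply: (@nneseries_lim_ge R _ xpredT 0 M) => k _ _; rewrite lee_fin.
  have c2 := normed_cvg c1.
  have -> : (fun k => S (nk k) w) = (fun k => S (nk 0%N) w + series (g^~ w) k).
    apply/funext => k; rewrite seriesEnat /= telescope_sumr//.
    by rewrite addrC subrK.
  by apply: is_cvgD => //; exact: is_cvg_cst.
(* The upper limit is measurable and defined everywhere. *)
pose Ye w := limn_esup (fun k => (S (nk k) w)%:E).
pose Y w := fine (Ye w).
have mY : measurable_fun setT Y.
  apply: (@measurableT_comp _ _ _ _ _ _ fine); first exact: fine_measurable.
  by apply: measurable_fun_limn_esup => k; exact/measurable_EFinP.
have cvY : {ae P, forall w, (fun k => S (nk k) w) @ \oo --> Y w}.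
  apply: filterS Scvg => w cw.
  have c : (fun k => (S (nk k) w)%:E) @ \oo --> (limn (fun k => S (nk k) w))%:E.
    by apply: cvg_EFin => //; near=> k.
  by rewrite /Y /Ye (cvg_limn_einf_sup c).2 /=.
exists Y => // n.
pose f k w := (((S n w - S (nk k) w) ^+ 2)%:E).
have mf k : measurable_fun setT (f k).
  by apply: measurable_sqr; exact: measurable_funB.
have f0 k w : (0 <= f k w)%E by rewrite lee_fin sqr_ge0.
have mfi : measurable_fun setT (fun w => limn_einf (f^~ w)).
  apply: (@measurableT_comp _ _ _ _ _ _ (@oppe R)) => //.
  by apply: measurable_fun_limn_esup => k; exact: (@measurableT_comp _ _ _ _ _ _ (@oppe R)).
have -> : msq P (fun w => S n w - Y w) = (\int[P]_w limn_einf (f^~ w))%E.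
  apply: ae_eq_integral => //; first by apply: measurable_sqr; exact: measurable_funB.
  apply: filterS cvY => w cw _.
  have c : (f^~ w) @ \oo --> (((S n w - Y w) ^+ 2)%:E).
    have cB : (fun k => S n w - S (nk k) w) @ \oo --> S n w - Y w.
      exact: (cvgB (cvg_cst (S n w)) cw).
    apply: cvg_EFin; first by near=> k.
    exact: (cvgM cB cB).
  by rewrite (cvg_limn_einf_sup c).1.
apply: (le_trans (fatou P measurableT mf _)) => //.
rewrite limn_einf_lim; apply: lime_le; first exact: is_cvg_einfs.
near=> m.
apply: (@le_trans _ _ (\int[P]_w f m w)%E).
  by apply: ereal_inf_lbound; exists m => /=.
have nm : (n <= nk m)%N by apply: (leq_trans _ (nkk m)); near: m; exists n.
have := Sr _ _ nm; congr (_ <= _)%E; apply: eq_integral => w _.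
by rewrite /f -[in RHS]opprB sqrrN.
Unshelve. all: by end_near. Qed.

End L2Limit.

Section GaussianLimit.
Context (R : realType) (d : measure_display) (T : measurableType d).
Context (P : probability T R).
Local Notation mR := (measurableTypeR R).

Lemma chebyshev_msq (V : T -> R) (dl : R) : measurable_fun setT V -> 0 < dl ->
  measurable [set w | (dl <= `|V w|)%R] /\
  ((dl ^+ 2)%:E * P [set w | (dl <= `|V w|)%R] <= msq P V)%E.
Proof.
move=> mV dl0; set E := [set w | _].
have mE : measurable E.
  have mn : measurable_fun setT (fun w => `|V w|) by exact: measurableT_comp.
  have := mn measurableT _ (measurable_itv `[dl, +oo[).
  by rewrite setTI; congr measurable; apply/seteqP; split=> w /=; rewrite in_itv /= andbT.
split=> //; rewrite -(integral_cst P mE).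
have m2 := measurable_sqr mV.
apply: (@le_trans _ _ (\int[P]_(w in E) (V w ^+ 2)%:E)%E).
  apply: ge0_le_integral => //.
  - by move=> w _; rewrite lee_fin sqr_ge0.
  - exact: measurable_funTS.
  - move=> w Ew; rewrite lee_fin -(real_normK (num_real (V w))).
    by rewrite ler_pXn2r// ?nnegrE// ltW.
apply: ge0_subset_integral => //.
by move=> w _; rewrite lee_fin sqr_ge0.
Qed.

(** The density is bounded by its peak. *)
Lemma normal_ray_add (s t dl : R) : 0 < s -> 0 < dl ->
  (normal_prob 0 s `]-oo, (t + dl)%R]%classic <=
   normal_prob 0 s `]-oo, t]%classic + (normal_peak s * dl)%:E)%E.
Proof.
move=> s0 dl0; have sn : s != 0 by rewrite gt_eqF.
have -> : `]-oo, (t + dl)]%classic = `]-oo, t]%classic `|` `]t, t + dl]%classic :> set R.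
  apply/seteqP; split=> x /=; rewrite !in_itv /=.
    by case: (leP x t) => h xl; [left|right].
  by case=> [h|/andP[]//]; apply: (le_trans h); rewrite lerDl ltW.
have mI : measurable (`]t, t + dl]%classic : set mR) by exact: measurable_itv.
have mJ : measurable (`]-oo, t]%classic : set mR) by exact: measurable_itv.
apply: le_trans (measureU2 (normal_prob 0 s) mJ mI) _.
rewrite leeD2l// /normal_prob.
apply: (@le_trans _ _ (\int[lebesgue_measure]_(x in `]t, (t + dl)%R]) (normal_peak s)%:E)%E).
  apply: ge0_le_integral => //.
  - by move=> x _; rewrite lee_fin normal_pdf_ge0.
  - by apply/measurable_EFinP; apply: measurable_funTS; exact: measurable_normal_pdf.
  - by move=> x _; rewrite lee_fin normal_pdf_ub.
rewrite integral_cst//= lebesgue_measure_itv /= lte_fin ltrDl dl0.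
by rewrite -EFinB addrAC subrr add0r -EFinM.
Qed.

Lemma normal_ray_open (s t : R) : 0 < s ->
  normal_prob 0 s `]-oo, t[%classic = normal_prob 0 s `]-oo, t]%classic.
Proof.
move=> s0; rewrite /normal_prob integral_itv_bndo_bndc//.
by apply/measurable_EFinP; apply: measurable_funTS; exact: measurable_normal_pdf.
Qed.

(** If Y <= t, then either Z <= t + dl or |Z - Y| >= dl; the probability of
    the latter is small by Chebyshev's inequality, and the normal distribution
    function is continuous. *)
Lemma ray_le_limit (Y : T -> R) (s t : R) : 0 < s -> measurable_fun setT Y ->
  (forall e, 0 < e -> exists Z : T -> R, [/\ measurable_fun setT Z,
     forall t, P (Z @^-1` `]-oo, t]%classic) = normal_prob 0 s `]-oo, t]%classic &
     (msq P (fun w => Z w - Y w)%R <= e%:E)%E]) ->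
  (P (Y @^-1` `]-oo, t]%classic) <= normal_prob 0 s `]-oo, t]%classic)%E.
Proof.
move=> s0 mY H; apply/lee_addgt0Pr => e e0.
have pk0 : 0 < normal_peak s by rewrite normal_peak_gt0 ?gt_eqF.
(* This makes the bound of [normal_ray_add] equal to e / 2. *)
pose dl := e / 2 / normal_peak s.
have dl0 : 0 < dl by rewrite !divr_gt0.
have e20 : 0 < dl ^+ 2 * (e / 2) by rewrite mulr_gt0 ?exprn_gt0 ?divr_gt0.
have [Z [mZ lZ ZY]] := H _ e20.
have mV : measurable_fun setT (fun w => Z w - Y w) by exact: measurable_funB.
have [mE cE] := chebyshev_msq mV dl0.
have mZt : measurable (Z @^-1` `]-oo, t + dl]%classic).
  by rewrite -[X in measurable X]setTI; exact: mZ.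
have mYt : measurable (Y @^-1` `]-oo, t]%classic).
  by rewrite -[X in measurable X]setTI; exact: mY.
have split_ray : (P (Y @^-1` `]-oo, t]%classic) <=
    P (Z @^-1` `]-oo, (t + dl)%R]%classic) + P [set w | (dl <= `|Z w - Y w|)%R])%E.
  apply: le_trans (measureU2 P mZt mE); apply: le_measure; rewrite ?inE//.
    exact: measurableU.
  move=> w /=; rewrite !in_itv /= => Yt.
  have [h|h] := leP dl `|Z w - Y w|; [by right|left].
  by move: h; rewrite ltr_norml => /andP[_ h]; rewrite /=; lra.
apply: (le_trans split_ray).
rewrite lZ [X in (_ <= _ + X%:E)%E](splitr e) EFinD addeA; apply: leeD.
  apply: le_trans (normal_ray_add t s0 dl0) _.
  by rewrite leeD2l// lee_fin /dl mulrC divfK// gt_eqF.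
rewrite -(@lee_pmul2l _ (dl ^+ 2)%:E)// ?lte_fin ?exprn_gt0//.
by apply: (le_trans cE); apply: (le_trans ZY); rewrite -EFinM.
Qed.

(** [ray_le_limit] bounds the distribution function of Y from above, and
    applied to - Y it bounds it from below, since the normal law is symmetric
    and has no atoms. *)
Lemma gaussian_law_approx (Y : T -> R) (s : R) : 0 < s -> measurable_fun setT Y ->
  (forall e, 0 < e -> exists Z : T -> R, [/\ measurable_fun setT Z,
     forall A : set mR, measurable A -> P (Z @^-1` A) = normal_prob 0 s A &
     (msq P (fun w => Z w - Y w)%R <= e%:E)%E]) ->
  gaussian_law P Y s.
Proof.
move=> s0 mY H A mA; rewrite (gt_eqF s0); move: A mA; apply: law_eq_rays => // t.
have sn : s != 0 by rewrite gt_eqF.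
apply/eqP; rewrite eq_le; apply/andP; split.
  apply: ray_le_limit => // e /H[Z [mZ lZ ZY]]; exists Z; split=> // t'.
  by apply: lZ; exact: measurable_itv.
have mYt u (i : interval R) : i = Interval -oo%O (BSide u t) -> measurable (Y @^-1` [set` i]).
  by move=> ->; rewrite -[X in measurable X]setTI; apply: mY => //; exact: measurable_itv.
have mN : measurable_fun setT (fun w => - Y w) by exact: measurableT_comp.
have : (P ((fun w => - Y w)%R @^-1` `]-oo, (- t)%R]%classic) <= normal_prob 0 s `]-oo, (- t)%R]%classic)%E.
  apply: ray_le_limit => // e /H[Z [mZ lZ ZY]]; exists (fun w => - Z w); split=> //.
  - exact: measurableT_comp.
  - move=> t'; rewrite -normal_prob_opp// -lZ; last exact: measurable_itv.
    by congr (P _); apply/seteqP; split=> w /=; rewrite !in_itv /= andbT lerNl.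
  - congr (_ <= _)%E: ZY; apply: eq_integral => w _.
    by rewrite -opprD sqrrN.
rewrite -normal_prob_opp// opprK.
have -> : (fun w => - Y w)%R @^-1` `]-oo, - t]%classic = ~` (Y @^-1` `]-oo, t[%classic).
  by apply/seteqP; split=> w /=; rewrite !in_itv /= lerN2 leNgt => /negP.
have -> : `[t, +oo[%classic = ~` `]-oo, t[%classic :> set mR.
  by apply/seteqP; split=> x /=; rewrite !in_itv /= andbT leNgt => /negP.
have mYo : measurable (Y @^-1` `]-oo, t[%classic) by exact: (mYt true).
have mo : measurable (`]-oo, t[%classic : set mR) by exact: measurable_itv.
have cN : (normal_prob 0 s (~` `]-oo, t[%classic) = 1 - normal_prob 0 s `]-oo, t]%classic)%E.
  by rewrite -normal_ray_open//; exact: (probability_setC (normal_prob 0 s) mo).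
rewrite (probability_setC P mYo) cN.
rewrite leeD2lE// leeN2 => h; apply: (le_trans h).
apply: le_measure; rewrite ?inE//; first exact: (mYt false).
by move=> w /=; rewrite !in_itv /=; exact: ltW.
Qed.

(** A limit of variance 0 vanishes almost everywhere.  Otherwise S n is rescaled
    to have the limit variance, which moves it by |s - s_n| in mean square, and
    (s - s_n)^2 <= |s^2 - s_n^2|; then [gaussian_law_approx] applies. *)
Lemma gaussian_law_limit (S : nat -> T -> R) (Y : T -> R) (s_ q : nat -> R) (s : R) :
  (forall n, measurable_fun setT (S n)) -> measurable_fun setT Y ->
  (forall n, 0 <= s_ n) -> 0 <= s ->
  (forall n, gaussian_law P (S n) (s_ n)) ->
  (forall n, (msq P (fun w => S n w - Y w)%R <= (q n)%:E)%E) ->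
  q @ \oo --> 0 -> (fun n => s_ n ^+ 2) @ \oo --> s ^+ 2 ->
  gaussian_law P Y s.
Proof.
move=> mS mY s_0 s0 lS SY q0 ss.
have small e : 0 < e -> \forall n \near \oo, 2 * `|s ^+ 2 - s_ n ^+ 2| + 2 * q n <= e.
  move=> e0; have e4 : 0 < e / 4 by rewrite divr_gt0.
  have /cvgrPdist_le/(_ _ e4) h1 := ss; have /cvgrPdist_le/(_ _ e4) h2 := q0.
  near=> n.
  have a1 : `|s ^+ 2 - s_ n ^+ 2| <= e / 4 by near: n.
  have a2 : `|0 - q n| <= e / 4 by near: n.
  by move: a2; rewrite ler_norml => /andP[a2 _]; lra.
have msqS n : msq P (S n) = (s_ n ^+ 2)%:E.
  by rewrite -expectation_msq; exact: gaussian_second_moment.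
have [s00|sn] := eqVneq s 0.
  have Y0 : msq P Y = 0%E.
    apply/eqP; rewrite eq_le msq_ge0 andbT; apply/lee_addgt0Pr => e /small[n _ /(_ n (leqnn n)) /= he].
    have -> : msq P Y = msq P (fun w => S n w + -1 * (S n w - Y w)).
      by apply: eq_integral => w _; congr (_ ^+ 2)%:E; ring.
    have mB : measurable_fun setT (fun w => S n w - Y w) by exact: measurable_funB.
    apply: le_trans (msqD P (mS n) _) _; first exact: measurable_funM.
    rewrite msqZ// sqrrN expr1n mul1e msqS add0e.
    apply: (@le_trans _ _ (2%:E * (s_ n ^+ 2)%:E + 2%:E * (q n)%:E)%E).
      by rewrite leeD2l// lee_pmul2l.
    rewrite -!EFinM -EFinD lee_fin; apply: le_trans he.
    by rewrite s00 expr0n /= sub0r normrN ger0_norm ?sqr_ge0.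
  have Yae := msq_eq0 mY Y0.
  have key (A : set mR) : measurable A -> ~ A 0 -> P (Y @^-1` A) = 0%E.
    move=> mA nA; apply: measure_negligible.
      by rewrite -[X in measurable X]setTI; exact: mY.
    by apply: negligibleS Yae => w /= Aw; apply: contra_not nA => <-.
  move=> A mA; rewrite s00 eqxx diracE; case: (boolP (0 \in A)) => [/set_mem A0|/negP A0].
    have := key _ (measurableC mA) (fun h => h A0).
    rewrite preimage_setC probability_setC; last first.
      by rewrite -[X in measurable X]setTI; exact: mY.
    move=> h; have fA : P (Y @^-1` A) \is a fin_num.
      by apply: fin_num_measure; rewrite -[X in measurable X]setTI; exact: mY.
    move: h; rewrite -(fineK fA) -EFinB => -[] /eqP; rewrite subr_eq0 => /eqP <-.
    by [].
  by rewrite key// => h; apply: A0; exact: mem_set.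
have sp : 0 < s by rewrite lt_def sn.
apply: gaussian_law_approx => // e e0.
have s2 : 0 < s ^+ 2 / 2 by rewrite divr_gt0 ?exprn_gt0.
have h1 := small _ e0; have /cvgrPdist_lt/(_ _ s2) h2 := ss.
have [n [n1 n2]] : exists n, 2 * `|s ^+ 2 - s_ n ^+ 2| + 2 * q n <= e /\
    `|s ^+ 2 - s_ n ^+ 2| < s ^+ 2 / 2.
  have [N _ HN] := filterI h1 h2.
  by exists N; have [] := HN N (leqnn N).
(* As s_n^2 is within s^2 / 2 of s^2. *)
have sn0 : 0 < s_ n.
  rewrite lt_def s_0 andbT; apply/eqP => sn0; move: n2.
  by rewrite sn0 expr0n /= subr0 ger0_norm ?sqr_ge0//; lra.
exists (fun w => s / s_ n * S n w); split.
- exact: measurable_funM.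
- apply: law_eq_rays; first exact: measurable_funM.
  move=> t.
  have -> : (fun w => s / s_ n * S n w) @^-1` `]-oo, t]%classic =
            S n @^-1` `]-oo, t / (s / s_ n)]%classic.
    by apply/seteqP; split=> w /=; rewrite !in_itv /= ler_pdivlMr ?divr_gt0// mulrC.
  rewrite lS; last exact: measurable_itv.
  have r0 : 0 < s / s_ n by rewrite divr_gt0.
  rewrite (gt_eqF sn0) -(normal_prob_scale _ sn0 r0).
  by rewrite divfK ?gt_eqF// mulrCA divff ?gt_eqF// mulr1.
have -> : msq P (fun w => s / s_ n * S n w - Y w) =
    msq P (fun w => (s / s_ n - 1) * S n w + (S n w - Y w)).
  by apply: eq_integral => w _; congr (_ ^+ 2)%:E; ring.
have mB : measurable_fun setT (fun w => S n w - Y w) by exact: measurable_funB.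
apply: le_trans (msqD P _ mB) _; first exact: measurable_funM.
rewrite msqZ// msqS.
apply: (@le_trans _ _ (2%:E * (((s / s_ n - 1) ^+ 2)%:E * (s_ n ^+ 2)%:E) + 2%:E * (q n)%:E)%E).
  by rewrite leeD2l// lee_pmul2l.
rewrite -!EFinM -EFinD lee_fin; apply: le_trans n1.
rewrite lerD2r ler_pM2l// -exprMn mulrBl divfK ?gt_eqF// mul1r.
rewrite subr_sqr normrM -(real_normK (num_real (s - s_ n))) expr2.
apply: ler_wpM2l => //; rewrite [leRHS]ger0_norm ?addr_ge0//.
by apply: le_trans (ler_normB _ _) _; rewrite !ger0_norm.
Unshelve. all: by end_near. Qed.

End GaussianLimit.

(** * The Haar series *)

Section HaarLabels.

(** All the Haar functions, of any level, as a single index type for the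
    independent variables. *)
Definition haar_label : choiceType := {k : nat & haar_index k}.

Definition labels (ks : seq nat) : seq haar_label :=
  flatten [seq [seq (Tagged (fun k => haar_index k) i : haar_label) | i <- enum (haar_index k)] | k <- ks].

Lemma big_labels (R : realType) ks (F : haar_label -> R) :
  \sum_(p <- labels ks) F p =
  \sum_(k <- ks) \sum_(i : haar_index k) F (Tagged (fun k => haar_index k) i).
Proof.
by rewrite big_flatten big_map; apply: eq_bigr => k _; rewrite big_map big_enum.
Qed.

Lemma labels_tag ks p : p \in labels ks -> tag p \in ks.
Proof. by move=> /flatten_mapP[k kks /mapP[i _ ->]]. Qed.

Lemma labels_uniq ks : uniq ks -> uniq (labels ks).
Proof.
elim: ks => //= k ks IH /andP[kks /IH uks].
rewrite /labels /= cat_uniq -/(labels ks) uks andbT; apply/andP; split.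
  rewrite map_inj_uniq ?enum_uniq// => i j /eqP; rewrite eq_Tagged /= => /eqP.
  by [].
apply/hasPn => p /labels_tag pks; apply/mapP => -[i _ pE].
by move: kks; rewrite pE /= in pks; rewrite pks.
Qed.

Lemma labels_cat ks ks' : labels (ks ++ ks') = labels ks ++ labels ks'.
Proof. by rewrite /labels map_cat flatten_cat. Qed.

End HaarLabels.

Section HaarSeries.
Context (R : realType) (d : measure_display) (T : measurableType d).
Context (P : probability T R).
Local Notation R4 := (R * R * R * R)%type.
Variables (phi : nat -> R4 -> R) (lam : nat -> R).
Variable xi : forall k : nat, haar_index k -> {RV P >-> R}.
Hypothesis Hphi : laplace_eigenbasis phi lam.
Hypothesis Hxi : iid_std_normal (fun p : {k : nat & haar_index k} => @xi (tag p) (tagged p)).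

Let X (p : haar_label) : {RV P >-> R} := @xi (tag p) (tagged p).

Let iidX : iid_std_normal X. Proof. exact: Hxi. Qed.

Definition haar_coefs k (i : haar_index k) : nat -> R := coefs phi (haar i).

Let bessel : forall l N (v : nat -> R),
  \sum_(k < l) \sum_(i : haar_index k) (\sum_(j < N) v j * haar_coefs i j) ^+ 2
  <= \sum_(j < N) v j ^+ 2.
Proof. exact: (haar_bessel Hphi). Qed.

(** Bessel's inequality tested on the j-th unit sequence bounds the sums by 1,
    and [haar_mass_ge] gives the matching lower bound. *)
Lemma haar_mass_cvg j : (0 < j)%N ->
  (fun l => \sum_(k < l) \sum_(i : haar_index k) haar_coefs i j ^+ 2) @ \oo --> (1 : R).
Proof.
move=> j0.
apply: (@squeeze_cvgr _ _ _ _ (fun l => 1 - energy_const R * 4 ^- l * lam j) (fun=> 1)).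
- apply: nearW => l; apply/andP; split; first exact: (haar_mass_ge Hphi).
  have := bessel l j.+1 (unit_coef j).
  have sel (f : nat -> R) : \sum_(n < j.+1) unit_coef j n * f n = f j.
    rewrite big_ord_recr /= /unit_coef eqxx mul1r big1 ?add0r// => n _.
    by rewrite (ltn_eqF (ltn_ord n)) mul0r.
  have -> : \sum_(n < j.+1) unit_coef j n ^+ 2 = 1 :> R.
    by under eq_bigr do rewrite expr2; rewrite sel /unit_coef eqxx.
  by under eq_bigr do under eq_bigr do rewrite sel.
- have c4 : `|4^-1 : R| < 1 by rewrite ger0_norm// invf_lt1// ltr1n.
  have h : (fun l => energy_const R * lam j * 4^-1 ^+ l) @ \oo --> energy_const R * lam j * 0.
    exact: (cvgM (cvg_cst _) (cvg_expr c4)).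
  rewrite mulr0 in h; have h1 := cvgB (cvg_cst (1 : R)) h; rewrite subr0 in h1.
  rewrite (_ : (fun l => _) = (fun l => 1 - energy_const R * lam j * 4^-1 ^+ l)).
    exact: h1.
  by apply/funext => l; rewrite exprVn mulrAC.
- exact: cvg_cst.
Qed.

Let haar_l2 k (i : haar_index k) : l2 (haar_coefs i).
Proof. exact: (row_l2 bessel). Qed.

(** The coefficient of the variable of label p in the pairing of the Haar
    series with u, since <u, G eta> = <G u, eta>. *)
Definition series_coef (u : nat -> R) (p : haar_label) : R :=
  Num.sqrt 8 * pi * pairing (green lam u) (haar_coefs (tagged p)).

Definition series_const : R := 8 * pi ^+ 2.

Definition partial_field u l : T -> R := lin X (series_coef u) (labels (iota 0 l)).

Let energy := row_energy haar_coefs.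
Let defect := row_defect haar_coefs.

Lemma series_coef_energy u m n : (m <= n)%N ->
  \sum_(p <- labels (iota m (n - m))) series_coef u p ^+ 2 =
  series_const * (energy n (green lam u) - energy m (green lam u)).
Proof.
move=> mn; rewrite big_labels /energy /row_energy.
rewrite -(big_mkord xpredT (fun k => \sum_(i : haar_index k) pairing (green lam u) (haar_coefs i) ^+ 2)).
rewrite -(big_mkord xpredT (fun k => \sum_(i : haar_index k) pairing (green lam u) (haar_coefs i) ^+ 2)).
rewrite (big_cat_nat (leq0n _) mn)/= addrAC subrr add0r mulr_sumr.
apply: eq_bigr => k _; rewrite mulr_sumr; apply: eq_bigr => i _.
by rewrite /series_coef /= exprMn exprMn sqr_sqrtr.
Qed.

Lemma partial_field_split u m n : (m <= n)%N ->
  partial_field u n = fun w => partial_field u m w + lin X (series_coef u) (labels (iota m (n - m))) w.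
Proof.
move=> mn; apply/funext => w; rewrite /partial_field /lin -big_cat -labels_cat.
by rewrite -[X in iota _ (n - X)]add0n -iotaD subnKC.
Qed.

Lemma measurable_partial_field u n : measurable_fun setT (partial_field u n).
Proof. exact: measurable_lin. Qed.

Lemma msq_partial_field u m n : (m <= n)%N -> l2 (green lam u) ->
  (msq P (fun w => partial_field u n w - partial_field u m w)%R
   <= (series_const * defect m (green lam u))%:E)%E.
Proof.
move=> mn lu.
have -> : (fun w => partial_field u n w - partial_field u m w) =
    lin X (series_coef u) (labels (iota m (n - m))).
  by apply/funext => w; rewrite (partial_field_split u mn) addrAC subrr add0r.
rewrite (msq_lin iidX _ (labels_uniq (iota_uniq _ _))) lee_fin series_coef_energy//.
rewrite ler_wpM2l//; first by rewrite mulr_ge0 ?sqr_ge0.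
by rewrite lerD2r (row_energy_le bessel).
Qed.

Lemma defect_cvg0 u : l2 (green lam u) ->
  (fun l => series_const * defect l (green lam u)) @ \oo --> 0.
Proof.
move=> lu; rewrite -(mulr0 series_const); apply: (cvgM (cvg_cst _)).
exact: (row_parseval bessel haar_mass_cvg lu (green_zero lam u)).
Qed.

(** The trivial choice where the Green transform is not square summable makes
    h a total function of u. *)
Lemma partial_field_limit u : exists Y : {RV P >-> R}, l2 (green lam u) ->
  forall n, (msq P (fun w => partial_field u n w - Y w)%R
    <= (series_const * defect n (green lam u))%:E)%E.
Proof.
have [lu|nlu] := pselect (l2 (green lam u)); last by exists (mkRV P (measurable_cst (0 : R))).
have [|m n mn||Y mY HY] := @L2_limit R d T P (partial_field u)
  (fun n => series_const * defect n (green lam u)).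
- exact: measurable_partial_field.
- exact: msq_partial_field.
- exact: defect_cvg0.
by exists (mkRV P mY).
Qed.

Lemma sobolev_green u : sobolev lam (- 2) u -> l2 (green lam u).
Proof. exact: (sobolev_green_l2 (lam_gt0 Hphi) (eigen_mono Hphi)). Qed.

Lemma haar_field_sum ks w : (fun j => \sum_(k <- ks) haar_level xi phi lam k w j) =
  green lam (fun j => \sum_(p <- labels ks) (Num.sqrt 8 * pi * X p w) * haar_coefs (tagged p) j).
Proof.
apply/funext => j; rewrite /haar_level {2}/green.
have [j0|j0] := eqVneq j 0%N.
  rewrite big1// => k _; rewrite big1 ?mulr0// => i _.
  by rewrite /green j0 eqxx mulr0.
rewrite big_labels mulr_suml; apply: eq_bigr => k _.
rewrite mulr_sumr mulr_suml; apply: eq_bigr => i _.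
by rewrite /green (negbTE j0) /= !mulrA.
Qed.

Lemma pairing_haar_field u ks w : l2 (green lam u) ->
  pairing u (fun j => \sum_(k <- ks) haar_level xi phi lam k w j) =
  lin X (series_coef u) (labels ks) w.
Proof.
move=> lu; rewrite haar_field_sum pairing_green pairing_sumr//.
by apply: eq_bigr => p _; rewrite /series_coef; ring.
Qed.

Lemma pairing_partial_field u l w : l2 (green lam u) ->
  pairing u (haar_field xi phi lam l w) = partial_field u l w.
Proof.
move=> lu; rewrite /partial_field -pairing_haar_field//; congr pairing.
apply/funext => j; rewrite /haar_field.
by rewrite -(big_mkord xpredT (fun k => haar_level xi phi lam k w j)) /index_iota subn0.
Qed.

Lemma pairing_level_sum u l w : l2 (green lam u) ->
  \sum_(k < l) pairing u (haar_level xi phi lam k w) = partial_field u l w.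
Proof.
move=> lu; rewrite /partial_field /lin big_labels.
rewrite -(big_mkord xpredT (fun k => pairing u (haar_level xi phi lam k w))) /index_iota subn0.
apply: eq_bigr => k _.
have := @pairing_haar_field u [:: k] w lu.
rewrite /lin big_labels big_seq1 => <-; congr pairing.
by apply/funext => j; rewrite big_seq1.
Qed.

Section Limit.
Variable h : (nat -> R) -> {RV P >-> R}.
Hypothesis hP : forall u, l2 (green lam u) -> forall n,
  (msq P (fun w => partial_field u n w - h u w)%R
    <= (series_const * defect n (green lam u))%:E)%E.

Lemma partial_field_cvg u : l2 (green lam u) ->
  (fun l => msq P (fun w => partial_field u l w - h u w)) @ \oo --> 0%E.
Proof.
move=> lu; apply: ereal_squeeze0 (hP lu) (defect_cvg0 lu) => l.
exact: msq_ge0.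
Qed.

(** The gap between the two sides differs from a combination of the three
    approximation errors by the corresponding identity for partial sums, which
    is exact; so its second moment is 0. *)
Lemma limit_linear (a b : R) u v : sobolev lam (- 2) u -> sobolev lam (- 2) v ->
  {ae P, forall w, h (fun j => a * u j + b * v j) w = a * h u w + b * h v w}.
Proof.
move=> su sv; have lu := sobolev_green su; have lv := sobolev_green sv.
pose z : nat -> R := fun j => a * u j + b * v j.
have lz : l2 (green lam z) by apply: sobolev_green; exact: sobolev_lin.
have mh u' : measurable_fun setT (h u' : T -> R) by exact: measurable_funP.
have lin_field n w : partial_field z n w = a * partial_field u n w + b * partial_field v n w.
  rewrite /partial_field /lin !mulr_sumr -big_split /=; apply: eq_bigr => p _.
  rewrite /series_coef green_lin pairingDl//; try exact: l2Z.
  by rewrite !pairingZl//; ring.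
pose dz n w := partial_field z n w - h z w.
pose du n w := partial_field u n w - h u w.
pose dv n w := partial_field v n w - h v w.
have md u' n : measurable_fun setT (fun w => partial_field u' n w - h u' w).
  by apply: measurable_funB => //; exact: measurable_partial_field.
(* gap = - dz + a du + b dv. *)
pose gap w := h z w - (a * h u w + b * h v w).
have mgap : measurable_fun setT gap.
  by apply: measurable_funB => //; apply: measurable_funD; exact: measurable_funM.
pose r n := 2 * (series_const * defect n (green lam z)) +
  2 * (2 * (a ^+ 2 * (series_const * defect n (green lam u))) +
       2 * (b ^+ 2 * (series_const * defect n (green lam v)))).
have gapr n : (msq P gap <= (r n)%:E)%E.
  have -> : msq P gap = msq P (fun w => -1 * dz n w + (a * du n w + b * dv n w)).
    by apply: eq_integral => w _; rewrite /gap /dz /du /dv lin_field; congr (_ ^+ 2)%:E; ring.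
  apply: le_trans (msqD P _ _) _.
  - by apply: measurable_funM => //; exact: md.
  - by apply: measurable_funD; apply: measurable_funM => //; exact: md.
  rewrite /r [leRHS]EFinD; apply: leeD.
    rewrite msqZ; last exact: md.
    by rewrite sqrrN expr1n mul1e [leRHS]EFinM lee_pmul2l//; exact: hP.
  rewrite [leRHS]EFinM lee_pmul2l//; apply: le_trans (msqD P _ _) _.
  - by apply: measurable_funM => //; exact: md.
  - by apply: measurable_funM => //; exact: md.
  rewrite [leRHS]EFinD; apply: leeD; rewrite [leRHS]EFinM lee_pmul2l// msqZ; try exact: md.
    by rewrite [leRHS]EFinM; apply: lee_wpmul2l; [rewrite lee_fin sqr_ge0|exact: hP].
  by rewrite [leRHS]EFinM; apply: lee_wpmul2l; [rewrite lee_fin sqr_ge0|exact: hP].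
have r0 : r @ \oo --> 0.
  have cz := defect_cvg0 lz; have cu := defect_cvg0 lu; have cv := defect_cvg0 lv.
  have c (k : R) (f : nat -> R) : f @ \oo --> 0 -> (fun n => k * f n) @ \oo --> 0.
    by move=> cf; rewrite -(mulr0 k); exact: (cvgM (cvg_cst k) cf).
  have cD (f g : nat -> R) : f @ \oo --> 0 -> g @ \oo --> 0 -> (fun n => f n + g n) @ \oo --> 0.
    by move=> cf cg; rewrite -(addr0 (0 : R)); exact: (cvgD cf cg).
  by apply: (cD); [apply: (c)|apply: (c); apply: (cD); apply: (c); exact: (c)].
have gap0 : msq P gap = 0%E.
  have cgap : (fun=> msq P gap) @ \oo --> 0%E by apply: ereal_squeeze0 gapr r0 => _; exact: msq_ge0.
  by have := cvg_unique _ cgap (cvg_cst _); move=> ->.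
apply: filterS (msq_eq0 mgap gap0) => w /eqP.
by rewrite subr_eq0 => /eqP.
Qed.

(** The variances of the partial sums are 8 pi^2 times the row energies and
    increase to the biharmonic form. *)
Lemma limit_gaussian u : sobolev lam (- 2) u ->
  0 <= biharmonic_form lam u u /\ gaussian_law P (h u) (Num.sqrt (biharmonic_form lam u u)).
Proof.
move=> su; have lu := sobolev_green su.
have B0 : 0 <= biharmonic_form lam u u.
  by rewrite biharmonic_form_green// mulr_ge0 ?pairing_self_ge0// mulr_ge0 ?sqr_ge0.
split=> //.
pose s n := Num.sqrt (\sum_(p <- labels (iota 0 n)) series_coef u p ^+ 2).
apply: (@gaussian_law_limit R d T P (partial_field u) _ s
  (fun n => series_const * defect n (green lam u))) => //.
- exact: measurable_partial_field.
- by move=> n; exact: sqrtr_ge0.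
- by move=> n; apply: gaussian_lin iidX _ _ (labels_uniq (iota_uniq _ _)).
- exact: hP.
- exact: defect_cvg0.
- rewrite sqr_sqrtr// biharmonic_form_green// -/series_const.
  have c := cvgB (cvg_cst (series_const * pairing (green lam u) (green lam u))) (defect_cvg0 lu).
  rewrite subr0 in c; rewrite (_ : (fun n => _) = (fun n =>
    series_const * pairing (green lam u) (green lam u) - series_const * defect n (green lam u))).
    exact: c.
  apply/funext => n; rewrite /s sqr_sqrtr; last by apply: sumr_ge0 => p _; exact: sqr_ge0.
  have := @series_coef_energy u 0 n (leq0n n); rewrite subn0 => ->.
  rewrite /defect /row_defect /energy /row_energy big_ord0; ring.
Qed.

Lemma limit_biharmonic : biharmonic_field lam h.
Proof.
split; first exact: limit_linear.
  move=> u su; have [_ g] := limit_gaussian su.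
  by exists (Num.sqrt (biharmonic_form lam u u)); [exact: sqrtr_ge0|exact: g].
move=> u su; have [B0 g] := limit_gaussian su.
rewrite (gaussian_second_moment _ _ g) ?sqrtr_ge0 ?sqr_sqrtr//.
Qed.

Lemma limit_series_sum : haar_series_sum xi phi lam h.
Proof.
move=> u su; have lu := sobolev_green su.
apply: cvg_trans (partial_field_cvg lu); apply: near_eq_cvg; apply: nearW => l.
rewrite expectation_msq; apply: eq_integral => w _.
by rewrite pairing_level_sum.
Qed.

(** A bound for the j-th term of the expected squared distance to the partial sum
    of level l; it is dominated, uniformly in l, by a multiple of
    [weyl_term]. *)
Definition sobolev_error (eps : R) l j : R :=
  series_const * weyl_term lam eps j * defect l (unit_coef j).

Let unit_l2 j : l2 (unit_coef j : nat -> R). Proof. exact: l2_unit_coef. Qed.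

Lemma defect_unit_le1 l j : 0 <= defect l (unit_coef j) <= 1.
Proof.
rewrite (row_defect_ge0 bessel)//=.
rewrite /defect /row_defect pairing_unit_coef /unit_coef eqxx gerBl.
by apply: sumr_ge0 => k _; apply: sumr_ge0 => i _; exact: sqr_ge0.
Qed.

Lemma sobolev_error_le eps l j :
  0 <= sobolev_error eps l j <= series_const * weyl_term lam eps j.
Proof.
have c0 : 0 <= series_const * weyl_term lam eps j.
  by rewrite mulr_ge0 ?weyl_term_ge0// mulr_ge0 ?sqr_ge0.
have /andP[d0 d1] := defect_unit_le1 l j.
by rewrite /sobolev_error mulr_ge0//= ler_piMr.
Qed.

Lemma sobolev_error_cvg0 eps j : (fun l => sobolev_error eps l j) @ \oo --> 0.
Proof.
have [->|j0] := posnP j.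
  rewrite (_ : (fun l => _) = cst 0); first exact: cvg_cst.
  by apply/funext => l; rewrite /sobolev_error /weyl_term eqxx mulr0 mul0r.
rewrite -(mulr0 (series_const * weyl_term lam eps j)); apply: (cvgM (cvg_cst _)).
exact: (row_defect_unit haar_mass_cvg j0).
Qed.

Lemma weyl_const_summable eps : 0 < eps -> cvgn (series (fun j => series_const * weyl_term lam eps j)).
Proof.
move=> e0; rewrite (_ : (fun j => _) = series_const *: (weyl_term lam eps : nat -> R)).
  apply: is_cvg_seriesZ; apply: weyl_summable => //.
  - exact: eigen_mono Hphi.
  - exact: weyl_lower_bound Hphi.
by apply/funext => j.
Qed.

Definition sobolev_dist (eps : R) l w : \bar R :=
  sobolev_sqnorm lam (- eps) (fun j => haar_field xi phi lam l w j - realization h w j)%R.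

Let sobolev_term (eps : R) l j w : R :=
  (1 + lam j) `^ (- eps) * (partial_field (unit_coef j) l w - h (unit_coef j) w) ^+ 2.

Let sobolev_distE eps l w : sobolev_dist eps l w = (\sum_(0 <= j <oo) (sobolev_term eps l j w)%:E)%E.
Proof.
apply: eq_eseriesr => j _; rewrite /sobolev_term -pairing_partial_field ?pairing_unit_coef//.
by apply: sobolev_green; exact: sobolev_unit_coef.
Qed.

Let sobolev_term_ge0 eps l j w : 0 <= sobolev_term eps l j w.
Proof. by rewrite mulr_ge0 ?powR_ge0 ?sqr_ge0. Qed.

Let measurable_sobolev_term eps l j : measurable_fun setT (fun w => (sobolev_term eps l j w)%:E).
Proof.
apply/measurable_EFinP; apply: measurable_funM => //; apply: measurable_funX.
by apply: measurable_funB; [exact: measurable_partial_field|exact: measurable_funP].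
Qed.

Lemma measurable_sobolev_dist eps l : measurable_fun setT (sobolev_dist eps l).
Proof.
rewrite (_ : sobolev_dist eps l = fun w => (\sum_(0 <= j <oo) (sobolev_term eps l j w)%:E)%E).
  by apply: ge0_emeasurable_sum => // j w _ _; rewrite lee_fin.
by apply/funext => w; exact: sobolev_distE.
Qed.

(** The integral and the sum over j are exchanged, and the j-th term is the mean
    square error for u = phi_j, whose Green transform is (lam j)^{-1} times the
    unit sequence. *)
Lemma integral_sobolev_dist_le eps l (C : R) :
  (forall N, \sum_(j < N) sobolev_error eps l j <= C) ->
  (\int[P]_w sobolev_dist eps l w <= C%:E)%E.
Proof.
move=> HC; under eq_integral do rewrite sobolev_distE.
rewrite integral_nneseries//; last by move=> j w _; rewrite lee_fin.
apply: (@le_trans _ _ (\sum_(0 <= j <oo) (sobolev_error eps l j)%:E)%E); last first.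
  by apply: nneseries_le_bound => // j; have /andP[] := sobolev_error_le eps l j.
apply: lee_nneseries => [j _ _|j _].
  by apply: integral_ge0 => w _; rewrite lee_fin.
have le2 : l2 (green lam (unit_coef j)) by apply: sobolev_green; exact: sobolev_unit_coef.
have m2 : measurable_fun setT (fun w =>
    ((partial_field (unit_coef j) l w - h (unit_coef j) w) ^+ 2)%:E).
  apply: measurable_sqr.
  by apply: measurable_funB; [exact: measurable_partial_field|exact: measurable_funP].
rewrite /sobolev_term; under eq_integral do rewrite EFinM.
rewrite ge0_integralZl//; [|by move=> w _; rewrite lee_fin sqr_ge0|by rewrite lee_fin powR_ge0].
apply: (@le_trans _ _ (((1 + lam j) `^ (- eps))%:E *
    (series_const * defect l (green lam (unit_coef j)))%:E)%E).
  by apply: lee_wpmul2l; [rewrite lee_fin powR_ge0|exact: hP].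
rewrite -EFinM lee_fin green_unit_coef /defect row_defectZ// /sobolev_error /weyl_term.
rewrite le_eqVlt; apply/orP; left; apply/eqP.
by case: eqP => _; [rewrite expr0n /=|rewrite exprVn]; rewrite /defect; ring.
Qed.

Lemma sobolev_dist_cvg0 eps : 0 < eps ->
  (fun l => (\int[P]_w sobolev_dist eps l w)%E) @ \oo --> 0%E.
Proof.
move=> eps0; apply: ereal_cvg0 => [l|e e0].
  by apply: integral_ge0 => w _; rewrite sobolev_distE; apply: nneseries_ge0 => j _ _; rewrite lee_fin.
have := series_dominated (sobolev_error_le eps) (weyl_const_summable eps0) (sobolev_error_cvg0 eps) e0.
by apply: filterS => l; exact: integral_sobolev_dist_le.
Qed.

(** At l = 0 the partial sum is 0, so the expected squared norm of the
    realization is the expected squared distance, which is finite. *)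
Lemma realization_sobolev_ae eps : 0 < eps ->
  {ae P, forall w, sobolev lam (- eps) (realization h w)}.
Proof.
move=> eps0.
pose C := limn (series (fun j => series_const * weyl_term lam eps j)).
have E0 w : sobolev_dist eps 0 w = sobolev_sqnorm lam (- eps) (realization h w).
  apply: eq_eseriesr => j _; congr (_ * _)%:E.
  by rewrite /haar_field big_ord0 sub0r sqrrN.
have fin : (\int[P]_w sobolev_dist eps 0 w <= C%:E)%E.
  apply: integral_sobolev_dist_le => N.
  apply: (@le_trans _ _ (\sum_(j < N) series_const * weyl_term lam eps j)).
    by apply: ler_sum => j _; have /andP[] := sobolev_error_le eps 0 j.
  apply: nneg_partial_le (weyl_const_summable eps0) => j.
  by have /andP[] := sobolev_error_le eps 0 j; exact: le_trans.
have D0 w : (0 <= sobolev_dist eps 0 w)%E.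
  by rewrite sobolev_distE; apply: nneseries_ge0 => j _ _; rewrite lee_fin.
have iD : P.-integrable setT (sobolev_dist eps 0).
  apply/integrableP; split; first exact: measurable_sobolev_dist.
  under eq_integral do rewrite gee0_abs//.
  exact: le_lt_trans fin (ltry _).
have := integrable_ae measurableT iD; apply: filterS => w /(_ I).
by rewrite ge0_fin_numE// E0.
Qed.

(** The Sobolev spaces decrease with the exponent, so countably many values of
    eps suffice. *)
Lemma realization_sobolev :
  {ae P, forall w, forall eps : R, 0 < eps -> sobolev lam (- eps) (realization h w)}.
Proof.
have H n : {ae P, forall w, sobolev lam (- (n.+1%:R^-1 : R)) (realization h w)}.
  by apply: realization_sobolev_ae; rewrite invr_gt0.
apply: filterS (ae_foralln H) => w Hw eps eps0.
have [n hn] : exists n, n.+1%:R^-1 <= eps.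
  exists (Num.bound eps^-1); rewrite -[leRHS]invrK lef_pV2 ?posrE ?invr_gt0//.
  have eps1 : 0 <= eps^-1 by rewrite invr_ge0 ltW.
  by apply: ltW; apply: (lt_trans (archi_boundP eps1)); rewrite ltr_nat.
by apply: (sobolev_mono (lam_ge0 Hphi) _ (Hw n)); rewrite lerN2.
Qed.

End Limit.

Lemma haar_filtrationE l :
  haar_filtration xi l = <<s cylinder X [set p | (tag p < l)%N] >>.
Proof.
rewrite /haar_filtration; set G := (X in <<s X>> = _); apply/seteqP; split.
  apply: smallest_sub; first exact: smallest_sigma_algebra.
  move=> _ [k [i [B [kl mB ->]]]]; apply: sub_sigma_algebra.
  exact: (@cylinder_gen _ _ _ P _ X _ (Tagged (fun k => haar_index k) i : haar_label)).
apply: smallest_sub; first exact: smallest_sigma_algebra.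
move=> _ [J [A [JA ->]]].
have : measurable (\bigcap_(p in [set` J]) (X p @^-1` A p) : set (g_sigma_algebraType G)).
  apply: fin_bigcap_measurable => // p /= pJ; have [pl mA] := JA p pJ.
  by apply: sub_sigma_algebra; exists (tag p), (tagged p), (A p).
by [].
Qed.

(** The increments are combinations of variables whose levels are at least m,
    to which [lin_integral_sigma] applies. *)
Lemma partial_field_martingale u : martingale P (haar_filtration xi) (partial_field u).
Proof.
split.
- move=> n B mB; rewrite haar_filtrationE; apply: sigma_lin => // p /labels_tag.
  by rewrite mem_iota.
- by move=> n; apply: (lin_integrable iidX _ (labels_uniq (iota_uniq _ _))).
- move=> m n A mn; rewrite haar_filtrationE => sA.
  have mA := sigma_cylinder_measurable sA.
  have iL ks : uniq ks -> P.-integrable A (EFin \o lin X (series_coef u) (labels ks)).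
    move=> uks; apply: (integrableS measurableT) => //.
    exact: (lin_integrable iidX _ (labels_uniq uks)).
  rewrite (partial_field_split u mn); under eq_integral do rewrite EFinD.
  rewrite (integralD mA (iL _ (iota_uniq _ _)) (iL _ (iota_uniq _ _))).
  rewrite [X in (_ + X)%E](lin_integral_sigma iidX _ _ sA) ?adde0// => p /labels_tag.
  by rewrite mem_iota => /andP[h _] /=; rewrite ltnNge h.
Qed.

Lemma partial_field_centered u : centered P (partial_field u).
Proof.
move=> n; rewrite unlock.
have sT : <<s cylinder X set0 >> setT by apply: sub_sigma_algebra; exact: cylinder_setT.
by rewrite (lin_integral_sigma iidX _ _ sT)// => p _ [].
Qed.

Lemma partial_field_bounded u : l2 (green lam u) -> L2_bounded P (partial_field u).
Proof.
move=> lu; exists (series_const * defect 0 (green lam u)) => n.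
rewrite expectation_msq.
have := msq_partial_field (leq0n n) lu; congr (_ <= _)%E; apply: eq_integral => w _.
by rewrite [X in _ - X](_ : _ = 0) ?subr0// /partial_field /lin big_nil.
Qed.

End HaarSeries.

Theorem theorem8 (R : realType) (d : measure_display) (T : measurableType d)
    (P : probability T R)
    (phi : nat -> R * R * R * R -> R) (lam : nat -> R)
    (xi : forall k : nat, haar_index k -> {RV P >-> R}) :
  laplace_eigenbasis phi lam ->
  iid_std_normal (fun p : {k : nat & haar_index k} => xi (tag p) (tagged p)) ->
  exists h : (nat -> R) -> {RV P >-> R},
    [/\ haar_series_sum xi phi lam h /\ biharmonic_field lam h,
        forall eps : R, 0 < eps ->
          (fun l => (\int[P]_w sobolev_sqnorm lam (- eps)
             (fun j => haar_field xi phi lam l w j - realization h w j)%R)%E)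
            @ \oo --> 0%E,
        {ae P, forall w, forall eps : R, 0 < eps ->
           sobolev lam (- eps) (realization h w)}
      & forall u, sobolev lam (- 2) u ->
          let X := fun (l : nat) (w : T) =>
            pairing u (haar_field xi phi lam l w) in
          [/\ martingale P (haar_filtration xi) X,
              centered P X,
              L2_bounded P X
            & (fun l => 'E_P[fun w => ((X l w - h u w) ^+ 2)%R]%E)
                @ \oo --> 0%E]].
Proof.
move=> Hphi Hxi.
have [h hP] := choice (partial_field_limit Hphi Hxi).
exists h; split.
- split; first exact: limit_series_sum hP.
  exact: limit_biharmonic hP.
- by move=> eps eps0; exact: sobolev_dist_cvg0 hP _ eps0.
- exact: realization_sobolev hP.
- move=> u su X; have lu := sobolev_green Hphi su.
  have -> : X = partial_field phi lam xi u.
    by apply/funext => l; apply/funext => w; exact: pairing_partial_field.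
  split.
  + exact: partial_field_martingale.
  + exact: partial_field_centered.
  + exact: partial_field_bounded.
  + by under eq_fun do rewrite expectation_msq; exact: partial_field_cvg hP _ lu.
Qed.
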